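(* Let $\Lambda$ be a topological $k$-graph. The product system $X=\bigsqcup_{n\in\mathbb N^k}X_n$ over $\mathbb N^k$ associated to $\Lambda$ (defined in the context) is compactly aligned if and only if $\Lambda$ is compactly aligned.
   Context: Topological $k$-graphs. A topological $k$-graph is a pair $(\Lambda,d)$: $\Lambda$ is a small category with a second countable locally compact Hausdorff topology such that composition is continuous and open, the range map $r$ is continuous and the source map $s$ is a local homeomorphism, and $d:\Lambda\to\mathbb N^k$ is a continuous functor such that if $d(\lambda)=m+n$ there are unique $\mu,\nu$ with $d(\mu)=m$, $d(\nu)=n$, $\lambda=\mu\nu$. $\Lambda^m=d^{-1}(m)$. For $0\le m\le n\le d(\lambda)$, $\lambda(m,n)$ is the unique path of degree $n-m$ with $\lambda=\mu\lambda(m,n)\nu$, $d(\mu)=m$. For $U,V\subset\Lambda$, $UV=\{\lambda\mu:\lambda\in U,\mu\in V,s(\lambda)=r(\mu)\}$. For $U\subset\Lambda^p$, $V\subset\Lambda^q$, $U\vee V=U\Lambda^{(p\vee q)-p}\cap V\Lambda^{(p\vee q)-q}$, where $p\vee q$ is the coordinatewise maximum. $\Lambda$ is compactly aligned if $U\vee V$ is compact whenever $U$ and $V$ are compact. The product system. With $A=C_0(\Lambda^0)$, $X_n$ is the completion of $C_c(\Lambda^n)$ (realised as a subspace of $C_0(\Lambda^n)$) for the operations $\langle f,g\rangle_A^n(v)=\sum_{\eta\in\Lambda^n,\,s(\eta)=v}\overline{f(\eta)}g(\eta)$ and $(a\cdot f\cdot b)(\lambda)=a(r(\lambda))f(\lambda)b(s(\lambda))$.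 For $f\in X_m$, $g\in X_n$ the product $fg\in X_{m+n}$ is $(fg)(\lambda)=f(\lambda(0,m))g(\lambda(m,m+n))$; this makes $X=\bigsqcup_nX_n$ a product system over $\mathbb N^k$ of right-Hilbert $A$--$A$ bimodules, i.e. a semigroup graded by $\mathbb N^k$ with $X_0=A$ whose multiplication induces isomorphisms $X_m\otimes_AX_n\cong X_{m+n}$. Compact alignment of $X$. $\mathcal L(X_m)$ and $\mathcal K(X_m)$ are the adjointable and generalised compact operators on $X_m$. For $m\ne0$, $\iota_m^{m+n}:\mathcal L(X_m)\to\mathcal L(X_{m+n})$ is determined by $\iota_m^{m+n}(S)(xy)=(Sx)y$ for $x\in X_m$, $y\in X_n$; $\iota_0^n$ is the left action of $\mathcal K(X_0)=A$ on $X_n$. $X$ is compactly aligned if $\iota_m^{m\vee n}(S)\,\iota_n^{m\vee n}(T)\in\mathcal K(X_{m\vee n})$ for all $m,n\in\mathbb N^k$, $S\in\mathcal K(X_m)$, $T\in\mathcal K(X_n)$. *)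

(* Defs.v *)
From HB Require Import structures.
From mathcomp Require Import all_boot all_order all_algebra finmap.
From mathcomp Require Import complex.
From mathcomp Require Import all_classical all_reals all_analysis.
From mathcomp.analysis Require showcase.summability.

Set Implicit Arguments.
Unset Strict Implicit.
Unset Printing Implicit Defensive.

Import Order.TTheory GRing.Theory Num.Theory.
Import numFieldNormedType.Exports.

Local Open Scope classical_set_scope.
Local Open Scope ring_scope.

Section degrees.
Context {k : nat}.
Implicit Types m n : {ffun 'I_k -> nat}.

Definition deg_join m n : {ffun 'I_k -> nat} := [ffun i => maxn (m i) (n i)].

Definition deg_sub n m : {ffun 'I_k -> nat} := [ffun i => (n i - m i)%N].

End degrees.

Definition local_homeomorphism (T U : topologicalType) (f : T -> U) :=
  forall x, exists A : set T,
    [/\ open A, A x, {in A &, injective f}, {within A, continuous f}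
      & forall B, B `<=` A -> open B -> open (f @` B)].

(* One-sorted presentation of a small category: the points are the morphisms
   (paths), and an object is identified with its identity morphism. The
   composite [kg_comp x y] (x after y) is meaningful only when
   [kg_s x = kg_r y]; its other values are unconstrained. The identities are
   exactly the paths of degree 0, by the factorisation property; they form an
   open set by continuity of the degree, so that it does not matter whether the
   range and source maps are seen as maps into the space of paths or into its
   subspace of objects. *)
Record topological_kgraph (k : nat) := TopologicalKGraph {
  kg_path :> topologicalType ;
  kg_r : kg_path -> kg_path ;
  kg_s : kg_path -> kg_path ;
  kg_comp : kg_path -> kg_path -> kg_path ;
  kg_d : kg_path -> {ffun 'I_k -> nat} ;
  kg_sr : forall x, kg_s (kg_r x) = kg_r x ;
  kg_rs : forall x, kg_r (kg_s x) = kg_s x ;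
  kg_r_comp : forall x y, kg_s x = kg_r y -> kg_r (kg_comp x y) = kg_r x ;
  kg_s_comp : forall x y, kg_s x = kg_r y -> kg_s (kg_comp x y) = kg_s y ;
  kg_compA : forall x y z, kg_s x = kg_r y -> kg_s y = kg_r z ->
    kg_comp x (kg_comp y z) = kg_comp (kg_comp x y) z ;
  kg_comp1l : forall x, kg_comp (kg_r x) x = x ;
  kg_comp1r : forall x, kg_comp x (kg_s x) = x ;
  kg_d_id : forall x, kg_d (kg_r x) = 0 ;
  kg_d_comp : forall x y, kg_s x = kg_r y ->
    kg_d (kg_comp x y) = kg_d x + kg_d y ;
  kg_factor : forall m n x, kg_d x = m + n ->
    exists! yz : kg_path * kg_path,
      [/\ kg_d yz.1 = m, kg_d yz.2 = n, kg_s yz.1 = kg_r yz.2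
        & x = kg_comp yz.1 yz.2] ;
  kg_second_countable : @second_countable kg_path ;
  kg_locally_compact : locally_compact [set: kg_path] ;
  kg_hausdorff : hausdorff_space kg_path ;
  kg_comp_continuous :
    {within [set p : kg_path * kg_path | kg_s p.1 = kg_r p.2],
      continuous (fun p => kg_comp p.1 p.2)} ;
  kg_comp_open : forall W : set (kg_path * kg_path), open W ->
    open ((fun p => kg_comp p.1 p.2) @`
      (W `&` [set p | kg_s p.1 = kg_r p.2])) ;
  kg_r_continuous : continuous kg_r ;
  kg_s_local_homeo : local_homeomorphism kg_s ;
  (* continuity of the degree, N^k being discrete *)
  kg_d_continuous : forall D : set {ffun 'I_k -> nat}, open (kg_d @^-1` D)
}.

Section kgraph.
Context {k : nat} (L : topological_kgraph k).
Implicit Types (m n p q : {ffun 'I_k -> nat}) (U V : set L) (x : L).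

Definition paths n : set L := [set x | kg_d x = n].

Definition path_mul U V : set L :=
  [set z | exists x y, [/\ U x, V y, kg_s x = kg_r y & z = kg_comp x y]].

Definition path_join p q U V : set L :=
  path_mul U (paths (deg_sub (deg_join p q) p)) `&`
  path_mul V (paths (deg_sub (deg_join p q) q)).

Definition kgraph_compactly_aligned :=
  forall p q U V, U `<=` paths p -> V `<=` paths q ->
    compact U -> compact V -> compact (path_join p q U V).

(* The path x(m, n); arbitrary unless 0 <= m <= n <= kg_d x. *)
Definition segment x m n : L :=
  xget x [set y | exists w z,
    [/\ kg_d w = m, kg_d y = deg_sub n m, kg_s w = kg_r y, kg_s y = kg_r z
      & x = kg_comp w (kg_comp y z)]].

End kgraph.

(* A function on the clopen set [paths L n] is encoded as a function on L
   vanishing outside it, so that all the fibres X_n of the product system live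
   in the same function space. *)
Section product_system.
Context (R : realType) {k : nat} (L : topological_kgraph k).
Local Notation C := R[i].
Implicit Types (m n p : {ffun 'I_k -> nat}) (f g a b : L -> C) (v x : L).
Implicit Types (S T : (L -> C) -> (L -> C)).

Definition C0 n : set (L -> C) := [set f |
  [/\ continuous (f : L -> C^o), forall x, ~ paths n x -> f x = 0
    & forall e : R, 0 < e -> exists2 K : set L, compact K &
        forall x, ~ K x -> Normc.normc (f x) < e]].

Definition Cc n : set (L -> C) := [set f |
  [/\ continuous (f : L -> C^o), forall x, ~ paths n x -> f x = 0
    & compact (closure [set x | f x != 0])]].

(* The sum is the unordered (unconditional) one, over a countable set. *)
Definition inner n f g : L -> C := fun v =>
  summability.sum
    ((fun x => (f x)^* * g x : C^o) \_ [set x | paths n x /\ kg_s x = v]).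

Definition lact a f : L -> C := fun x => a (kg_r x) * f x.

Definition ract f b : L -> C := fun x => f x * b (kg_s x).

(* [sup] is 0 on unbounded sets; the norms below are only used at elements of
   C_0 and of X_n, respectively, where the values are bounded. *)
Definition sup_norm f : R := sup [set Normc.normc (f x) | x in [set: L]].

Definition inner_norm n f : R := Num.sqrt (sup_norm (inner n f f)).

(* The completion of C_c, realised in C_0: since the supremum norm is bounded
   by [inner_norm n], a Cauchy sequence for the latter converges uniformly, and its
   uniform limit determines its class in the completion. *)
Definition X n : set (L -> C) := [set f | C0 n f /\
  exists u : nat -> L -> C,
    [/\ forall i, Cc n (u i),
        forall e : R, 0 < e -> exists N, forall i j, (N <= i)%N -> (N <= j)%N ->
          inner_norm n (u i - u j) < e
      & sup_norm (u i - f) @[i --> \oo] --> (0 : R)]].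

Definition ps_mul m n f g : L -> C := fun x =>
  if kg_d x == m + n then f (segment x 0 m) * g (segment x m (m + n)) else 0.

(* Operators on X_n are given by functions on the ambient space of which only
   the restriction to [X n] matters. *)
Definition adjointable n T :=
  (forall f, X n f -> X n (T f)) /\
  exists2 T', forall f, X n f -> X n (T' f) &
    forall f g, X n f -> X n g -> inner n (T f) g = inner n f (T' g).

Definition rank_one n f g : (L -> C) -> (L -> C) :=
  fun h => ract f (inner n g h).

(* The closure, for the operator norm, of the linear span of the rank one
   operators. *)
Definition compact_operator n T :=
  adjointable n T /\
  forall e : R, 0 < e ->
    exists N (c : 'I_N -> C) (f g : 'I_N -> L -> C),
      (forall i, X n (f i) /\ X n (g i)) /\
      forall h, X n h ->
        inner_norm n (T h - (fun x => \sum_i c i * rank_one n (f i) (g i) h x))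
          <= e * inner_norm n h.

(* The operator iota_m^p(S) on X_p, for m <= p; for m = 0, S is an element of
   K(X_0) = A, i.e. multiplication by a function a. The default value of [xget]
   is irrelevant, as such an operator exists and is unique on [X p] whenever S
   is adjointable (for m <> 0) or compact (for m = 0). *)
Definition iota m p S : (L -> C) -> (L -> C) :=
  xget S [set T |
    if m == 0 then
      exists a, [/\ C0 0 a, forall b, X 0 b -> S b = (fun x => a x * b x)
        & forall f, X p f -> T f = lact a f]
    else
      adjointable p T /\
      forall f g, X m f -> X (deg_sub p m) g ->
        T (ps_mul m (deg_sub p m) f g) = ps_mul m (deg_sub p m) (S f) g].

Definition ps_compactly_aligned :=
  forall m n S T, compact_operator m S -> compact_operator n T ->
    compact_operator (deg_join m n)
      (iota m (deg_join m n) S \o iota n (deg_join m n) T).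

End product_system.

(* Main.v *)
Require Import Defs.
From mathcomp Require Import all_boot all_order all_algebra finmap.
From mathcomp Require Import complex ring lra.
From mathcomp Require Import all_classical all_reals all_analysis.
From mathcomp.analysis Require showcase.summability.

(** Over an object [v] the module of degree [n] looks like the Hilbert space of
square-summable functions on the fibre, the set of paths of degree [n] with
source [v], and [X n] consists of the functions that can be approximated by
continuous compactly supported ones, uniformly over the fibres, in the
square-summable norm ([XP]). Since the source map is a local homeomorphism, a
path [x] carries a peak: a compactly supported function which is 1 at [x] and 0
elsewhere on the fibre of [x]. Pairing with peaks evaluates functions, so that
an adjointable operator [T] with adjoint [T'] is an integral operator along the
fibres, [T f x = <T' (peak x), f>]. In particular it is local over the objects.

A path of degree [m + n] is a head [a] of degree [m] followed by a tail [z] of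
degree [n], and its peak can be taken to be the product of the peaks of [a] and
[z]. Therefore the operator on [X (m + n)] induced by an operator [S] on [X m] is
unique, and it is given by an explicit formula, [ampl]: it acts as [S] on the
heads and leaves the tails alone. Grouping the paths of a fibre by their tails
shows that its norm is controlled by that of [S] ([ampl_bd]), and it preserves
[X (m + n)] because compactly supported functions are sums of products
([Cc_mul_ind]). This identifies [iota] ([iotaP], [iota_ampl]).

If the product system is compactly aligned, take compact sets [U] and [V] of
paths of degrees [p] and [q], and functions [a] and [b] with compact support
which are at least 1 on them. Multiplication by [a] is compact, because it is of
rank one if [a] lives where the source map is injective, and partitions of unity
reduce everything to that case. The operators induced by [a] and [b] multiply by
[a] and [b] evaluated at the heads, so that their composite multiplies by a
function which is at least 1 on the join of [U] and [V]. As it is compact, it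
nearly annihilates the peaks of the paths outside some compact set, which must
then contain the join.

Conversely, if the graph is compactly aligned, it suffices to treat rank-one
operators built from compactly supported functions, by approximation. The
composite of the operators induced by those given by [f1], [g1] and [f2], [g2]
involves [g1] and [f2] only through the function that sends a path to the
product of the conjugate of [g1] at its head of degree [m] and of [f2] at its
head of degree [n]. Compact alignment means that this function is compactly
supported. Locally a path is determined by either of its two tails, from which it
follows that such a composite is a finite sum of rank-one operators
([two_tails], [ampl_comp_rank_one]). *)

Set Implicit Arguments.
Unset Strict Implicit.
Unset Printing Implicit Defensive.

Import Order.TTheory GRing.Theory Num.Theory.
Import numFieldNormedType.Exports.

Local Open Scope classical_set_scope.
Local Open Scope ring_scope.

Local Notation "x %:C" := (real_complex _ x) : ring_scope.

(** * Complex scalars *)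

Section sqn.
Context (R : realType).
Local Notation C := R[i].
Implicit Types a b c z : C.

(** Working with squares of moduli avoids roots in all norm estimates. The
factor 2 in [sqnD] is harmless because only the smallness of norms matters. *)
Definition sqn z : R := complex.Re z ^+ 2 + complex.Im z ^+ 2.

Lemma normc_sqn z : Normc.normc z ^+ 2 = sqn z.
Proof. by case: z => x y; rewrite /sqn /= sqr_sqrtr// addr_ge0// sqr_ge0. Qed.

Lemma normcE z : Normc.normc z = Num.sqrt (sqn z).
Proof. by case: z. Qed.

Lemma sqn_ge0 z : 0 <= sqn z.
Proof. by rewrite addr_ge0// sqr_ge0. Qed.

Lemma normc_ge0 z : 0 <= Normc.normc z.
Proof. by rewrite normcE sqrtr_ge0. Qed.

Lemma sqn0 : sqn 0 = 0. Proof. by rewrite /sqn /= expr0n addr0. Qed.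

Lemma sqn1 : sqn 1 = 1. Proof. by rewrite /sqn /= expr0n expr1n addr0. Qed.

Lemma sqnM a b : sqn (a * b) = sqn a * sqn b.
Proof. by case: a b => [x y] [u v]; rewrite /sqn /=; ring. Qed.

Lemma sqnN a : sqn (- a) = sqn a.
Proof. by case: a => [x y]; rewrite /sqn /= !sqrrN. Qed.

Lemma sqnC a : sqn a^* = sqn a.
Proof. by case: a => [x y]; rewrite /sqn /= sqrrN. Qed.

Lemma sqnBC a b : sqn (a - b) = sqn (b - a).
Proof. by rewrite -sqnN opprB. Qed.

Lemma sqnD a b : sqn (a + b) <= 2 * (sqn a + sqn b).
Proof.
case: a b => [x y] [u v]; rewrite /sqn /= -subr_ge0.
have -> : 2 * (x ^+ 2 + y ^+ 2 + (u ^+ 2 + v ^+ 2)) -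
  ((x + u) ^+ 2 + (y + v) ^+ 2) = (x - u) ^+ 2 + (y - v) ^+ 2 by ring.
by rewrite addr_ge0// sqr_ge0.
Qed.

Lemma sqn_eq0 a : sqn a = 0 -> a = 0.
Proof. by move=> a0; apply: Normc.eq0_normc; rewrite normcE a0 sqrtr0. Qed.

Lemma sqn_real (x : R) : sqn x%:C = x ^+ 2.
Proof. by rewrite /sqn /= expr0n addr0. Qed.

Lemma conjM_sqn a : a^* * a = (sqn a)%:C.
Proof.
by case: a => [x y]; rewrite /sqn; apply/eqP; rewrite eq_complex /=; apply/andP;
  split; apply/eqP; ring.
Qed.

Lemma normcD a b :
  Normc.normc (a + b) <= Normc.normc a + Normc.normc b.
Proof. exact: (@le_normcD R a b). Qed.

Lemma normcBC a b : Normc.normc (a - b) = Normc.normc (b - a).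
Proof. by rewrite !normcE sqnBC. Qed.

Lemma normc_real (x : R) : Normc.normc x%:C = `|x|.
Proof. by rewrite normcE sqn_real sqrtr_sqr. Qed.

Lemma normC_lt (z : C) (e : R) : (`|z| < e%:C) = (Normc.normc z < e).
Proof. by rewrite /Num.Def.normr /= ltcR. Qed.

Lemma normc_le_sqn z (e : R) : 0 <= e -> (Normc.normc z <= e) = (sqn z <= e ^+ 2).
Proof. by move=> e0; rewrite -normc_sqn ler_sqr// nnegrE// normc_ge0. Qed.

Lemma eq0_sqn_small a : (forall e : R, 0 < e -> sqn a <= e) -> a = 0.
Proof.
move=> ae; apply: sqn_eq0; apply/eqP; rewrite eq_le sqn_ge0 andbT.
by apply/ler_addgt0Pr => e e0; rewrite add0r ae.
Qed.

Lemma cauchy_schwarz_real (I : Type) (s : seq I) (a b : I -> R) :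
  (forall i, 0 <= a i) -> (forall i, 0 <= b i) ->
  (\sum_(i <- s) a i * b i) ^+ 2 <=
    (\sum_(i <- s) a i ^+ 2) * (\sum_(i <- s) b i ^+ 2).
Proof.
move=> a0 b0; elim: s => [|i s IH]; first by rewrite !big_nil expr0n mulr0.
rewrite !big_cons; move: IH.
set S := \sum_(j <- s) _; set A := \sum_(j <- s) _; set B := \sum_(j <- s) _.
have A0 : 0 <= A by apply: sumr_ge0 => j _; rewrite sqr_ge0.
have B0 : 0 <= B by apply: sumr_ge0 => j _; rewrite sqr_ge0.
have S0 : 0 <= S by apply: sumr_ge0 => j _; rewrite mulr_ge0.
move=> IH.
suff : 2 * (a i * b i) * S <= a i ^+ 2 * B + A * b i ^+ 2 by nra.
have h0 : 0 <= a i ^+ 2 * B + A * b i ^+ 2.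
  by rewrite addr_ge0// mulr_ge0// sqr_ge0.
rewrite -ler_sqr ?nnegrE//; last by rewrite !mulr_ge0.
have : 0 <= (a i ^+ 2 * B - A * b i ^+ 2) ^+ 2 by exact: sqr_ge0.
have : (a i * b i) ^+ 2 * S ^+ 2 <= (a i * b i) ^+ 2 * (A * B).
  by rewrite ler_wpM2l// sqr_ge0.
by nra.
Qed.

Lemma normc_sum (I : Type) (s : seq I) (a : I -> C) :
  Normc.normc (\sum_(i <- s) a i) <= \sum_(i <- s) Normc.normc (a i).
Proof.
elim: s => [|i s IH]; first by rewrite !big_nil Normc.normc0.
by rewrite !big_cons (le_trans (normcD _ _))// lerD2l.
Qed.

Lemma cauchy_schwarz (I : Type) (s : seq I) (a b : I -> C) :
  sqn (\sum_(i <- s) (a i)^* * b i) <=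
    (\sum_(i <- s) sqn (a i)) * (\sum_(i <- s) sqn (b i)).
Proof.
rewrite -normc_sqn.
apply: (@le_trans _ _
  ((\sum_(i <- s) Normc.normc (a i) * Normc.normc (b i)) ^+ 2)).
  rewrite ler_sqr ?nnegrE ?normc_ge0//; last first.
    by apply: sumr_ge0 => i _; rewrite mulr_ge0// normc_ge0.
  apply: (le_trans (normc_sum _ _)); apply: ler_sum => i _.
  by rewrite Normc.normcM !normcE sqnC.
apply: (le_trans (cauchy_schwarz_real _ _ _)) => [i|i|]; rewrite ?normc_ge0//.
by under eq_bigr do rewrite normc_sqn; under [X in _ * X]eq_bigr do rewrite normc_sqn.
Qed.

End sqn.

(** * Square-summable families *)

Section square_summable.
Context (R : realType) (I : choiceType).
Local Notation C := R[i].
Implicit Types (D : set I) (f g h : I -> C) (E F : {fset I}) (M N e : R).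

(** A bound on all the finite sums, which involves no limit and is stable under
pointwise limits. *)
Definition l2 D f M := forall F, [set` F] `<=` D -> \sum_(x <- F) sqn (f x) <= M.

Lemma l2_le D f M N : M <= N -> l2 D f M -> l2 D f N.
Proof. by move=> MN fM F /fM /le_trans; apply. Qed.

Lemma l2_ge0 D f M : l2 D f M -> 0 <= M.
Proof. by move=> /(_ fset0); rewrite big_seq_fset0; apply => x; rewrite /= inE. Qed.

Lemma l2_eq D f g M : (forall x, D x -> f x = g x) -> l2 D f M -> l2 D g M.
Proof.
move=> fg fM F FD; rewrite (eq_big_seq (fun x => sqn (f x))) ?fM// => x xF.
by rewrite fg//; exact: FD.
Qed.

Lemma l2_pt D f M x : D x -> l2 D f M -> sqn (f x) <= M.
Proof.
move=> Dx /(_ [fset x]%fset); rewrite big_seq_fset1; apply.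
by move=> y /=; rewrite inE => /eqP ->.
Qed.

Lemma l2D D f g M N : l2 D f M -> l2 D g N ->
  l2 D (fun x => f x + g x) (2 * (M + N)).
Proof.
move=> fM gN F FD.
apply: (@le_trans _ _ (\sum_(x <- F) 2 * (sqn (f x) + sqn (g x)))).
  by apply: ler_sum => x _; exact: sqnD.
by rewrite -mulr_sumr big_split /= ler_pM2l// lerD// ?fM ?gN.
Qed.

Lemma l2N D f M : l2 D f M -> l2 D (fun x => - f x) M.
Proof. by move=> fM F /fM; under eq_bigr do rewrite -sqnN. Qed.

Lemma l2B D f g M N : l2 D f M -> l2 D g N ->
  l2 D (fun x => f x - g x) (2 * (M + N)).
Proof. by move=> fM /l2N; exact: l2D. Qed.

Lemma l2BC D f g M : l2 D (fun x => f x - g x) M -> l2 D (fun x => g x - f x) M.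
Proof. by move=> fM F /fM; under eq_bigr do rewrite sqnBC. Qed.

Lemma l2Z D f M (c : C) : l2 D f M -> l2 D (fun x => c * f x) (sqn c * M).
Proof.
move=> fM F /fM FM; under eq_bigr do rewrite sqnM.
by rewrite -mulr_sumr ler_wpM2l ?sqn_ge0.
Qed.

Lemma sum_le_sub (s : I -> R) E F : (forall x, 0 <= s x) ->
  (forall x, x \in F -> s x != 0 -> x \in E) ->
  \sum_(x <- F) s x <= \sum_(x <- E) s x.
Proof.
move=> s0 FE.
rewrite [X in X <= _](bigID (mem E)) /= [X in _ + X]big1_seq ?addr0; last first.
  move=> x /andP[xE xF]; apply/eqP; apply: contraNT xE; exact: FE.
rewrite [X in _ <= X](bigID (mem F)) /=.
rewrite -[X in X <= _]addr0 lerD//; last exact: sumr_ge0.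
rewrite -big_filter -[X in _ <= X]big_filter.
rewrite (perm_big [seq x <- E | x \in F])//=.
apply: uniq_perm; rewrite ?filter_uniq ?fset_uniq//.
by move=> x; rewrite !mem_filter andbC.
Qed.

Lemma sum_incl (s : I -> C) E F : {subset E <= F} ->
  (forall x, x \in F -> x \notin E -> s x = 0) ->
  \sum_(x <- F) s x = \sum_(x <- E) s x.
Proof.
move=> EF s0; rewrite (bigID (mem E)) /= [X in _ + X]big1_seq ?addr0; last first.
  by move=> x /andP[xE xF]; exact: s0.
rewrite -big_filter (perm_big (enum_fset E))//=.
apply: uniq_perm; rewrite ?filter_uniq ?fset_uniq// => x.
by rewrite mem_filter; case: (boolP (x \in E)) => //= /EF ->.
Qed.

Lemma sum_one (s : I -> C) E y : (forall x, x \in E -> x != y -> s x = 0) ->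
  (y \notin E -> s y = 0) -> \sum_(x <- E) s x = s y.
Proof.
move=> s0 sy; case: (boolP (y \in E)) => [yE|/[dup] yE /sy ->].
  rewrite (@sum_incl _ [fset y]%fset) ?big_seq_fset1// => x; rewrite inE.
    by move/eqP ->.
  by move=> xE xy; exact: s0.
rewrite big1_seq// => x /andP[_ xE]; apply: s0 => //.
by apply: contraNneq yE => <-.
Qed.

Lemma l2_fin D f E : (forall x, D x -> f x != 0 -> x \in E) ->
  l2 D f (\sum_(x <- E) sqn (f x)).
Proof.
move=> fE F FD; apply: sum_le_sub => [x|x xF fx0]; first exact: sqn_ge0.
by apply: fE; [exact: FD | apply: contraNneq fx0 => ->; rewrite sqn0].
Qed.

Definition has_sum D f (s : C) := forall e, 0 < e ->
  exists E, [set` E] `<=` D /\ forall F, [set` F] `<=` D -> {subset E <= F} ->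
    Normc.normc (\sum_(x <- F) f x - s) < e.

Lemma fsetU_sub D E F : [set` E] `<=` D -> [set` F] `<=` D ->
  [set` (E `|` F)%fset] `<=` D.
Proof. by move=> ED FD x /=; rewrite inE => /orP[/ED|/FD]. Qed.

Lemma has_sum_unique D f s t : has_sum D f s -> has_sum D f t -> s = t.
Proof.
move=> fs ft; apply/eqP; rewrite -subr_eq0; apply/eqP/Normc.eq0_normc/eqP.
rewrite eq_le normc_ge0 andbT; apply/ler_addgt0Pr => e e0; rewrite add0r.
have e20 : 0 < e / 2 by rewrite divr_gt0.
have [E [ED Es]] := fs _ e20; have [F [FD Ft]] := ft _ e20.
have UD := fsetU_sub ED FD.
have := Es _ UD (fsubsetP (fsubsetUl E F)).
have := Ft _ UD (fsubsetP (fsubsetUr E F)).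
set S := \sum_(x <- _) _ => St Ss.
rewrite -(subrK S s) -addrA (le_trans (normcD _ _))// (splitr e) lerD//.
  by rewrite normcBC ltW.
by rewrite ltW.
Qed.

Lemma has_sum_eq D f g s : (forall x, D x -> f x = g x) ->
  has_sum D f s -> has_sum D g s.
Proof.
move=> fg fs e /fs [E [ED Es]]; exists E; split => // F FD EF.
rewrite (eq_big_seq f) ?Es// => x xF; rewrite fg//; exact: FD.
Qed.

Lemma has_sumD D f g s t : has_sum D f s -> has_sum D g t ->
  has_sum D (fun x => f x + g x) (s + t).
Proof.
move=> fs gt e e0; have e20 : 0 < e / 2 by rewrite divr_gt0.
have [E [ED Es]] := fs _ e20; have [F [FD Ft]] := gt _ e20.
exists (E `|` F)%fset; split=> [|G GD UG]; first exact: fsetU_sub.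
rewrite big_split /= opprD addrACA [ltRHS](splitr e).
rewrite (le_lt_trans (normcD _ _))// ltrD//.
  by apply: Es => // x xE; apply: UG; rewrite inE xE.
by apply: Ft => // x xE; apply: UG; rewrite inE xE orbT.
Qed.

Lemma has_sumZ D f s (c : C) : has_sum D f s ->
  has_sum D (fun x => c * f x) (c * s).
Proof.
move=> fs e e0.
have c0 : 0 < Normc.normc c + 1 by rewrite ltr_wpDl// normc_ge0.
have [E [ED Es]] := fs _ (divr_gt0 e0 c0); exists E; split => // F FD /Es -/(_ FD).
rewrite -mulr_sumr -mulrBr Normc.normcM => h.
apply: (@le_lt_trans _ _ ((Normc.normc c + 1) *
   Normc.normc (\sum_(x <- F) f x - s))).
  by rewrite ler_wpM2r ?normc_ge0// lerDl.
by rewrite mulrC -ltr_pdivlMr.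
Qed.

Lemma has_sum_conj D f s : has_sum D f s -> has_sum D (fun x => (f x)^*) s^*.
Proof.
move=> fs e /fs[E [ED Es]]; exists E; split => // F FD /Es -/(_ FD).
by rewrite -rmorph_sum -rmorphB /= !normcE sqnC.
Qed.

Lemma has_sum_fin D f E : [set` E] `<=` D ->
  (forall x, D x -> x \notin E -> f x = 0) -> has_sum D f (\sum_(x <- E) f x).
Proof.
move=> ED f0 e e0; exists E; split => // F FD EF.
rewrite (sum_incl EF) ?subrr ?Normc.normc0// => x /FD; exact: f0.
Qed.

(** The sum is the supremum of the finite sums, hence also their least bound.
The existence of all inner products reduces to this case by polarisation. *)
Lemma l2_has_sum D f M : l2 D f M -> exists s : R,
  [/\ has_sum D (fun x => (sqn (f x))%:C) s%:C, 0 <= s, s <= M & l2 D f s].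
Proof.
move=> fM; pose A := [set \sum_(x <- F) sqn (f x) | F in [set F : {fset I} | [set` F] `<=` D]].
have A0 : A 0.
  exists fset0; first by move=> x /=; rewrite inE.
  by rewrite big_seq_fset0.
have ubA : ubound A M by move=> _ [F FD <-]; exact: fM.
have hA : has_sup A by split; [exists 0 | exists M].
exists (sup A); split.
- move=> e e0; have [_ [E ED <-] sE] := sup_adherent e0 hA.
  exists E; split => // F FD EF.
  rewrite -rmorph_sum -rmorphB normc_real distrC ger0_norm; last first.
    by rewrite subr_ge0 ub_le_sup//; [exists M | exists F].
  rewrite ltrBlDr -ltrBlDl (lt_le_trans sE)//.
  by apply: sum_le_sub => [x|x xE _]; [exact: sqn_ge0 | exact: EF].
- by apply: ub_le_sup => //; exists M.
- by apply: ge_sup => //; exists 0.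
- by move=> F FD; apply: ub_le_sup; [exists M | exists F].
Qed.

Lemma polarisation (a b : C) : let j : C := Complex 0 1 in
  a^* * b = 2^-1 * (sqn (a + b))%:C + (- (j / 2) * (sqn (a + j * b))%:C +
    (j - 1) / 2 * ((sqn a)%:C + (sqn b)%:C)).
Proof.
apply: (@mulfI _ 2) => //=; case: a b => [x y] [u v].
rewrite 2!mulrDr !mulrA mulfV// mulrN !mulrA ![2 * _]mulrC !mulfK//.
by rewrite /sqn; apply/eqP; rewrite eq_complex /=; apply/andP; split;
  apply/eqP; ring.
Qed.

(** The shape of the inner product of the modules, over an arbitrary set. *)
Definition ip D f g : C :=
  summability.sum ((fun x => (f x)^* * g x : C^o) \_ D).

Lemma has_sum_sum D (f : I -> C) s : has_sum D f s ->
  summability.sum ((f : I -> C^o) \_ D) = s.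
Proof.
move=> fs; have FF := @summability.totally_filter I.
apply: cvg_lim; first exact: norm_hausdorff.
apply/cvgrPdist_lt => /= e e0.
have [e0' eE] : 0 < complex.Re e /\ e = (complex.Re e)%:C.
  case: e e0 => a b; rewrite ltcE /= => /andP[/eqP -> a0]; split => //.
rewrite eE; have [E [ED Es]] := fs _ e0'.
exists E => // F /fsubsetP EF /=; rewrite normC_lt normcBC.
pose G := [fset x in F | x \in D]%fset.
have -> : summability.partial_sum ((f : I -> C^o) \_ D) F = \sum_(x <- G) f x.
  rewrite /summability.partial_sum.
  rewrite -(big_seq_fsetE _ F xpredT ((f : I -> C^o) \_ D)) /=.
  rewrite (bigID (mem D)) /= [X in _ + X]big1 ?addr0; last first.
    by move=> x /negPf; rewrite patchE => ->.
  rewrite -big_filter (perm_big (enum_fset G))/=; last first.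
    apply: uniq_perm; rewrite ?filter_uniq ?fset_uniq// => x.
    by rewrite mem_filter !inE andbC.
  by apply: eq_big_seq => x; rewrite !inE patchE => /andP[_ ->].
apply: Es => x /=.
  by rewrite !inE => /andP[_]; rewrite inE.
by move=> xE; rewrite !inE (EF _ xE) /= mem_set//; exact: ED.
Qed.

Lemma has_sum_ip D f g M N : l2 D f M -> l2 D g N ->
  has_sum D (fun x => (f x)^* * g x) (ip D f g).
Proof.
move=> fM gN.
suff [s hs] : exists s, has_sum D (fun x => (f x)^* * g x) s.
  by rewrite /ip (has_sum_sum hs).
pose j : C := Complex 0 1.
have [s1 [h1 _ _ _]] := l2_has_sum (l2D fM gN).
have [s2 [h2 _ _ _]] := l2_has_sum (l2D fM (l2Z j gN)).
have [s3 [h3 _ _ _]] := l2_has_sum fM; have [s4 [h4 _ _ _]] := l2_has_sum gN.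
have h := has_sumD (has_sumZ 2^-1 h1) (has_sumD (has_sumZ (- (j / 2)) h2)
  (has_sumZ ((j - 1) / 2) (has_sumD h3 h4))).
by eexists; apply: has_sum_eq h => x _; rewrite -/j [RHS]polarisation.
Qed.

Lemma ip_eq D f f' g g' : (forall x, D x -> f x = f' x) ->
  (forall x, D x -> g x = g' x) -> ip D f g = ip D f' g'.
Proof.
by move=> ff' gg'; rewrite /ip; f_equal; apply/funext => x; rewrite !patchE;
  case: ifPn => //; rewrite inE => Dx; rewrite ff'// gg'.
Qed.

Lemma ip_eqM D f f' g g' :
  (forall x, D x -> (f x)^* * g x = (f' x)^* * g' x) -> ip D f g = ip D f' g'.
Proof.
move=> e; rewrite /ip; f_equal; apply/funext => x; rewrite !patchE.
by case: ifPn => //; rewrite inE => /e.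
Qed.

Lemma ip_bound D f g M N : l2 D f M -> l2 D g N -> sqn (ip D f g) <= M * N.
Proof.
move=> fM gN; have h := has_sum_ip fM gN.
have M0 := l2_ge0 fM; have N0 := l2_ge0 gN.
rewrite -[leRHS]sqr_sqrtr ?mulr_ge0// -normc_le_sqn ?sqrtr_ge0//.
apply/ler_addgt0Pr => e /h [E [ED /(_ E ED (fun x => id)) hE]].
rewrite -(subrK (\sum_(x <- E) (f x)^* * g x) (ip D f g)) addrC.
rewrite (le_trans (normcD _ _))// lerD//; last by rewrite normcBC ltW.
rewrite normc_le_sqn ?sqrtr_ge0// sqr_sqrtr ?mulr_ge0//.
rewrite (le_trans (cauchy_schwarz _ _ _))// ler_pM// ?fM ?gN//.
  by apply: sumr_ge0 => x _; exact: sqn_ge0.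
by apply: sumr_ge0 => x _; exact: sqn_ge0.
Qed.

Lemma ip_fin D f g E : [set` E] `<=` D ->
  (forall x, D x -> x \notin E -> (f x)^* * g x = 0) ->
  ip D f g = \sum_(x <- E) (f x)^* * g x.
Proof. by move=> ED /(has_sum_fin ED) /has_sum_sum. Qed.

Lemma ip_single D f g y : D y -> (forall x, D x -> x != y -> (f x)^* * g x = 0) ->
  ip D f g = (f y)^* * g y.
Proof.
move=> Dy f0; rewrite (@ip_fin _ _ _ [fset y]%fset) ?big_seq_fset1//.
  by move=> x /=; rewrite inE => /eqP ->.
by move=> x Dx; rewrite inE => /f0; exact.
Qed.

Lemma ip_eq0 D f g : (forall x, D x -> (f x)^* * g x = 0) -> ip D f g = 0.
Proof.
by move=> fg; rewrite (@ip_fin _ _ _ fset0) ?big_seq_fset0// => x /fg.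
Qed.

Lemma ipC D f g M N : l2 D f M -> l2 D g N -> ip D g f = (ip D f g)^*.
Proof.
move=> fM gN; apply: has_sum_unique (has_sum_ip gN fM) _.
apply: has_sum_eq (has_sum_conj (has_sum_ip fM gN)) => x _.
by rewrite rmorphM /= conjCK mulrC.
Qed.

Lemma ipDr D f g h M N N' : l2 D f M -> l2 D g N -> l2 D h N' ->
  ip D f (fun x => g x + h x) = ip D f g + ip D f h.
Proof.
move=> fM gN hN; apply: has_sum_unique (has_sum_ip fM (l2D gN hN)) _.
apply: has_sum_eq (has_sumD (has_sum_ip fM gN) (has_sum_ip fM hN)) => x _.
by rewrite mulrDr.
Qed.

Lemma ipZr D f g c M N : l2 D f M -> l2 D g N ->
  ip D f (fun x => c * g x) = c * ip D f g.
Proof.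
move=> fM gN; apply: has_sum_unique (has_sum_ip fM (l2Z c gN)) _.
apply: has_sum_eq (has_sumZ c (has_sum_ip fM gN)) => x _.
by rewrite mulrCA.
Qed.

Lemma ipBr D f g h M N N' : l2 D f M -> l2 D g N -> l2 D h N' ->
  ip D f (fun x => g x - h x) = ip D f g - ip D f h.
Proof.
move=> fM gN hN; rewrite -mulN1r -(ipZr _ fM hN) -(ipDr fM gN (l2Z (-1) hN)).
by apply: ip_eq => // x _; rewrite mulN1r.
Qed.

Lemma ipDl D f g h M N N' : l2 D f M -> l2 D g N -> l2 D h N' ->
  ip D (fun x => g x + h x) f = ip D g f + ip D h f.
Proof.
by move=> fM gN hN; rewrite (ipC fM (l2D gN hN)) (ipDr fM gN hN) rmorphD /=
  -(ipC fM gN) -(ipC fM hN).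
Qed.

Lemma ipBl D f g h M N N' : l2 D f M -> l2 D g N -> l2 D h N' ->
  ip D (fun x => g x - h x) f = ip D g f - ip D h f.
Proof.
by move=> fM gN hN; rewrite (ipC fM (l2B gN hN)) (ipBr fM gN hN) rmorphB /=
  -(ipC fM gN) -(ipC fM hN).
Qed.

Lemma ipZl D f g c M N : l2 D f M -> l2 D g N ->
  ip D (fun x => c * f x) g = c^* * ip D f g.
Proof.
move=> fM gN.
by rewrite (ipC gN (l2Z c fM)) (ipZr c gN fM) rmorphM /= -(ipC gN fM).
Qed.

Lemma ip_self D f M : l2 D f M -> exists s : R,
  [/\ ip D f f = s%:C, 0 <= s, s <= M & l2 D f s].
Proof.
move=> fM; have [s [hs s0 sM fs]] := l2_has_sum fM; exists s; split => //.
apply: has_sum_unique (has_sum_ip fM fM) _; apply: has_sum_eq hs => x _.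
by rewrite conjM_sqn.
Qed.

End square_summable.

Lemma has_sum_reindex (R : realType) (I J : choiceType) (D : set I) (D' : set J)
    (t : I -> J) (g : J -> I) (f : J -> R[i]) s :
  (forall x, D x -> D' (t x) /\ g (t x) = x) ->
  (forall y, D' y -> f y != 0 -> D (g y) /\ t (g y) = y) ->
  has_sum D (f \o t) s -> has_sum D' f s.
Proof.
move=> tD gD fs e e0; have [E [ED Es]] := fs _ e0.
exists [fset t x | x in E]%fset; split=> [y /= /imfsetP[x /= /ED Dx ->]|F FD EF].
  by have [] := tD _ Dx.
pose F' := [fset y in F | `[< D (g y) /\ t (g y) = y >]]%fset.
have F'P y : y \in F' -> [/\ y \in F, D (g y) & t (g y) = y].
  by rewrite !inE => /andP[yF /asboolP[]].
have F'I y : y \in F -> D (g y) -> t (g y) = y -> y \in F'.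
  by move=> yF Dy ty; rewrite !inE yF; apply/asboolP.
move: F' F'P F'I => F' F'P F'I.
have -> : \sum_(y <- F) f y = \sum_(y <- F') f y.
  apply: sum_incl => [y /F'P[]//|y yF yF'].
  apply/eqP; apply: contraNT yF' => fy0.
  by have [Dy ty] := gD _ (FD _ yF) fy0; exact: F'I.
pose G := [fset g y | y in F']%fset.
have -> : \sum_(y <- F') f y = \sum_(x <- G) (f \o t) x.
  have gi : {in F' &, injective g}.
    by move=> y z /F'P[_ _ yE] /F'P[_ _ zE] gyz; rewrite -yE -zE gyz.
  rewrite /G big_imfset; last exact: gi.
  by apply: eq_big_seq => y /F'P[_ _ yE]; rewrite /= yE.
apply: Es => [x /= /imfsetP[y /= /F'P[_ Dx _] ->]//|x xE].
have [_ gx] := tD _ (ED _ xE); apply/imfsetP; exists (t x); rewrite ?gx//=.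
apply: F'I; rewrite ?gx//; first by apply: EF; apply/imfsetP; exists x.
exact: ED.
Qed.

(** * Topology *)

Lemma compact_fset_cover (T : topologicalType) (K : set T) (U : T -> set T) :
  compact K -> (forall x, K x -> nbhs x (U x)) ->
  exists E : {fset T}, [set` E] `<=` K /\
    forall y, K y -> exists2 x, x \in E & U x y.
Proof.
move=> /compact_near_coveringP cK KU.
have FF := @summability.totally_filter T.
pose P (E : {fset T}) y := exists x, [/\ x \in E, K x & U x y].
have [x Kx|E _ EP] := cK _ summability.totally P FF.
  exists (U x, [set E | [fset x]%fset `<=` E]%fset) => /=.
    by split; [exact: KU | exists [fset x]%fset].
  move=> [y E] /= [Uxy xE]; exists x; split => //.
  by apply: (fsubsetP xE); rewrite inE.
exists [fset x in E | x \in K]%fset; split.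
  by move=> x /=; rewrite !inE => /andP[_]; rewrite inE.
move=> y /(EP E (fsubset_refl _)) [x [xE Kx Uxy]].
by exists x => //; rewrite !inE xE mem_set.
Qed.

Lemma compact_sub (T : topologicalType) (A K : set T) : closed A -> compact K ->
  A `<=` K -> compact A.
Proof. by move=> cA cK AK; exact: subclosed_compact cA cK AK. Qed.

Lemma closed_equaliser (T U : topologicalType) (f g : T -> U) :
  hausdorff_space U -> continuous f -> continuous g ->
  closed [set x | f x = g x].
Proof.
rewrite open_hausdorff => hU cf cg; rewrite -openC openE => x /= fgx.
have /hU[[A B] /= [fA gB] [oA oB /eqP AB]] : f x != g x by apply/eqP.
have nx : nbhs x (f @^-1` A `&` g @^-1` B).
  by apply: filterI; [apply: cf|apply: cg]; apply: open_nbhs_nbhs; split=> //;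
    exact: set_mem.
apply: filterS nx => y [/= Ay By] fgy.
have : (A `&` B) (f y) by split => //; rewrite fgy.
by rewrite AB.
Qed.

Section complex_continuity.
Context (R : realType) (T : topologicalType).
Local Notation C := R[i].
Implicit Types f g : T -> C.

Lemma continuousP_normc f : continuous (f : T -> C^o) <->
  forall x (e : R), 0 < e -> nbhs x [set y | Normc.normc (f x - f y) < e].
Proof.
split=> [cf x e e0|cf x].
  have /cvgrPdist_lt/(_ e%:C) := cf x; rewrite ltcR => /(_ e0).
  by apply: filterS => y /=; rewrite normC_lt.
apply/cvgrPdist_lt => /= e e0.
have [e0' eE] : 0 < complex.Re e /\ e = (complex.Re e)%:C.
  by case: e e0 => a b; rewrite ltcE /= => /andP[/eqP -> a0]; split.
rewrite eE; move: (cf x _ e0'); apply: filterS => y /=.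
by rewrite normC_lt.
Qed.

Lemma continuous_at_mul f g x : {for x, continuous (f : T -> C^o)} ->
  {for x, continuous (g : T -> C^o)} ->
  {for x, continuous ((fun y => f y * g y) : T -> C^o)}.
Proof. by move=> cf cg; apply: (@cvgM C). Qed.

Lemma continuous_at_eq f g x : nbhs x [set y | f y = g y] ->
  {for x, continuous (f : T -> C^o)} -> {for x, continuous (g : T -> C^o)}.
Proof.
move=> fg cf; have fgx : f x = g x := nbhs_singleton fg.
rewrite /prop_for /continuous_at -fgx; apply: cvg_trans cf.
exact: near_eq_cvg.
Qed.

Lemma continuous_complex (f : T -> R) : continuous f ->
  continuous (fun x => (f x)%:C : C^o).
Proof.
move=> cf; apply/continuousP_normc => x e e0.
have /cvgrPdist_lt/(_ _ e0) := cf x; apply: filterS => y.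
by rewrite /mkset -rmorphB normc_real.
Qed.

Lemma continuous_conj f : continuous (f : T -> C^o) ->
  continuous (fun x => (f x)^* : C^o).
Proof.
move/continuousP_normc => cf; apply/continuousP_normc => x e /(cf x).
by apply: filterS => y /=; rewrite -rmorphB /= !normcE sqnC.
Qed.

Lemma continuous_add f g : continuous (f : T -> C^o) ->
  continuous (g : T -> C^o) -> continuous (fun x => f x + g x : C^o).
Proof. by move=> cf cg x; apply: (@cvgD C C^o); [exact: cf|exact: cg]. Qed.

Lemma continuous_mul f g : continuous (f : T -> C^o) ->
  continuous (g : T -> C^o) -> continuous (fun x => f x * g x : C^o).
Proof. by move=> cf cg x; apply: (@cvgM C); [exact: cf|exact: cg]. Qed.

Lemma continuous_cst (c : C) : continuous (fun _ : T => c : C^o).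
Proof. by move=> x; exact: cvg_cst. Qed.

End complex_continuity.

Section bumps.
Context (R : realType) (T : topologicalType).
Context (lcT : locally_compact [set: T]) (hT : hausdorff_space T).

(** Local compactness makes the space completely regular; a separating function
is truncated so that its support stays inside a compact neighbourhood and
that it is constant around the point. *)
Lemma bump x (W : set T) : open W -> W x -> exists (c : T -> R) (K V : set T),
  [/\ continuous c, forall y, 0 <= c y <= 1,
     compact K /\ K `<=` W, forall y, c y != 0 -> K y &
     [/\ open V, V x, V `<=` K & forall y, V y -> c y = 1]].
Proof.
move=> oW Wx; have [/= B nB [cB clB]] : exists2 B, nbhs x B & compact B /\ closed B.
  have [B nB ?] := @lcT x I; exists B => //; move: nB; rewrite /within /=.
  by apply: filterS => y; apply.
have nU : nbhs x (B° `&` W).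
  by apply: filterI; [exact: nbhs_interior|exact: open_nbhs_nbhs].
have oU : open (B° `&` W) by apply: openI => //; exact: open_interior.
have cU : closed (~` (B° `&` W)) by exact: open_closedC.
have nUx : ~ (~` (B° `&` W)) x by move=> h; apply: h; exact: nbhs_singleton nU.
have /(@uniform_separatorP _ R) [f [cf f01 f0 f1]] :=
  @locally_compact_completely_regular T R lcT hT _ _ cU nUx.
have f0x : f x = 0 by apply: f0; exists x.
have fU y : f y < 1 -> (B° `&` W) y.
  move=> fy; apply: contrapT => nUy.
  by move: fy; rewrite (f1 (f y))/= ?ltxx//; exists y.
(* 1 for [t <= 1/3] and 0 for [t >= 2/3] *)
pose h (t : R) := Num.max 0 (Num.min 1 (2 - 3 * t)).
have ch : continuous h.
  move=> t; have c1 : {for t, continuous ((fun t => 2 - 3 * t) : R -> R^o)}.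
    by apply: cvgB; [exact: cvg_cst|apply: cvgM; [exact: cvg_cst|exact: cvg_id]].
  have c0 (a : R) : {for t, continuous ((fun=> a) : R -> R^o)} by exact: cvg_cst.
  exact: (continuous_max (c0 0) (continuous_min (c0 1) c1)).
exists (h \o f), (f @^-1` `]-oo, 2/3]), (f @^-1` `]-oo, 1/3[).
have KU : f @^-1` `]-oo, 2/3] `<=` B° `&` W.
  by move=> y /=; rewrite in_itv /= => fy; apply: fU; lra.
have clK : closed (f @^-1` `]-oo, 2/3]).
  by move/continuous_closedP : cf; apply; exact: interval_closed.
split.
- by move=> y; apply: continuous_comp; [exact: cf|exact: ch].
- move=> y; rewrite /= /h le_max lexx /= ge_max ler01 /= ge_min lexx //.
- split; last by move=> y /KU[].
  apply: (compact_sub clK cB) => y /KU[By _]; exact: interior_subset.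
- move=> y /=; rewrite in_itv /= /h; apply: contraNT; rewrite -ltNge => fy.
  by apply/eqP/max_idPl; rewrite ge_min; apply/orP; right; lra.
split.
- by move/continuousP : cf; apply; exact: interval_open.
- by rewrite /= in_itv /= f0x divr_gt0.
- by move=> y /=; rewrite !in_itv /= => fy; lra.
- move=> y /=; rewrite in_itv /= /h => fy.
  by rewrite min_l ?max_r//; lra.
Qed.

End bumps.

(** Openness of [t] makes the transported function continuous on the image of
[W]; the image of the carrier is compact, hence closed, so that the extension by
zero is continuous elsewhere. *)
Lemma push_forward (R : realType) (T S : topologicalType) (t : T -> S)
    (W K : set T) (f : T -> R[i]) :
  hausdorff_space S -> open W -> {in W &, injective t} ->
  (forall y, W y -> {for y, continuous t}) ->
  (forall B, B `<=` W -> open B -> open (t @` B)) ->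
  compact K -> K `<=` W -> continuous (f : T -> R[i]^o) ->
  (forall y, f y != 0 -> K y) ->
  exists g : S -> R[i], [/\ continuous (g : S -> R[i]^o),
    forall y, W y -> g (t y) = f y, compact (t @` K) &
    forall z, g z != 0 -> exists2 y, K y & t y = z].
Proof.
move=> hS oW tinj ct ot cK KW cf fK.
pose g z := if pselect (exists y, W y /\ t y = z) is left h
  then f (projT1 (cid h)) else 0.
have gt y : W y -> g (t y) = f y.
  move=> Wy; rewrite /g; case: pselect => [h|[]]; last by exists y.
  case: cid => y' /= [Wy' ty']; congr f; apply: tinj => //; exact: mem_set.
have g0 z : g z != 0 -> exists2 y, K y & t y = z.
  rewrite /g; case: pselect => [h|_]; last by rewrite eqxx.
  by case: cid => y /= [Wy <-] /fK Ky; exists y.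
have ctK : compact (t @` K).
  apply: continuous_compact cK; apply/subspace_continuousP => y Ky.
  exact: cvg_within_filter (ct y (KW _ Ky)).
exists g; split => //; apply/continuousP_normc => z e e0.
have [[y [Wy <-]]|nz] := pselect (exists y, W y /\ t y = z).
  rewrite gt//; move/continuousP_normc : (cf) => /(_ y e e0).
  rewrite nbhsE => -[B [oB By] Be].
  have : nbhs (t y) (t @` (B `&` W)).
    apply: open_nbhs_nbhs; split; last by exists y.
    by apply: ot; [exact: subIsetr | exact: openI].
  by apply: filterS => _ [y' [By' Wy'] <-] /=; rewrite gt//; exact: Be.
have clK := compact_closed hS ctK.
have : nbhs z (~` (t @` K)).
  apply: open_nbhs_nbhs; split; first exact: closed_openC.
  by move=> [y Ky tyz]; apply: nz; exists y; split => //; exact: KW.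
have gz : g z = 0.
  apply/eqP; apply/negPn; apply/negP => /g0[y Ky tyz]; apply: nz; exists y.
  by split => //; exact: KW.
apply: filterS => w /= nw; have -> : g w = 0.
  by apply/eqP; apply/negPn; apply/negP => /g0[y Ky tyw]; apply: nw; exists y.
by rewrite gz subrr Normc.normc0.
Qed.

(** * Factorisation of paths *)

Section kgraph.
Context {k : nat} (L : topological_kgraph k).
Implicit Types (m n p q : {ffun 'I_k -> nat}) (U V W : set L) (x y z v a b : L).

Lemma deg_addI m n n' : m + n = m + n' -> n = n'.
Proof. by move/ffunP => h; apply/ffunP => i; have := h i; rewrite !ffunE => /addnI. Qed.

Lemma deg_sub0 m : deg_sub m 0 = m.
Proof. by apply/ffunP => i; rewrite !ffunE subn0. Qed.

Lemma deg_addK m n : deg_sub (m + n) m = n.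
Proof. by apply/ffunP => i; rewrite !ffunE addKn. Qed.

Lemma deg_joinl p q : p + deg_sub (deg_join p q) p = deg_join p q.
Proof. by apply/ffunP => i; rewrite !ffunE; apply: subnKC; exact: leq_maxl. Qed.

Lemma deg_joinr p q : q + deg_sub (deg_join p q) q = deg_join p q.
Proof. by apply/ffunP => i; rewrite !ffunE; apply: subnKC; exact: leq_maxr. Qed.

Lemma kg_d_s x : kg_d (kg_s x) = 0.
Proof. by rewrite -kg_rs kg_d_id. Qed.

Lemma comp_inj m n a b a' b' : kg_d a = m -> kg_d b = n -> kg_s a = kg_r b ->
  kg_d a' = m -> kg_d b' = n -> kg_s a' = kg_r b' ->
  kg_comp a b = kg_comp a' b' -> a = a' /\ b = b'.
Proof.
move=> da db ab da' db' ab' e.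
have dab : kg_d (kg_comp a b) = m + n by rewrite kg_d_comp// da db.
have [ab0 [_ u]] := kg_factor dab.
have e1 : ab0 = (a, b) by exact: u.
have e2 : ab0 = (a', b') by apply: u; split => //=.
by move: e1; rewrite e2 => -[-> ->].
Qed.

(** Both [(r v, v)] and [(v, s v)] factor a path [v] of degree 0. *)
Lemma deg0_id v : kg_d v = 0 -> kg_s v = v /\ kg_r v = v.
Proof.
move=> dv; have [] // := @comp_inj 0 0 (kg_r v) v v (kg_s v).
- exact: kg_d_id.
- by rewrite kg_sr.
- exact: kg_d_s.
- by rewrite kg_rs.
- by rewrite kg_comp1l kg_comp1r.
Qed.

Definition head m x := segment x 0 m.
Definition tail m n x := segment x m (m + n).

Lemma head_comp m n a b : kg_d a = m -> kg_d b = n -> kg_s a = kg_r b ->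
  head m (kg_comp a b) = a.
Proof.
move=> da db ab; apply: xget_unique => [|y [w [z [dw dy wy yz e]]]].
  exists (kg_r a), b; rewrite kg_d_id deg_sub0 kg_sr; split => //.
  by rewrite -{1}(kg_r_comp ab) kg_comp1l.
have [sw _] := deg0_id dw.
have e1 : kg_comp a b = kg_comp y z.
  by rewrite e -{1}sw wy -{1}(kg_r_comp yz) kg_comp1l.
rewrite deg_sub0 in dy.
have dz : kg_d z = n.
  apply: (@deg_addI m); rewrite -{1}dy -kg_d_comp// -e1 kg_d_comp//.
  by rewrite da db.
by have [->] := comp_inj da db ab dy dz yz e1.
Qed.

Lemma tail_comp m n a b : kg_d a = m -> kg_d b = n -> kg_s a = kg_r b ->
  tail m n (kg_comp a b) = b.
Proof.
move=> da db ab; apply: xget_unique => [|y [w [z [dw dy wy yz e]]]].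
  exists a, (kg_s b); rewrite deg_addK kg_rs; split => //.
  by rewrite kg_comp1r.
rewrite deg_addK in dy.
have dz : kg_d z = 0.
  have dyz : kg_d (kg_comp y z) = n + kg_d z by rewrite kg_d_comp// dy.
  have wyz : kg_s w = kg_r (kg_comp y z) by rewrite kg_r_comp.
  apply: (@deg_addI n); apply: (@deg_addI m).
  by rewrite -dyz -{1}dw -kg_d_comp// -e kg_d_comp// addr0 da db.
have [_ rz] := deg0_id dz.
have e1 : kg_comp a b = kg_comp w y by rewrite e -rz -yz kg_comp1r.
by have [_ ->] := comp_inj da db ab dw dy wy e1.
Qed.

Lemma factorisation m n x : kg_d x = m + n ->
  [/\ kg_d (head m x) = m, kg_d (tail m n x) = n,
      kg_s (head m x) = kg_r (tail m n x)
    & kg_comp (head m x) (tail m n x) = x].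
Proof.
move=> dx; have [[a b] [/= [da db ab ->] _]] := kg_factor dx.
by rewrite (head_comp da db ab) (tail_comp da db ab).
Qed.

Lemma kg_s_tail m n x : kg_d x = m + n -> kg_s (tail m n x) = kg_s x.
Proof.
by move=> dx; have [_ _ ab {2}<-] := factorisation dx; rewrite kg_s_comp.
Qed.

Lemma factor_inj m n x y : kg_d x = m + n -> kg_d y = m + n ->
  head m x = head m y -> tail m n x = tail m n y -> x = y.
Proof.
move=> dx dy hxy txy; have [_ _ _ <-] := factorisation dx.
by have [_ _ _ <-] := factorisation dy; rewrite hxy txy.
Qed.

Lemma open_paths n : open (paths n : set L).
Proof. exact: (@kg_d_continuous k L [set n]). Qed.

Lemma closed_paths n : closed (paths n : set L).
Proof.
by rewrite -openC; exact: (@kg_d_continuous k L (~` [set n])).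
Qed.

Definition s_inj W := {in W &, injective (@kg_s k L)}.

Lemma s_injE W x y : s_inj W -> W x -> W y -> kg_s x = kg_s y -> x = y.
Proof. by move=> h Wx Wy; apply: h; exact: mem_set. Qed.

Lemma s_inj_sub W W' : W `<=` W' -> s_inj W' -> s_inj W.
Proof. by move=> h i x y; rewrite !inE => /h Wx /h Wy; exact: (s_injE i Wx Wy). Qed.

Lemma s_inj_nbhs n x : paths n x ->
  exists W, [/\ open W, W x, W `<=` paths n & s_inj W].
Proof.
move=> nx; have [A [oA Ax iA _ _]] := kg_s_local_homeo x.
exists (A `&` paths n); split => //.
- by apply: openI; [exact: oA|exact: open_paths].
- by apply: s_inj_sub iA; exact: subIsetl.
Qed.

Lemma kg_s_continuous : continuous (@kg_s k L).
Proof.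
move=> x; have [A [oA Ax _ cA _]] := kg_s_local_homeo x.
by move: cA; rewrite continuous_open_subspace//; apply; exact: mem_set.
Qed.

Lemma open_source U : open U -> open (@kg_s k L @` U).
Proof.
move=> oU; rewrite openE => _ [x Ux <-].
have [A [oA Ax _ _ h]] := kg_s_local_homeo x.
rewrite /interior nbhsE; exists (@kg_s k L @` (A `&` U)); last first.
  by move=> _ [y [_ Uy] <-]; exists y.
split; last by exists x.
by apply: h; [exact: subIsetl | exact: openI].
Qed.

Lemma open_path_mul U V : open U -> open V -> open (path_mul U V).
Proof.
move=> oU oV.
have oW : open ((fst @^-1` U) `&` (snd @^-1` V) : set (L * L)).
  apply: openI; apply: open_comp => // x _; [exact: cvg_fst|exact: cvg_snd].
have := kg_comp_open oW; congr open; apply/seteqP; split => z.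
  by move=> [[x y] /= [[Ux Vy] xy] <-]; exists x, y.
by move=> [x [y [Ux Vy xy ->]]]; exists (x, y).
Qed.

(** Composition is open, and injective on pairs of given degrees, so that its
inverse is continuous. *)
Lemma head_continuous m n x : paths (m + n) x -> {for x, continuous (head m)}.
Proof.
move=> dx N nN; move: (nN); rewrite nbhsE => -[U [oU Ux] UN].
have [dh dt ht e] := factorisation dx.
have oc : open (path_mul (U `&` paths m) (paths n)).
  by apply: open_path_mul; [apply: openI => //|]; exact: open_paths.
have nx : nbhs x (path_mul (U `&` paths m) (paths n)).
  apply: open_nbhs_nbhs; split => //.
  by exists (head m x), (tail m n x).
have sub : path_mul (U `&` paths m) (paths n) `<=` head m @^-1` N.
  move=> _ [a [b [[Ua da] db ab ->]]]; apply: UN.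
  by rewrite (head_comp da db ab).
exact: filterS sub nx.
Qed.

Lemma tail_continuous m n x : paths (m + n) x ->
  {for x, continuous (tail m n)}.
Proof.
move=> dx N nN; move: (nN); rewrite nbhsE => -[U [oU Ux] UN].
have [dh dt ht e] := factorisation dx.
have oc : open (path_mul (paths m) (U `&` paths n)).
  by apply: open_path_mul; [|apply: openI => //]; exact: open_paths.
have nx : nbhs x (path_mul (paths m) (U `&` paths n)).
  apply: open_nbhs_nbhs; split => //.
  by exists (head m x), (tail m n x).
have sub : path_mul (paths m) (U `&` paths n) `<=` tail m n @^-1` N.
  move=> _ [a [b [da [Ub db] ab ->]]]; apply: UN.
  by rewrite (tail_comp da db ab).
exact: filterS sub nx.
Qed.

Lemma tail_inj m n W : W `<=` paths (m + n) -> s_inj W ->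
  {in W &, injective (tail m n)}.
Proof.
move=> Wp Wi x y; rewrite !inE => Wx Wy txy; apply: (s_injE Wi) => //.
by rewrite -(kg_s_tail (Wp _ Wx)) -(kg_s_tail (Wp _ Wy)) txy.
Qed.

(** The source map is a local homeomorphism which factors through the tail, so
that the tail is a local homeomorphism as well. *)
Lemma tail_open m n U : U `<=` paths (m + n) -> open U ->
  open (tail m n @` U).
Proof.
move=> Up oU; rewrite openE => _ [x Ux <-].
have dx := Up _ Ux.
have [N [oN Nx _ Ni]] := s_inj_nbhs (erefl (kg_d (tail m n x))).
have : nbhs x (U `&` (tail m n @^-1` N)).
  apply: filterI; first exact: open_nbhs_nbhs.
  by apply: (tail_continuous dx); exact: open_nbhs_nbhs.
rewrite nbhsE => -[B [oB Bx] BU].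
rewrite /interior nbhsE; exists (N `&` (@kg_s k L @^-1` (@kg_s k L @` B))).
  split; last first.
    by split => //; exists x => //; rewrite (kg_s_tail dx).
  apply: openI => //.
  by move/continuousP : kg_s_continuous; apply; exact: open_source.
move=> z [Nz [y By syz]]; have [Uy Ny] := BU _ By.
exists y => //; apply: (s_injE Ni) => //.
by rewrite (kg_s_tail (Up _ Uy)).
Qed.

Definition fib n v : set L := [set x | paths n x /\ kg_s x = v].

End kgraph.

(** * Continuous functions with compact support *)

Section functions.
Context (R : realType) {k : nat} (L : topological_kgraph k).
Local Notation C := R[i].
Implicit Types (m n p : {ffun 'I_k -> nat}) (f g h u : L -> C) (v x y : L).
Implicit Types (M N e : R) (K W : set L).

Lemma Cc_intro n f K : continuous (f : L -> C^o) -> compact K ->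
  K `<=` paths n -> (forall x, f x != 0 -> K x) -> Cc n f.
Proof.
move=> cf cK Kn fK; split => // [x nx|].
  by apply/eqP; apply: contra_notT nx => /fK /Kn.
apply: (compact_sub _ cK); first exact: closed_closure.
apply: subset_trans (compact_closed (@kg_hausdorff _ L) cK).
by apply: closure_subset => x /fK.
Qed.

Lemma Cc_carrier n f : Cc n f -> exists K, [/\ compact K, K `<=` paths n &
  forall x, f x != 0 -> K x].
Proof.
move=> [cf f0 cK]; exists (closure [set x | f x != 0]); split => //.
  apply: subset_trans (@closed_paths _ L n).
  by apply: closure_subset => x /= fx0; apply: contrapT => /f0 /eqP; apply/negP.
by move=> x fx0; apply: subset_closure.
Qed.

Lemma Cc_cont n f : Cc n f -> continuous (f : L -> C^o).
Proof. by case. Qed.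

Lemma Cc_off n f x : Cc n f -> ~ paths n x -> f x = 0.
Proof. by case=> _ + _; apply. Qed.

Lemma Cc_comb n f g (a b : L -> C) : Cc n f -> Cc n g ->
  continuous (a : L -> C^o) -> continuous (b : L -> C^o) ->
  Cc n (fun x => a x * f x + b x * g x).
Proof.
move=> cf cg ca cb; have [K [cK Kn fK]] := Cc_carrier cf.
have [K' [cK' Kn' gK]] := Cc_carrier cg.
apply: (@Cc_intro _ _ (K `|` K')).
- exact: (continuous_add (continuous_mul ca (Cc_cont cf))
    (continuous_mul cb (Cc_cont cg))).
- exact: compactU.
- by move=> x [/Kn|/Kn'].
move=> x; have [->|/fK] := eqVneq (f x) 0; last by left.
have [->|/gK] := eqVneq (g x) 0; last by right.
by rewrite !mulr0 addr0 eqxx.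
Qed.

Lemma CcD n f g : Cc n f -> Cc n g -> Cc n (fun x => f x + g x).
Proof.
move=> cf cg; have := Cc_comb cf cg (@continuous_cst R L 1) (@continuous_cst R L 1).
by congr Cc; apply/funext => x; rewrite !mul1r.
Qed.

Lemma CcB n f g : Cc n f -> Cc n g -> Cc n (fun x => f x - g x).
Proof.
move=> cf cg; have := Cc_comb cf cg (@continuous_cst R L 1) (@continuous_cst R L (- 1)).
by congr Cc; apply/funext => x; rewrite mul1r mulN1r.
Qed.

Lemma CcM n f (a : L -> C) : Cc n f -> continuous (a : L -> C^o) ->
  Cc n (fun x => a x * f x).
Proof.
move=> cf ca; have := Cc_comb cf cf ca (@continuous_cst R L 0).
by congr Cc; apply/funext => x; rewrite mul0r addr0.
Qed.

Lemma Cc0 n : Cc n (fun _ : L => 0 : C).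
Proof.
apply: (@Cc_intro _ _ set0) => //; first exact: continuous_cst.
  exact: compact0.
by move=> x; rewrite eqxx.
Qed.

Lemma Cc_conj n f : Cc n f -> Cc n (fun x => (f x)^*).
Proof.
move=> cf; have [K [cK Kn fK]] := Cc_carrier cf.
apply: (Cc_intro _ cK Kn); first by apply: continuous_conj; exact: Cc_cont cf.
by move=> x; rewrite conjC_eq0; exact: fK.
Qed.

Definition carried f W := exists K, [/\ compact K, K `<=` W &
  forall x, f x != 0 -> K x].

Lemma carriedE f W x : carried f W -> f x != 0 -> W x.
Proof. by move=> [K [_ KW fK]] /fK /KW. Qed.

(** A partition of unity in disguise: with bumps [c] around finitely many points
covering the support of [f], [f = c f + (1 - c) f] peels off one bump at a
time, and nothing is left after the last one. *)
Lemma Cc_ind n (P : (L -> C) -> Prop) :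
  P (fun=> 0) ->
  (forall f g, Cc n f -> Cc n g -> P f -> P g -> P (fun x => f x + g x)) ->
  (forall x, paths n x -> exists W, [/\ open W, W x &
     forall f, Cc n f -> carried f W -> P f]) ->
  forall f, Cc n f -> P f.
Proof.
move=> P0 PD Ploc.
pose Q x (c : L -> R) := [/\ continuous c, nbhs x [set y | c y = 1] &
  forall f, Cc n f -> P (fun y => (c y)%:C * f y)].
have /choice[c cQ] : forall x, exists c, paths n x -> Q x c.
  move=> x; have [nx|nx] := pselect (paths n x); last by exists (cst 0).
  have [W [oW Wx WP]] := Ploc _ nx.
  have [c [K [V [cc _ [cK KW] c0 [oV Vx _ V1]]]]] :=
    @bump R L (@kg_locally_compact _ L) (@kg_hausdorff _ L) _ _ oW Wx.
  exists c => _; split => //.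
    by apply: (@filterS _ (nbhs x) _ V) => //; exact: open_nbhs_nbhs.
  move=> f cf; apply: WP.
    exact: (CcM cf (continuous_complex cc)).
  exists K; split => // y; have [->|/c0//] := eqVneq (c y) 0.
  by rewrite mul0r eqxx.
move=> f cf; have [K [cK Kn fK]] := Cc_carrier cf.
have Kc x : K x -> nbhs x [set y | c x y = 1] by move=> /Kn/cQ[].
have [E [EK KE]] := compact_fset_cover cK Kc.
have {KE} : forall y, f y * \prod_(x <- E) (1 - (c x y)%:C) = 0.
  move=> y; have [->|/fK/KE[x xE /= cxy]] := eqVneq (f y) 0; first by rewrite mul0r.
  by rewrite (big_fsetD1 x)//= cxy subrr mul0r mulr0.
have {EK} : forall x, x \in enum_fset E -> paths n x by move=> x /EK /Kn.
elim: (enum_fset E) f cf {K cK Kn fK Kc} => [|x s IH] f cf sn f0.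
  have -> : f = fun=> 0; last exact: P0.
  by apply/funext => y; have := f0 y; rewrite big_nil mulr1.
have [cc _ Pc] := cQ x (sn x (mem_head _ _)).
have -> : f = fun y => (c x y)%:C * f y + (1 - (c x y)%:C) * f y.
  by apply/funext => y; rewrite -mulrDl addrCA subrr addr0 mul1r.
have c1 : continuous ((fun y => 1 - (c x y)%:C) : L -> C^o).
  move=> y; apply: (@cvgB C C^o); first exact: cvg_cst.
  exact: (continuous_complex cc).
apply: PD; [| |exact: Pc|].
- exact: (CcM cf (continuous_complex cc)).
- exact: (CcM cf c1).
- apply: IH => [||y]; first exact: (CcM cf c1).
    by move=> y ys; apply: sn; rewrite inE ys orbT.
  by have := f0 y; rewrite big_cons mulrA [f y * _]mulrC.
Qed.

Lemma compact_bounded f K : continuous (f : L -> C^o) -> compact K ->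
  exists2 M, 0 <= M & forall x, K x -> sqn (f x) <= M.
Proof.
move=> /continuousP_normc cf cK.
have [E [EK KE]] := compact_fset_cover cK (fun x _ => cf x 1 ltr01).
have S0 : 0 <= \sum_(x <- E) sqn (f x) by apply: sumr_ge0 => x _; exact: sqn_ge0.
exists (2 * (1 + \sum_(x <- E) sqn (f x))); first lra.
move=> y /KE[x xE /= xy].
rewrite -[f y](subrK (f x)) (le_trans (sqnD _ _))// ler_pM2l// lerD//.
  by rewrite -normc_sqn normcBC exprn_ile1 ?normc_ge0// ltW.
rewrite (big_fsetD1 x)//= lerDl; apply: sumr_ge0 => z _; exact: sqn_ge0.
Qed.

Lemma Cc_bounded n f : Cc n f -> exists2 M, 0 <= M & forall x, sqn (f x) <= M.
Proof.
move=> cf; have [K [cK Kn fK]] := Cc_carrier cf.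
have [M M0 fM] := compact_bounded (Cc_cont cf) cK; exists M => // x.
by have [->|/fK/fM//] := eqVneq (f x) 0; rewrite sqn0.
Qed.

(** [M] bounds the square of the norm of the Hilbert module. *)
Definition bd n f M := forall v, l2 (fib n v) f M.

Lemma bd_le n f M N : M <= N -> bd n f M -> bd n f N.
Proof. by move=> MN fM v; apply: l2_le (fM v). Qed.

Lemma bd_eq n f g M : (forall x, paths n x -> f x = g x) -> bd n f M -> bd n g M.
Proof. by move=> fg fM v; apply: l2_eq (fM v) => x [nx _]; exact: fg. Qed.

Lemma bdD n f g M N : bd n f M -> bd n g N ->
  bd n (fun x => f x + g x) (2 * (M + N)).
Proof. by move=> fM gN v; exact: l2D. Qed.

Lemma bdB n f g M N : bd n f M -> bd n g N ->
  bd n (fun x => f x - g x) (2 * (M + N)).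
Proof. by move=> fM gN v; exact: l2B. Qed.

Lemma bdBC n f g M : bd n (fun x => f x - g x) M -> bd n (fun x => g x - f x) M.
Proof. by move=> fM v; exact: l2BC. Qed.

Lemma bdZ n f M (c : C) : bd n f M -> bd n (fun x => c * f x) (sqn c * M).
Proof. by move=> fM v; exact: l2Z. Qed.

Lemma bd_tri n f g h M N : bd n (fun x => f x - g x) M ->
  bd n (fun x => g x - h x) N -> bd n (fun x => f x - h x) (2 * (M + N)).
Proof.
move=> fg gh; apply: bd_eq (bdD fg gh) => x _.
by rewrite addrA subrK.
Qed.

Lemma bd_pt n f M x : paths n x -> bd n f M -> sqn (f x) <= M.
Proof. by move=> nx /(_ (kg_s x)); apply: l2_pt. Qed.

Lemma bd_ge0 n f M x : bd n f M -> 0 <= M.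
Proof. by move=> /(_ x)/l2_ge0. Qed.

Lemma s_inj_l2 n f W M v : s_inj W -> (forall x, f x != 0 -> W x) -> 0 <= M ->
  (forall x, sqn (f x) <= M) -> l2 (fib n v) f M.
Proof.
move=> Wi fW M0 fM.
have [[y [[ny sy] fy]]|h] := pselect (exists y, fib n v y /\ f y != 0).
  apply: l2_le (fM y) _; rewrite -(big_seq_fset1 +%R y (fun y => sqn (f y))).
  apply: l2_fin => x [nx sx] fx; rewrite inE; apply/eqP.
  by apply: (s_injE Wi); [exact: fW|exact: fW|rewrite sx].
apply: l2_le M0 _; rewrite -(big_seq_fset0 +%R (fun y => sqn (f y))).
by apply: l2_fin => x vx fx; exfalso; apply: h; exists x.
Qed.

(** Locally the support meets every fibre at most once. *)
Lemma Cc_fin n f : Cc n f -> (exists M, bd n f M) /\ forall v,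
  exists E : {fset L}, [set` E] `<=` fib n v /\
    forall x, fib n v x -> f x != 0 -> x \in E.
Proof.
move: f; apply: Cc_ind => [|f g cf cg [[M fM] fE] [[N gN] gE]|x nx].
- split=> [|v]; last by exists fset0; split => x /=; rewrite ?inE// eqxx.
  exists 0 => v F _; rewrite big1// => x _; exact: sqn0.
- split=> [|v]; first by exists (2 * (M + N)); exact: bdD.
  have [E [Ev EE]] := fE v; have [F [Fv FF]] := gE v.
  exists (E `|` F)%fset; split; first exact: fsetU_sub.
  move=> x vx; rewrite inE; have [->|/(EE _ vx) ->//] := eqVneq (f x) 0.
  by rewrite add0r => /(FF _ vx) ->; rewrite orbT.
have [W [oW Wx Wn Wi]] := s_inj_nbhs nx; exists W; split => // f cf fW.
have fW' y := carriedE (x := y) fW.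
split=> [|v].
  by have [M M0 fM] := Cc_bounded cf; exists M => v; exact: (s_inj_l2 Wi).
have [[y [vy fy]]|h] := pselect (exists y, fib n v y /\ f y != 0).
  exists [fset y]%fset; split=> z /=; rewrite inE; first by move/eqP ->.
  move=> [nz sz] fz; apply/eqP; apply: (s_injE Wi); [exact: fW'|exact: fW'|].
  by rewrite sz; case: vy => _ ->.
by exists fset0; split=> z /=; rewrite inE// => vz fz; exfalso; apply: h; exists z.
Qed.

Lemma Cc_bd n f : Cc n f -> exists M, bd n f M.
Proof. by case/Cc_fin. Qed.

(** The last clause says that [c] lives where the source map is injective, which
is what makes convex combinations with [c] cheap in [interpolation]. *)
Lemma peak_exists n x : paths n x -> exists c : L -> R,
  [/\ Cc n (fun y => (c y)%:C), forall y, 0 <= c y <= 1,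
      forall y, fib n (kg_s x) y -> c y = (y == x)%:R
    & forall v, (forall y, fib n v y -> c y = 0) \/
        exists2 z, fib n v z & forall y, fib n v y -> y != z -> c y = 0].
Proof.
move=> nx; have [W [oW Wx Wn Wi]] := s_inj_nbhs nx.
have [c [K [V [cc c01 [cK KW] c0 [oV Vx _ V1]]]]] :=
  @bump R L (@kg_locally_compact _ L) (@kg_hausdorff _ L) _ _ oW Wx.
exists c; split => //.
- apply: (Cc_intro (continuous_complex cc) cK); first exact: subset_trans Wn.
  by move=> y cy; apply: c0; apply: contraNneq cy => ->.
- move=> y [ny sy]; have [->|yx] := eqVneq y x; first exact: V1.
  apply/eqP; apply: contraTT yx => /c0/KW Wy; rewrite negbK; apply/eqP.
  exact: (s_injE Wi).
move=> v; have [[z [vz cz]]|h] := pselect (exists z, fib n v z /\ c z != 0).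
  right; exists z => // y vy; apply: contraTeq => cy; rewrite negbK; apply/eqP.
  apply: (s_injE Wi); [exact/KW/c0|exact/KW/c0|].
  by case: vy vz => _ -> [_ ->].
by left=> y vy; apply/eqP; apply/negPn; apply/negP => cy; apply: h; exists y.
Qed.

Lemma sqn_convex (t : R) (a b : C) : 0 <= t <= 1 ->
  sqn (t%:C * a + (1 - t%:C) * b) <= t * sqn a + (1 - t) * sqn b.
Proof.
move=> /andP[t0 t1]; case: a b => [x y] [z w]; rewrite /sqn /=.
rewrite -subr_ge0.
rewrite (_ : _ - _ = t * (1 - t) * ((x - z) ^+ 2 + (y - w) ^+ 2)); last by ring.
by rewrite mulr_ge0 ?mulr_ge0 ?subr_ge0 ?addr_ge0 ?sqr_ge0.
Qed.

(** Every finitely supported vector of a fibre extends, without increasing the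
norm, to an element of the module: convexity lets the next peak [c] be mixed
in as [c * value + (1 - c) * f]. *)
Lemma interpolation n v (E : {fset L}) (a : L -> C) : [set` E] `<=` fib n v ->
  exists f, [/\ Cc n f, forall x, fib n v x -> f x = if x \in E then a x else 0
    & bd n f (\sum_(x <- E) sqn (a x))].
Proof.
move=> Ev; have {Ev} : forall x, x \in enum_fset E -> fib n v x by [].
suff : forall s : seq L, (forall x, x \in s -> fib n v x) ->
  exists f, [/\ Cc n f, forall x, fib n v x -> f x = if x \in s then a x else 0
    & bd n f (\sum_(x <- s) sqn (a x))] by apply.
elim=> [|z s IH] sv.
  exists (fun=> 0); split => //; first exact: Cc0.
  by move=> w F _; rewrite big_nil big1// => x _; exact: sqn0.
have [|f [cf fs fM]] := IH; first by move=> x xs; apply: sv; rewrite inE xs orbT.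
have vz : fib n v z by apply: sv; exact: mem_head.
have [nz sz] := vz; have [c [cc c01 cv cw]] := peak_exists nz.
exists (fun x => (c x)%:C * a z + (1 - (c x)%:C) * f x); split.
- have -> : (fun x => (c x)%:C * a z + (1 - (c x)%:C) * f x) =
            (fun x => a z * (c x)%:C + (1 - (c x)%:C) * f x).
    by apply/funext => x; rewrite [a z * _]mulrC.
  apply: Cc_comb => //; first exact: continuous_cst.
  move=> y; apply: (@cvgB C C^o); first exact: cvg_cst.
  exact: (Cc_cont cc).
- move=> x vx; rewrite cv ?sz// fs// inE; case: eqVneq => [->|_] /=.
    by rewrite mul1r subrr mul0r addr0.
  by rewrite mul0r subr0 mul1r add0r.
move=> w F Fw; rewrite big_cons.
apply: (@le_trans _ _ (\sum_(x <- F) (c x * sqn (a z) + sqn (f x)))).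
  apply: ler_sum => x _; rewrite (le_trans (sqn_convex _ _ (c01 x)))// lerD2l.
  have /andP[cx0 _] := c01 x.
  by rewrite -[leRHS]mul1r ler_wpM2r ?sqn_ge0// gerBl.
rewrite big_split /=; apply: lerD; last exact: (fM w F Fw).
rewrite -mulr_suml -[leRHS]mul1r ler_wpM2r ?sqn_ge0//.
have [c0|[y wy c0]] := cw w.
  rewrite big1_seq// => x /= xF; rewrite c0//; exact: Fw.
have /andP[_ cy1] := c01 y; apply: le_trans cy1.
rewrite -(big_seq_fset1 +%R y c); apply: sum_le_sub => [x|x xF].
  by have /andP[] := c01 x.
rewrite inE; apply: contraNT => xy; rewrite c0//; exact: Fw.
Qed.

End functions.

(** * The modules as closures *)

Section modules.
Context (R : realType) {k : nat} (L : topological_kgraph k).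
Local Notation C := R[i].
Implicit Types (m n p : {ffun 'I_k -> nat}) (f g h u : L -> C) (v x y : L).
Implicit Types (M N e : R) (K W : set L).

Lemma sup_norm_ge f M x : (forall x, sqn (f x) <= M) ->
  sqn (f x) <= sup_norm f ^+ 2.
Proof.
move=> fM; have M0 : 0 <= M by exact: le_trans (sqn_ge0 _) (fM x).
have h : Normc.normc (f x) <= sup_norm f.
  apply: ub_le_sup; last by exists x.
  exists (Num.sqrt M) => _ [y _ <-].
  by rewrite normc_le_sqn ?sqrtr_ge0// sqr_sqrtr.
by rewrite -normc_le_sqn// (le_trans (normc_ge0 _) h).
Qed.

Lemma sup_norm_ge0 f : 0 <= sup_norm f.
Proof.
rewrite /sup_norm; set A := (X in sup X).
have [[a Aa]|A0] := pselect (A !=set0); last first.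
  by rewrite (_ : A = set0) ?sup0//; apply/seteqP; split=> // y Ay; apply: A0; exists y.
have [hA|] := pselect (has_ubound A); last first.
  by move=> hA; rewrite sup_out// => -[_].
have a0 : 0 <= a by case: Aa => x _ <-; exact: normc_ge0.
by apply: le_trans a0 _; apply: ub_le_sup.
Qed.

Lemma sup_norm_le f e : 0 <= e -> (forall x, Normc.normc (f x) <= e) ->
  sup_norm f <= e.
Proof.
move=> e0 fe; rewrite /sup_norm; set A := (X in sup X).
have [[a Aa]|A0] := pselect (A !=set0); last first.
  by rewrite (_ : A = set0) ?sup0//; apply/seteqP; split=> // y Ay; apply: A0; exists y.
by apply: ge_sup; [exists a | move=> _ [x _ <-]].
Qed.

Lemma innerE n f g v : inner n f g v = ip (fib n v) f g.
Proof. by []. Qed.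

Lemma inner_norm_sqr n f : inner_norm n f ^+ 2 = sup_norm (inner n f f).
Proof. by rewrite sqr_sqrtr// sup_norm_ge0. Qed.

Lemma inner_norm_le n f M : 0 <= M -> bd n f M -> inner_norm n f ^+ 2 <= M.
Proof.
move=> M0 fM; rewrite inner_norm_sqr; apply: sup_norm_le => // v.
have [s [sE s0 sM _]] := ip_self (fM v).
by rewrite innerE sE normc_real ger0_norm.
Qed.

Lemma bd_inner_norm n f M : bd n f M -> bd n f (inner_norm n f ^+ 2).
Proof.
move=> fM v; have [s [sE s0 sM fs]] := ip_self (fM v); apply: l2_le fs.
rewrite inner_norm_sqr -(ger0_norm s0) -normc_real -sE.
apply: ub_le_sup; last by exists v.
exists M => _ [w _ <-]; have [t [tE t0 tM _]] := ip_self (fM w).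
by rewrite innerE tE normc_real ger0_norm.
Qed.

(** Finite sums over a fibre pass to the uniform limit of a Cauchy sequence, so
that the completion is a closure in the space of functions whose fibrewise
norms are bounded. *)
Lemma XP n f : X n f <-> (forall x, ~ paths n x -> f x = 0) /\
  forall e, 0 < e -> exists2 u, Cc n u & bd n (fun x => f x - u x) e.
Proof.
split=> [[[cf f0 fC] [u [cu ucauchy uf]]]|[f0 fapp]].
  split=> // e e0; have e40 : 0 < Num.sqrt (e / 4) by rewrite sqrtr_gt0 divr_gt0.
  have [i ui] := ucauchy _ e40; exists (u i) => // v F Fv.
  have uib j : (i <= j)%N -> bd n (fun x => u j x - u i x) (e / 4).
    move=> ij; have [M uM] := Cc_bd (CcB (cu j) (cu i)).
    apply: bd_le (bd_inner_norm uM).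
    rewrite -[leRHS]sqr_sqrtr; last by rewrite divr_ge0// ltW.
    have /ltW := ui j i ij (leqnn i).
    by rewrite ler_sqr ?nnegrE ?sqrtr_ge0.
  (* so small that the errors at the points of [F] add up to at most [e / 4] *)
  pose d := Num.sqrt (e / (4 * (size F).+1%:R)).
  have d0 : 0 < d by rewrite sqrtr_gt0 divr_gt0// mulr_gt0.
  move/cvgrPdist_lt : uf => /(_ _ d0) [j _ ufd].
  have /= := ufd (maxn i j) (leq_maxr i j); rewrite sub0r normrN.
  rewrite ger0_norm ?sup_norm_ge0// => sd.
  have uij := uib _ (leq_maxl i j).
  set l := maxn i j in sd uij.
  have [M M0 uM] := Cc_bounded (cu l).
  have [K cK fK] := fC 1 ltr01; have [M' M'0 fM'] := compact_bounded cf cK.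
  have ufb x : sqn ((u l - f) x) <= 2 * (M + (M' + 1)).
    apply: le_trans (sqnD _ _) _; rewrite ler_pM2l// lerD// sqnN.
    have [/fM' fx|/fK fx] := pselect (K x); first by rewrite (le_trans fx)// lerDl.
    rewrite ler_wpDl// -normc_sqn exprn_ile1 ?normc_ge0// ltW//.
  have fl x : sqn (f x - u l x) <= e / (4 * (size F).+1%:R).
    rewrite sqnBC (le_trans (sup_norm_ge x ufb))//.
    rewrite -[leRHS]sqr_sqrtr; last by rewrite divr_ge0 ?mulr_ge0// ltW.
    by rewrite ler_sqr ?nnegrE ?sqrtr_ge0 ?sup_norm_ge0// ltW.
  apply: (@le_trans _ _ (\sum_(x <- F) (2 * sqn (f x - u l x) +
     2 * sqn (u l x - u i x)))).
    apply: ler_sum => x _; rewrite -mulrDr.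
    by rewrite -[f x - u i x](subrKA (u l x)) sqnD.
  rewrite big_split /= -!mulr_sumr; have := uij v F Fv.
  have : \sum_(x <- F) sqn (f x - u l x) <= e / 4.
    apply: (@le_trans _ _ (\sum_(x <- F) e / (4 * (size F).+1%:R))).
      by apply: ler_sum => x _; exact: fl.
    rewrite big_const_seq count_predT iter_addr_0 -[X in X <= _]mulr_natl invfM !mulrA.
    rewrite ler_pdivrMr// -[X in X <= _]mulrA mulrC ler_wpM2l ?ler_nat//.
    by rewrite divr_ge0// ltW.
  lra.
have off u x : Cc n u -> ~ paths n x -> f x - u x = 0.
  by move=> cu nx; rewrite f0// (Cc_off cu)// subrr.
have fu u e x : Cc n u -> bd n (fun x => f x - u x) e -> 0 <= e ->
    sqn (f x - u x) <= e.
  move=> cu ue e0; have [nx|nx] := pselect (paths n x).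
    exact: (bd_pt nx ue).
  by rewrite (off u)// sqn0.
split; first split=> //.
- apply/continuousP_normc => x e e0.
  have e30 : 0 < e / 4 by rewrite divr_gt0.
  have [u cu ue] := fapp _ (exprn_gt0 2 e30).
  have fu3 z : Normc.normc (f z - u z) <= e / 4.
    by rewrite normc_le_sqn ?(ltW e30)// (fu u)// ltW// exprn_gt0.
  move/continuousP_normc : (Cc_cont cu) => /(_ x _ e30); apply: filterS => y /= uxy.
  have -> : f x - f y = (f x - u x) + ((u x - u y) + (u y - f y)).
    by rewrite subrKA subrKA.
  rewrite (le_lt_trans (normcD _ _))//.
  have := normcD (u x - u y) (u y - f y); rewrite (normcBC (u y)).
  by have := fu3 x; have := fu3 y; lra.
- move=> e e0; have e20 : 0 < e / 2 by rewrite divr_gt0.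
  have [u cu ue] := fapp _ (exprn_gt0 2 e20).
  have [K [cK _ uK]] := Cc_carrier cu; exists K => // x nK.
  have ux0 : u x = 0 by apply/eqP; apply: contra_notT nK => /uK.
  have := fu u _ x cu ue (sqr_ge0 _); rewrite ux0 subr0 -normc_le_sqn ?(ltW e20)//.
  by move=> /le_lt_trans; apply; rewrite ltr_pdivrMr// ltr_pMr// ltr1n.
have iS (i : nat) : 0 < i.+1%:R^-1 :> R by rewrite invr_gt0.
have /choice[u uP] : forall i : nat, exists u, Cc n u /\
    bd n (fun x => f x - u x) i.+1%:R^-1.
  by move=> i; have [u ? ?] := fapp _ (iS i); exists u.
exists u; split=> [i|e e0|]; first by case: (uP i).
  have e20 : 0 < e ^+ 2 by rewrite exprn_gt0.
  pose N := Num.truncn (4 / e ^+ 2); exists N => i j Ni Nj.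
  have NE : 4 / e ^+ 2 < N.+1%:R by exact: truncnS_gt.
  have iN l : (N <= l)%N -> l.+1%:R^-1 < e ^+ 2 / 4 :> R.
    move=> Nl; rewrite -[ltRHS]invrK ltf_pV2 ?posrE ?invr_gt0 ?divr_gt0//.
    by rewrite invf_div (lt_le_trans NE)// ler_nat.
  have := bdBC (bdB (proj2 (uP i)) (proj2 (uP j))).
  have -> : (fun x => f x - u j x - (f x - u i x)) = u i - u j.
    by apply/funext => x; rewrite opprB addrC subrKA.
  move=> /inner_norm_le h; have := iN i Ni; have := iN j Nj => hj hi.
  have i0 := iS i; have j0 := iS j.
  have {h} : inner_norm n (u i - u j) ^+ 2 < e ^+ 2.
    move: (i.+1%:R^-1) (j.+1%:R^-1) hi hj i0 j0 h => a b ha hb a0 b0 h.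
    by apply: le_lt_trans (h _) _; lra.
  by rewrite ltr_sqr ?nnegrE ?sqrtr_ge0// ltW.
apply/cvgrPdist_lt => e e0; have e20 : 0 < e / 2 by rewrite divr_gt0.
pose N := Num.truncn ((e / 2) ^+ 2)^-1; exists N => // i /= Ni.
have NE : ((e / 2) ^+ 2)^-1 < N.+1%:R by exact: truncnS_gt.
rewrite sub0r normrN ger0_norm ?sup_norm_ge0//.
apply: (@le_lt_trans _ _ (e / 2)).
  apply: sup_norm_le => [|x]; first exact: ltW.
  have [cui ui] := uP i.
  rewrite normcBC normc_le_sqn ?(ltW e20)// (le_trans (fu _ _ x cui ui (ltW (iS i))))//.
  rewrite -[leRHS]invrK lef_pV2 ?posrE ?invr_gt0 ?exprn_gt0//.
  by rewrite ltW// (lt_le_trans NE)// ler_nat.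
by rewrite ltr_pdivrMr// ltr_pMr// ltr1n.
Qed.

End modules.

(** * Operations on the modules *)

Lemma small_factor (R : realType) (K e : R) : 0 <= K -> 0 < e ->
  exists2 d, 0 < d & K * d <= e.
Proof.
move=> K0 e0; have K1 : 0 < K + 1 by rewrite ltr_wpDl.
exists (e / (K + 1)); first by rewrite divr_gt0.
by rewrite mulrA ler_pdivrMr// mulrC ler_wpM2l ?lerDl// ltW.
Qed.

Section module_operations.
Context (R : realType) {k : nat} (L : topological_kgraph k).
Local Notation C := R[i].
Implicit Types (m n p : {ffun 'I_k -> nat}) (f g h u : L -> C) (v x y : L).
Implicit Types (M N e : R) (K W : set L).

Lemma X_off n f x : X n f -> ~ paths n x -> f x = 0.
Proof. by move=> /XP[+ _]; apply. Qed.

Lemma X_app n f e : X n f -> 0 < e ->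
  exists2 u, Cc n u & bd n (fun x => f x - u x) e.
Proof. by move=> /XP[_]; apply. Qed.

Lemma X_closed n f : (forall x, ~ paths n x -> f x = 0) ->
  (forall e, 0 < e -> exists2 g, X n g & bd n (fun x => f x - g x) e) -> X n f.
Proof.
move=> f0 fg; apply/XP; split => // e e0.
have e40 : 0 < e / 4 by rewrite divr_gt0.
have [g Xg ge] := fg _ e40; have [u cu ue] := X_app Xg e40.
by exists u => //; apply: bd_le (bd_tri ge ue); lra.
Qed.

Lemma X_Cc n f : Cc n f -> X n f.
Proof.
move=> cf; apply/XP; split=> [x|e e0]; first exact: Cc_off.
exists f => // v F _; rewrite big1 ?ltW// => x _.
by rewrite subrr sqn0.
Qed.

Lemma X_bd n f : X n f -> exists2 M, 0 <= M & bd n f M.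
Proof.
move=> Xf; have [u cu ue] := X_app Xf ltr01; have [M uM] := Cc_bd cu.
exists (2 * (1 + `|M|)); first by rewrite mulr_ge0// addr_ge0.
apply: (@bd_le _ _ _ _ _ (2 * (1 + M))); first by rewrite ler_pM2l// lerD2l ler_norm.
by apply: bd_eq (bdD ue uM) => x _; rewrite subrK.
Qed.

Lemma X_comb n f g (c : C) : X n f -> X n g -> X n (fun x => c * f x + g x).
Proof.
move=> Xf Xg; apply/XP; split=> [x nx|e e0].
  by rewrite (X_off Xf)// (X_off Xg)// mulr0 addr0.
have e40 : 0 < e / 4 by rewrite divr_gt0.
have [d d0 de] := small_factor (sqn_ge0 c) e40.
have [u cu ue] := X_app Xf d0; have [w cw we] := X_app Xg e40.
exists (fun x => c * u x + w x).
  exact: CcD (CcM cu (@continuous_cst R L c)) cw.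
apply: bd_le (bd_eq _ (bdD (bdZ c ue) we)); last first.
  by move=> x _; rewrite mulrBr opprD addrACA.
lra.
Qed.

Lemma X0 n : X n (fun _ : L => 0 : C).
Proof. exact/X_Cc/Cc0. Qed.

Lemma XD n f g : X n f -> X n g -> X n (fun x => f x + g x).
Proof.
move=> Xf Xg; have := X_comb 1 Xf Xg.
by rewrite (_ : (fun x => 1 * f x + g x) = (fun x => f x + g x))//;
  apply/funext => x; rewrite mul1r.
Qed.

Lemma XZ n f (c : C) : X n f -> X n (fun x => c * f x).
Proof.
move=> Xf; have := X_comb c Xf (X0 n).
by rewrite (_ : (fun x => c * f x + 0) = (fun x => c * f x))//;
  apply/funext => x; rewrite addr0.
Qed.

Lemma XB n f g : X n f -> X n g -> X n (fun x => f x - g x).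
Proof.
move=> Xf Xg; have := X_comb (- 1) Xg Xf.
by rewrite (_ : (fun x => -1 * g x + f x) = (fun x => f x - g x))//;
  apply/funext => x; rewrite mulN1r addrC.
Qed.

Lemma X_conj n f : X n f -> X n (fun x => (f x)^*).
Proof.
move=> Xf; apply/XP; split=> [x nx|e e0]; first by rewrite (X_off Xf)// rmorph0.
have [u cu ue] := X_app Xf e0; exists (fun x => (u x)^*); first exact: Cc_conj.
move=> v F /(ue v); under eq_bigr do rewrite -sqnC.
by under eq_bigr do rewrite rmorphB.
Qed.

Lemma X_ip n f g v : X n f -> X n g ->
  exists M N, l2 (fib n v) f M /\ l2 (fib n v) g N.
Proof.
by move=> /X_bd[M _ fM] /X_bd[N _ gN]; exists M, N; split; [exact: fM|exact: gN].
Qed.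

Lemma peakP n x : paths n x -> exists d : L -> C, [/\ Cc n d,
  forall y, fib n (kg_s x) y -> d y = (y == x)%:R & bd n d 1].
Proof.
move=> nx; have xs : [set` [fset x]%fset] `<=` fib n (kg_s x).
  by move=> y /=; rewrite inE => /eqP ->.
have [d [cd dx d1]] := interpolation (cst (1 : C)) xs.
exists d; split => //; last by move: d1; rewrite big_seq_fset1 /= sqn1.
by move=> y /dx ->; rewrite inE; case: eqP.
Qed.

(** On its fibre the peak at [x] is the basis vector at [x]. *)
Definition peak n x : L -> C := xget (cst 0) [set d | [/\ Cc n d,
  forall y, fib n (kg_s x) y -> d y = (y == x)%:R & bd n d 1]].

Lemma peakE n x : paths n x -> [/\ Cc n (peak n x),
  forall y, fib n (kg_s x) y -> peak n x y = (y == x)%:R & bd n (peak n x) 1].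
Proof. by move=> /peakP/(xgetPex (cst 0)). Qed.

Lemma X_peak n x : paths n x -> X n (peak n x).
Proof. by move=> /peakE[+ _ _]; exact: X_Cc. Qed.

Lemma inner_peakl n x f : paths n x -> inner n (peak n x) f (kg_s x) = f x.
Proof.
move=> nx; have [_ dx _] := peakE nx; have xx : fib n (kg_s x) x by [].
rewrite innerE (ip_single xx) ?dx// ?eqxx ?rmorph1 ?mul1r// => y vy yx.
by rewrite dx// (negPf yx) rmorph0 mul0r.
Qed.

Lemma inner_peakr n x f : paths n x -> inner n f (peak n x) (kg_s x) = (f x)^*.
Proof.
move=> nx; have [_ dx _] := peakE nx; have xx : fib n (kg_s x) x by [].
rewrite innerE (ip_single xx) ?dx// ?eqxx ?mulr1// => y vy yx.
by rewrite dx// (negPf yx) mulr0.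
Qed.

(** Where the source map is injective, the inner product is the pointwise product
pushed forward along it. *)
Lemma inner_continuous n f g : Cc n f -> Cc n g ->
  continuous (inner n f g : L -> C^o).
Proof.
move=> + cg; move: f; apply: Cc_ind => [|f f' cf cf' If If'|x nx].
- rewrite (_ : inner _ _ _ = fun=> 0); first exact: continuous_cst.
  by apply/funext => v; apply: ip_eq0 => x _; rewrite rmorph0 mul0r.
- rewrite (_ : inner _ _ _ = fun v => inner n f g v + inner n f' g v).
    exact: continuous_add.
  have [M fM] := Cc_bd cf; have [M' fM'] := Cc_bd cf'; have [N gN] := Cc_bd cg.
  by apply/funext => v; rewrite !innerE (ipDl (gN v) (fM v) (fM' v)).
have [W [oW Wx Wn Wi]] := s_inj_nbhs nx; exists W; split => // f cf fW.
have [K [cK KW fK]] := fW.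
pose q y := (f y)^* * g y.
have cq : continuous (q : L -> C^o).
  exact: (continuous_mul (continuous_conj (Cc_cont cf)) (Cc_cont cg)).
have qK y : q y != 0 -> K y.
  by move=> qy; apply: fK; apply: contraNneq qy => fy; rewrite /q fy rmorph0 mul0r.
have [G [cG Gs _ GK]] := push_forward (@kg_hausdorff _ L) oW Wi
  (fun y _ => @kg_s_continuous _ L y) (fun B _ oB => open_source oB) cK KW cq qK.
rewrite (_ : inner _ _ _ = G)//; apply/funext => v; rewrite innerE.
have [[y [Wy yv]]|h] := pselect (exists y, W y /\ kg_s y = v).
  rewrite -yv (Gs _ Wy) (@ip_single _ _ _ _ _ y) => // [|z [nz sz] zy].
    by split => //; exact: Wn.
  have [->|fz] := eqVneq (f z) 0; first by rewrite rmorph0 mul0r.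
  by case/eqP: zy; apply: (s_injE Wi) => //; exact: carriedE fW fz.
have -> : G v = 0.
  apply/eqP; apply/negPn; apply/negP => /GK[y Ky yv]; apply: h; exists y.
  by split => //; exact: KW.
apply: ip_eq0 => z [nz sz]; have [->|fz] := eqVneq (f z) 0; first by rewrite rmorph0 mul0r.
by exfalso; apply: h; exists z; split => //; exact: carriedE fW fz.
Qed.

Lemma bd_ract n f (b : L -> C) M N : bd n f M -> 0 <= N ->
  (forall v, sqn (b v) <= N) -> bd n (ract f b) (N * M).
Proof.
move=> fM N0 bN v F Fv; rewrite (eq_big_seq (fun x => sqn (b v) * sqn (f x))).
  rewrite -mulr_sumr ler_pM ?sqn_ge0//; first by apply: sumr_ge0 => x _; exact: sqn_ge0.
  exact: fM Fv.
by move=> x /Fv[_ sx]; rewrite /ract sqnM sx mulrC.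
Qed.

Lemma inner_bound n f g M N v : bd n f M -> bd n g N ->
  sqn (inner n f g v) <= M * N.
Proof. by move=> fM gN; exact: ip_bound (fM v) (gN v). Qed.

Lemma bd_rank_one n f g h Mf Mg Mh : bd n f Mf -> bd n g Mg -> bd n h Mh ->
  bd n (rank_one n f g h) (Mg * Mh * Mf).
Proof.
move=> fM gM hM v; have Mg0 := bd_ge0 v gM; have Mh0 := bd_ge0 v hM.
have N0 : 0 <= Mg * Mh by rewrite mulr_ge0.
by apply: (bd_ract fM N0) => w; exact: inner_bound.
Qed.

Lemma rank_oneBl n f f' g h :
  (fun x => rank_one n f g h x - rank_one n f' g h x) =
  rank_one n (fun x => f x - f' x) g h.
Proof. by apply/funext => x; rewrite /rank_one /ract mulrBl. Qed.

Lemma rank_oneBm n f g g' h : X n g -> X n g' -> X n h ->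
  (fun x => rank_one n f g h x - rank_one n f g' h x) =
  rank_one n f (fun x => g x - g' x) h.
Proof.
move=> /X_bd[M _ gM] /X_bd[M' _ gM'] /X_bd[N _ hN].
apply/funext => x; rewrite /rank_one /ract -mulrBr; congr (_ * _).
by rewrite !innerE (ipBl (hN _) (gM _) (gM' _)).
Qed.

Lemma rank_oneBr n f g h h' : X n g -> X n h -> X n h' ->
  (fun x => rank_one n f g h x - rank_one n f g h' x) =
  rank_one n f g (fun x => h x - h' x).
Proof.
move=> /X_bd[M _ gM] /X_bd[M' _ hM'] /X_bd[N _ hN].
apply/funext => x; rewrite /rank_one /ract -mulrBr; congr (_ * _).
by rewrite !innerE (ipBr (gM _) (hM' _) (hN _)).
Qed.

Lemma rank_one_off n f g h x : X n f -> ~ paths n x -> rank_one n f g h x = 0.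
Proof. by move=> Xf nx; rewrite /rank_one /ract (X_off Xf)// mul0r. Qed.

(** The three arguments are replaced in turn by compactly supported functions,
for which the coefficient is continuous by [inner_continuous]. *)
Lemma X_rank_one n f g h : X n f -> X n g -> X n h -> X n (rank_one n f g h).
Proof.
move=> Xf Xg Xh.
have H1 u w z : Cc n u -> Cc n w -> Cc n z -> X n (rank_one n u w z).
  move=> cu cw cz; apply: X_Cc.
  rewrite (_ : rank_one _ _ _ _ = fun x => inner n w z (kg_s x) * u x).
    apply: CcM cu _ => x; apply: (@continuous_comp _ _ _ (@kg_s k L)).
      exact: kg_s_continuous.
    exact: inner_continuous.
  by apply/funext => x; rewrite /rank_one /ract mulrC.
have H2 u w : Cc n u -> Cc n w -> X n (rank_one n u w h).
  move=> cu cw; apply: X_closed => [x nx|e e0]; first exact: rank_one_off (X_Cc cu) nx.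
  have [M M0 uM] := X_bd (X_Cc cu); have [N N0 wN] := X_bd (X_Cc cw).
  have [d d0 de] := small_factor (mulr_ge0 M0 N0) e0.
  have [z cz zd] := X_app Xh d0; exists (rank_one n u w z); first exact: H1.
  rewrite rank_oneBr//; [|exact: X_Cc|exact: X_Cc].
  by apply: bd_le (bd_rank_one uM wN zd); rewrite mulrC mulrA.
have H3 u : Cc n u -> X n (rank_one n u g h).
  move=> cu; apply: X_closed => [x nx|e e0]; first exact: rank_one_off (X_Cc cu) nx.
  have [M M0 uM] := X_bd (X_Cc cu); have [N N0 hN] := X_bd Xh.
  have [d d0 de] := small_factor (mulr_ge0 N0 M0) e0.
  have [z cz zd] := X_app Xg d0; exists (rank_one n u z h); first exact: H2.
  rewrite rank_oneBm//; last exact: X_Cc.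
  by apply: bd_le (bd_rank_one uM zd hN); rewrite -mulrA mulrC.
apply: X_closed => [x nx|e e0]; first exact: rank_one_off nx.
have [M M0 gM] := X_bd Xg; have [N N0 hN] := X_bd Xh.
have [d d0 de] := small_factor (mulr_ge0 M0 N0) e0.
have [z cz zd] := X_app Xf d0; exists (rank_one n z g h); first exact: H3.
by rewrite rank_oneBl; apply: bd_le (bd_rank_one zd gM hN).
Qed.

End module_operations.

(** * Products and tails *)

Section products.
Context (R : realType) {k : nat} (L : topological_kgraph k).
Local Notation C := R[i].
Implicit Types (m n p : {ffun 'I_k -> nat}) (f g h u : L -> C) (v x y z : L).
Implicit Types (M N e : R) (K W : set L).

Lemma mulE m n f g x : paths (m + n) x ->
  ps_mul m n f g x = f (head m x) * g (tail m n x).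
Proof. by move=> dx; rewrite /ps_mul dx eqxx. Qed.

Lemma mul_off m n f g x : ~ paths (m + n) x -> ps_mul m n f g x = 0.
Proof. by move=> dx; rewrite /ps_mul; case: eqP. Qed.

Lemma tail_partition m n (F : {fset L}) (s : L -> R) :
  \sum_(x <- F) s x = \sum_(z <- [fset tail m n x | x in F]%fset)
    \sum_(x <- [fset x in F | tail m n x == z]%fset) s x.
Proof.
rewrite (partition_big_imfset _ (tail m n)) /=; apply: eq_bigr => z _.
rewrite -big_filter; apply: perm_big; apply: uniq_perm; rewrite ?filter_uniq ?fset_uniq//.
by move=> x; rewrite mem_filter !inE andbC.
Qed.

Lemma heads_sub m n v z (F : {fset L}) : [set` F] `<=` fib (m + n) v ->
  (forall x, x \in F -> tail m n x = z) ->
  [set` [fset head m x | x in F]%fset] `<=` fib m (kg_r z).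
Proof.
move=> Fv Fz y /= /imfsetP[x /= xF ->]; have [dx _] := Fv _ xF.
by have [dh _ hz _] := factorisation dx; split=> //; rewrite hz (Fz _ xF).
Qed.

Lemma heads_sum (V : nmodType) m n v z (F : {fset L}) (s : L -> V) :
  [set` F] `<=` fib (m + n) v -> (forall x, x \in F -> tail m n x = z) ->
  \sum_(x <- F) s (head m x) = \sum_(y <- [fset head m x | x in F]%fset) s y.
Proof.
move=> Fv Fz; rewrite big_imfset//= => x y xF yF hxy.
have [dx _] := Fv _ xF; have [dy _] := Fv _ yF.
by apply: (factor_inj dx dy) => //; rewrite !Fz.
Qed.

(** Summing over the heads first costs [M] for each tail. *)
Lemma bd_mul m n f g M N : bd m f M -> bd n g N ->
  bd (m + n) (ps_mul m n f g) (M * N).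
Proof.
move=> fM gN v F Fv; have M0 := bd_ge0 v fM.
rewrite (tail_partition m n).
apply: (@le_trans _ _ (\sum_(z <- [fset tail m n x | x in F]%fset) M * sqn (g z))).
  apply: ler_sum => z _; set G := [fset x in F | _]%fset.
  have GP x : x \in G -> x \in F /\ tail m n x = z.
    by rewrite !inE => /andP[? /eqP].
  have Gv : [set` G] `<=` fib (m + n) v by move=> x /GP[/Fv].
  have Gz x : x \in G -> tail m n x = z by case/GP.
  rewrite (eq_big_seq (fun x => sqn (f (head m x)) * sqn (g z))); last first.
    by move=> x xG; have [dx _] := Gv _ xG; rewrite mulE// sqnM Gz.
  rewrite -mulr_suml (heads_sum (fun y => sqn (f y)) Gv Gz) ler_wpM2r ?sqn_ge0//.
  by apply: (fM (kg_r z)); exact: heads_sub Gv Gz.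
rewrite -mulr_sumr ler_wpM2l//; apply: (gN v) => z /= /imfsetP[x /= xF ->].
have [dx sx] := Fv _ xF; have [_ dt _ _] := factorisation dx.
by split=> //; rewrite kg_s_tail.
Qed.

Lemma mul_continuous m n f g : continuous (f : L -> C^o) ->
  continuous (g : L -> C^o) -> continuous (ps_mul m n f g : L -> C^o).
Proof.
move=> cf cg x; have [dx|dx] := pselect (paths (m + n) x).
  apply: (@continuous_at_eq _ _ (fun y => f (head m y) * g (tail m n y))).
    have : nbhs x (paths (m + n)).
      by apply: open_nbhs_nbhs; split; [exact: open_paths|].
    by apply: filterS => y dy; rewrite /= mulE.
  apply: continuous_at_mul.
    exact: cvg_comp (head_continuous dx) (cf _).
  exact: cvg_comp (tail_continuous dx) (cg _).
apply: (@continuous_at_eq _ _ (fun=> 0)); last exact: continuous_cst.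
have : nbhs x (paths (kg_d x)).
  by apply: open_nbhs_nbhs; split; [exact: open_paths|].
apply: filterS => y dy /=; rewrite mul_off// => dy'; apply: dx.
by rewrite /paths /= -dy' -dy.
Qed.

Lemma compact_path_mul K W : compact K -> compact W -> compact (path_mul K W).
Proof.
move=> cK cW.
have cs : closed [set q : L * L | kg_s q.1 = kg_r q.2].
  apply: closed_equaliser; first exact: kg_hausdorff.
    move=> q; apply: continuous_comp; first exact: cvg_fst.
    exact: kg_s_continuous.
  move=> q; apply: continuous_comp; first exact: cvg_snd.
  exact: kg_r_continuous.
have cKW := compact_closedI (compact_setX cK cW) cs.
have sub : (K `*` W) `&` [set q : L * L | kg_s q.1 = kg_r q.2] `<=`
    [set q : L * L | kg_s q.1 = kg_r q.2] by move=> q [].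
have := continuous_compact (continuous_subspaceW sub (@kg_comp_continuous _ L)) cKW.
rewrite (_ : _ @` _ = path_mul K W)//; apply/seteqP; split => z.
  by move=> [[x y] /= [[Kx Wy] xy] <-]; exists x, y.
by move=> [x [y [Kx Wy xy ->]]]; exists (x, y).
Qed.

Lemma Cc_mul m n f g : Cc m f -> Cc n g -> Cc (m + n) (ps_mul m n f g).
Proof.
move=> cf cg; have [K [cK Km fK]] := Cc_carrier cf.
have [W [cW Wn gW]] := Cc_carrier cg.
apply: (@Cc_intro _ _ _ _ _ (path_mul K W)).
- exact: (mul_continuous (Cc_cont cf) (Cc_cont cg)).
- exact: compact_path_mul.
- by move=> _ [a [b [/Km da /Wn db ab ->]]]; rewrite /paths /= kg_d_comp// da db.
move=> x; have [dx|dx] := pselect (paths (m + n) x); last first.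
  by rewrite mul_off// eqxx.
have [_ _ ht xE] := factorisation dx.
rewrite mulE// mulf_eq0 negb_or => /andP[/fK Kh /gW Wt].
by exists (head m x), (tail m n x); rewrite xE.
Qed.

Lemma mulBl m n f f' g : (fun x => ps_mul m n f g x - ps_mul m n f' g x) =
  ps_mul m n (fun x => f x - f' x) g.
Proof.
apply/funext => x; rewrite /ps_mul; case: ifP => _; last by rewrite subrr.
by rewrite mulrBl.
Qed.

Lemma mulBr m n f g g' : (fun x => ps_mul m n f g x - ps_mul m n f g' x) =
  ps_mul m n f (fun x => g x - g' x).
Proof.
apply/funext => x; rewrite /ps_mul; case: ifP => _; last by rewrite subrr.
by rewrite mulrBr.
Qed.

Lemma X_mul m n f g : X m f -> X n g -> X (m + n) (ps_mul m n f g).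
Proof.
move=> Xf Xg.
have H u : Cc m u -> X (m + n) (ps_mul m n u g).
  move=> cu; apply: X_closed => [x nx|e e0]; first exact: mul_off.
  have [M M0 uM] := X_bd (X_Cc cu).
  have [d d0 de] := small_factor M0 e0.
  have [z cz zd] := X_app Xg d0; exists (ps_mul m n u z); first exact/X_Cc/Cc_mul.
  by rewrite mulBr; apply: bd_le (bd_mul uM zd).
apply: X_closed => [x nx|e e0]; first exact: mul_off.
have [M M0 gM] := X_bd Xg.
have [d d0 de] := small_factor M0 e0.
have [z cz zd] := X_app Xf d0; exists (ps_mul m n z g); first exact: H.
by rewrite mulBl; apply: bd_le (bd_mul zd gM); rewrite mulrC.
Qed.

(** A local substitute for the constant function 1 that is also a legitimate
element of the module and meets every fibre at most once. *)
Lemma local_unit n x : paths n x -> exists (W W' : set L) (c : L -> C),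
  [/\ open W, W x & W `<=` W'] /\ [/\ open W', W' `<=` paths n & s_inj W'] /\
  [/\ Cc n c, forall y, W y -> c y = 1 & carried c W'].
Proof.
move=> nx; have [W' [oW Wx Wn Wi]] := s_inj_nbhs nx.
have [c [K [V [cc c01 [cK KW] c0 [oV Vx VK V1]]]]] :=
  @bump R L (@kg_locally_compact _ L) (@kg_hausdorff _ L) _ _ oW Wx.
exists V, W', (fun y => (c y)%:C); split; [|split]; split => //.
- exact: subset_trans VK KW.
- apply: (Cc_intro (continuous_complex cc) cK); first exact: subset_trans KW Wn.
  by move=> y cy; apply: c0; apply: contraNneq cy => ->.
- by move=> y /V1 ->.
- exists K; split => // y cy; apply: c0.
  by apply: contraNneq cy => ->.
Qed.

(** Continuous compactly supported functions are sums of products: locally a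
path is determined by its tail [z], so that a function [h] can be written
[h (a z) = 1 * h (a_z z)], where [a_z] is the only possible head and [1]
stands for a local unit. *)
Lemma Cc_mul_ind m n (P : (L -> C) -> Prop) :
  P (fun=> 0) ->
  (forall f g, Cc (m + n) f -> Cc (m + n) g -> P f -> P g ->
     P (fun x => f x + g x)) ->
  (forall f g, Cc m f -> Cc n g -> P (ps_mul m n f g)) ->
  forall h, Cc (m + n) h -> P h.
Proof.
move=> P0 PD PM; apply: Cc_ind => // x dx.
have [dh dt ht _] := factorisation dx.
have [U [U' [c [[oU Ux UU'] [[oU' U'm U'i] [cc c1 cU']]]]]] := local_unit dh.
have [W [oW Wx Wn Wi]] := s_inj_nbhs dx.
have : nbhs x (W `&` (head m @^-1` U)).
  apply: filterI; first exact: open_nbhs_nbhs.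
  by apply: (head_continuous dx); exact: open_nbhs_nbhs.
rewrite nbhsE => -[B [oB Bx] BW]; exists B; split => // h ch hB.
have Bn : B `<=` paths (m + n) by move=> y /BW[/Wn].
have Bi : s_inj B by apply: s_inj_sub Wi => y /BW[].
have [K [cK KB hK]] := hB.
have [g [cg gB ctK gK]] := push_forward (@kg_hausdorff _ L) oB (tail_inj Bn Bi)
  (fun y By => tail_continuous (Bn y By))
  (fun D DB oD => tail_open (subset_trans DB Bn) oD) cK KB (Cc_cont ch) hK.
have cg' : Cc n g.
  apply: (Cc_intro cg ctK) => [_ [y /KB/Bn dy <-]|z /gK[y Ky <-]]; last by exists y.
  by have [] := factorisation dy.
suff -> : h = ps_mul m n c g by exact: PM.
apply/funext => y; have [dy|dy] := pselect (paths (m + n) y); last first.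
  by rewrite mul_off// (Cc_off ch).
rewrite mulE//; have [By|nBy] := pselect (B y).
  by rewrite gB// c1 ?mul1r//; have [] := BW _ By.
have -> : h y = 0.
  by apply/eqP; apply/negPn; apply/negP => /(carriedE hB).
apply/esym/eqP; apply: contra_notT nBy; rewrite mulf_eq0 negb_or.
move=> /andP[/(carriedE cU') U'y /gK[y' Ky' tyy']].
have By' := KB _ Ky'; have dy' := Bn _ By'.
suff -> : y = y' by [].
have [_ _ hy _] := factorisation dy; have [_ _ hy' _] := factorisation dy'.
apply: (factor_inj dy dy') => //; apply: (s_injE U'i) => //.
  by apply: UU'; have [] := BW _ By'.
by rewrite hy hy' tyy'.
Qed.

(** Locally a path is determined by either of its tails, so that the sum over the
paths with a given tail after degree [m] has at most one term, which depends on
that tail through one function and on the tail after degree [n] through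
another. *)
Lemma two_tails m m' n n' F : m + m' = n + n' -> Cc (m + m') F ->
  exists s : seq ((L -> C) * (L -> C)),
  List.Forall (fun ab => Cc m' ab.1 /\ Cc n' ab.2) s /\
  forall (x : L) (q : L -> C) (E : {fset L}), paths m' x ->
    [set` E] `<=` fib (m + m') (kg_s x) ->
    (forall y, fib (m + m') (kg_s x) y -> F y != 0 -> y \in E) ->
    \sum_(y <- E | tail m m' y == x) F y * q (tail n n' y) =
    \sum_(ab <- s) ab.1 x * inner n' ab.2 q (kg_s x).
Proof.
move=> emn; move: F; apply: Cc_ind => [|F G cF cG [s [sC sF]] [t [tC tG]]|x dx].
- exists [::]; split => // x q E _ _ _.
  by rewrite big_nil big1// => y _; rewrite mul0r.
- exists (s ++ t); split; first by apply/List.Forall_app.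
  move=> x q E dx Ex EFG; rewrite big_cat /=.
  have [_ /(_ (kg_s x))[EF [EFx EFF]]] := Cc_fin cF.
  have [_ /(_ (kg_s x))[EG [EGx EGG]]] := Cc_fin cG.
  pose E' := (E `|` (EF `|` EG))%fset.
  have E'x : [set` E'] `<=` fib (m + m') (kg_s x) by do 2!apply: fsetU_sub => //.
  rewrite -(sF x q E') -?(tG x q E')//; [|move=> y xy Fy..].
  + rewrite -big_split /=.
    rewrite big_mkcond [RHS]big_mkcond /=.
    rewrite [RHS](@sum_incl _ _ _ E).
    * by apply: eq_bigr => y _; case: ifP => // _; rewrite mulrDl.
    * by move=> y yE; rewrite inE yE.
    * move=> y yE' yE; case: ifP => // _; rewrite -mulrDl.
      have -> : F y + G y = 0; last by rewrite mul0r.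
      apply/eqP; apply: contraNT yE; apply: EFG; exact: E'x.
  + by rewrite !inE EGG ?orbT.
  + by rewrite !inE EFF ?orbT.
have [W [W' [c [[oW Wx WW'] [[oW' W'p W'i] [cc c1 cW']]]]]] := local_unit dx.
exists W; split => // F cF FW.
have Wi := s_inj_sub WW' W'i; have Wp := subset_trans WW' W'p.
have [K [cK KW FK]] := FW.
have [a [ca aW ctK aK]] := push_forward (@kg_hausdorff _ L) oW (tail_inj Wp Wi)
  (fun y Wy => tail_continuous (Wp y Wy))
  (fun D DW oD => tail_open (subset_trans DW Wp) oD) cK KW (Cc_cont cF) FK.
have W'p' : W' `<=` paths (n + n') by rewrite -emn.
have [K' [cK' KW' cK'0]] := cW'.
have [b [cb bW ctK' bK]] := push_forward (@kg_hausdorff _ L) oW' (tail_inj W'p' W'i)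
  (fun y Wy => tail_continuous (W'p' y Wy))
  (fun D DW oD => tail_open (subset_trans DW W'p') oD) cK' KW' (Cc_cont cc) cK'0.
exists [:: (a, b)]; split.
  apply: List.Forall_cons; [split => /=|exact: List.Forall_nil].
    apply: (Cc_intro ca ctK) => [_ [y /KW/Wp dy <-]|z /aK[y Ky <-]]; last by exists y.
    by have [] := factorisation dy.
  apply: (Cc_intro cb ctK') => [_ [y /KW'/W'p' dy <-]|z /bK[y Ky <-]]; last by exists y.
  by have [] := factorisation dy.
move=> z q E dz Ez EF; rewrite big_seq1 /= big_mkcond /=.
have Fz y : y \in E -> F y != 0 -> tail m m' y = z -> W y /\ kg_s y = kg_s z.
  move=> yE Fy <-; split; first exact: carriedE FW Fy.
  by have [dy _] := Ez _ yE; rewrite kg_s_tail.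
have [[y [Wy yz]]|nW] := pselect (exists y, W y /\ tail m m' y = z).
  have dy := Wp _ Wy; have dy' := W'p' _ (WW' _ Wy).
  have sy : kg_s y = kg_s z by rewrite -yz kg_s_tail.
  rewrite (@sum_one _ _ _ _ y) => [|x' x'E x'y|yE].
  - rewrite yz eqxx -(aW _ Wy) yz; congr (_ * _).
    rewrite innerE (@ip_single _ _ _ _ _ (tail n n' y)).
    + by rewrite bW ?c1 ?rmorph1 ?mul1r//; exact: WW'.
    + have [_ dt _ _] := factorisation dy'; split => //.
      by rewrite kg_s_tail.
    move=> w [dw sw] wy; have [->|/bK[x' /KW' W'x' x'w]] := eqVneq (b w) 0.
      by rewrite rmorph0 mul0r.
    case/eqP: wy; rewrite -x'w; congr (tail _ _ _); apply: (s_injE W'i) => //.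
      exact: WW'.
    by rewrite sy -sw -x'w kg_s_tail//; exact: W'p'.
  - case: eqP => // x'z; have [->|Fx'] := eqVneq (F x') 0; first by rewrite mul0r.
    have [Wx' sx'] := Fz _ x'E Fx' x'z.
    by case/eqP: x'y; apply: (s_injE Wi) => //; rewrite sx' sy.
  - case: ifP => // _; have -> : F y = 0; last by rewrite mul0r.
    by apply/eqP; apply: contraNT yE; apply: EF.
have -> : a z = 0.
  apply/eqP; apply/negPn; apply/negP => /aK[y Ky yz]; apply: nW; exists y.
  by split => //; exact: KW.
rewrite mul0r big1_seq// => y /andP[_ yE]; case: eqP => // yz.
have [->|Fy] := eqVneq (F y) 0; first by rewrite mul0r.
by exfalso; apply: nW; exists y; have [] := Fz _ yE Fy yz.
Qed.

End products.

(** * Adjointable operators *)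

Section operators.
Context (R : realType) {k : nat} (L : topological_kgraph k).
Local Notation C := R[i].
Implicit Types (m n p : {ffun 'I_k -> nat}) (f g h u : L -> C) (v x y z : L).
Implicit Types (M N e : R) (S T : (L -> C) -> L -> C).

Definition adjoint n T T' := [/\ forall f, X n f -> X n (T f),
  forall f, X n f -> X n (T' f)
  & forall f g, X n f -> X n g -> inner n (T f) g = inner n f (T' g)].

Lemma adjointableP n T : adjointable n T <-> exists T', adjoint n T T'.
Proof.
split=> [[XT [T' XT' TT']]|[T' [XT XT' TT']]]; first by exists T'.
by split => //; exists T'.
Qed.

Lemma inner_conj n f g v : X n f -> X n g -> inner n g f v = (inner n f g v)^*.
Proof.
move=> Xf Xg; have [M [N [fM gN]]] := X_ip v Xf Xg.
by rewrite !innerE; exact: (ipC fM gN).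
Qed.

Lemma adjoint_sym n T T' : adjoint n T T' -> adjoint n T' T.
Proof.
move=> [XT XT' TT']; split => // f g Xf Xg; apply/funext => v.
rewrite (@inner_conj n g (T' f) v)//; last exact: XT'.
by rewrite -TT'// -inner_conj//; exact: XT.
Qed.

(** An adjointable operator is an integral operator along the fibres. *)
Lemma adjoint_peak n T T' f x : adjoint n T T' -> X n f -> paths n x ->
  T f x = inner n (T' (peak R n x)) f (kg_s x).
Proof.
move=> TT' Xf nx; have [_ XT sym] := adjoint_sym TT'.
by rewrite sym ?inner_peakl//; exact: X_peak.
Qed.

Lemma adjoint_local n T T' f g v x : adjoint n T T' -> X n f -> X n g ->
  (forall y, fib n v y -> f y = g y) -> fib n v x -> T f x = T g x.
Proof.
move=> TT' Xf Xg fg [nx sx]; rewrite !(adjoint_peak TT')// sx.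
exact: ip_eq.
Qed.

Lemma inner_combr n f g h (c : C) v : X n f -> X n g -> X n h ->
  inner n f (fun x => c * g x + h x) v = c * inner n f g v + inner n f h v.
Proof.
move=> /X_bd[M _ fM] /X_bd[N _ gN] /X_bd[M' _ hM].
by rewrite !innerE (ipDr (fM v) (l2Z c (gN v)) (hM v)) (ipZr c (fM v) (gN v)).
Qed.

Lemma inner_combl n f g h (c : C) v : X n f -> X n g -> X n h ->
  inner n (fun x => c * g x + h x) f v = c^* * inner n g f v + inner n h f v.
Proof.
move=> Xf Xg Xh; rewrite (inner_conj v Xf); last exact: X_comb.
by rewrite inner_combr// rmorphD rmorphM /= -!inner_conj.
Qed.

Lemma innerBr n f g h v : X n f -> X n g -> X n h ->
  inner n f (fun x => g x - h x) v = inner n f g v - inner n f h v.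
Proof.
move=> /X_bd[M _ fM] /X_bd[N _ gN] /X_bd[M' _ hM].
by rewrite !innerE (ipBr (fM v) (gN v) (hM v)).
Qed.

Lemma innerBl n f g h v : X n f -> X n g -> X n h ->
  inner n (fun x => g x - h x) f v = inner n g f v - inner n h f v.
Proof.
move=> /X_bd[M _ fM] /X_bd[N _ gN] /X_bd[M' _ hM].
by rewrite !innerE (ipBl (fM v) (gN v) (hM v)).
Qed.

Lemma adjoint_comb n S S' T T' (c : C) : adjoint n S S' -> adjoint n T T' ->
  adjoint n (fun f x => c * S f x + T f x) (fun f x => c^* * S' f x + T' f x).
Proof.
move=> [XS XS' SS'] [XT XT' TT']; split=> [f Xf|f Xf|f g Xf Xg].
- by apply: X_comb; [exact: XS|exact: XT].
- by apply: X_comb; [exact: XS'|exact: XT'].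
apply/funext => v; rewrite inner_combl//; [|exact: XS|exact: XT].
by rewrite inner_combr ?SS' ?TT'//; [exact: XS'|exact: XT'].
Qed.

Lemma adjoint_sub n S S' T T' : adjoint n S S' -> adjoint n T T' ->
  adjoint n (fun f x => S f x - T f x) (fun f x => S' f x - T' f x).
Proof.
move=> SS' TT'; have := adjoint_comb (- 1) TT' SS'.
rewrite rmorphN rmorph1.
by congr adjoint; apply/funext => f; apply/funext => x; rewrite mulN1r addrC.
Qed.

Lemma adjoint_comp n S S' T T' : adjoint n S S' -> adjoint n T T' ->
  adjoint n (S \o T) (T' \o S').
Proof.
move=> [XS XS' SS'] [XT XT' TT']; split=> [f Xf|f Xf|f g Xf Xg].
- exact/XS/XT.
- exact/XT'/XS'.
by rewrite /= SS' ?TT'//; [exact: XS'|exact: XT].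
Qed.

Lemma adjoint0 n : adjoint n (fun _ _ => 0) (fun _ _ => 0).
Proof.
split=> [f _|f _|f g Xf Xg]; [exact: X0|exact: X0|].
apply/funext => v; rewrite !innerE !ip_eq0// => x _; first by rewrite mulr0.
by rewrite rmorph0 mul0r.
Qed.

Lemma adjoint_rank_one n f g : X n f -> X n g ->
  adjoint n (rank_one n f g) (rank_one n g f).
Proof.
move=> Xf Xg; split=> [h Xh|h Xh|h u Xh Xu]; [exact: X_rank_one..|].
apply/funext => v.
have [M _ fM] := X_bd Xf; have [M' _ gM] := X_bd Xg.
have [N _ hN] := X_bd Xh; have [N' _ uN] := X_bd Xu.
rewrite (_ : inner n (rank_one _ _ _ _) _ _ =
    ip (fib n v) (fun x => inner n g h v * f x) u).
  rewrite (_ : inner n _ (rank_one _ _ _ _) _ =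
      ip (fib n v) h (fun x => inner n f u v * g x)).
    rewrite (ipZl _ (fM v) (uN v)) (ipZr _ (hN v) (gM v)) -!innerE.
    by rewrite -inner_conj// mulrC.
  by apply: ip_eq => // x [_ sx]; rewrite /rank_one /ract sx mulrC.
by apply: ip_eq => // x [_ sx]; rewrite /rank_one /ract sx mulrC.
Qed.

(** [e] bounds the square of the operator norm. *)
Definition opbd n T e := forall h M, X n h -> bd n h M -> bd n (T h) (e * M).

Lemma opbd_le n T e e' : e <= e' -> opbd n T e -> opbd n T e'.
Proof.
move=> ee' Te h M Xh hM v; have M0 := bd_ge0 v hM.
by apply: l2_le (Te h M Xh hM v); rewrite ler_wpM2r.
Qed.

Lemma opbd_eq n S T e : (forall f, X n f -> S f = T f) -> opbd n S e -> opbd n T e.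
Proof. by move=> ST Se h M Xh hM; rewrite -ST//; exact: Se. Qed.

Lemma opbdD n S T e e' : opbd n S e -> opbd n T e' ->
  opbd n (fun f x => S f x + T f x) (2 * (e + e')).
Proof.
move=> Se Te h M Xh hM; rewrite -mulrA (mulrDl e e').
exact: bdD (Se h M Xh hM) (Te h M Xh hM).
Qed.

Lemma opbd_comp n S T e e' : (forall f, X n f -> X n (T f)) ->
  opbd n S e -> opbd n T e' -> opbd n (S \o T) (e * e').
Proof.
move=> XT Se Te h M Xh hM; rewrite -mulrA.
by apply: Se; [exact: XT|exact: Te].
Qed.

(** Only the values of [f] on a fibre matter to the values of [T f] on that
fibre, and they extend to an element of norm no larger. *)
Lemma opbd_fibre n T T' e f v M : adjoint n T T' -> opbd n T e -> 0 <= e ->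
  Cc n f -> l2 (fib n v) f M -> l2 (fib n v) (T f) (e * M).
Proof.
move=> TT' Te e0 cf fM; have [_ /(_ v)[E [Ev EE]]] := Cc_fin cf.
have [g [cg gf gM]] := interpolation f Ev.
have fg y : fib n v y -> g y = f y.
  move=> vy; rewrite gf//; case: ifPn => // yE; apply/esym/eqP.
  by apply: contraNT yE; exact: EE.
apply: l2_le (l2_eq _ (Te g _ (X_Cc cg) gM v)) => [|x vx].
  by rewrite ler_wpM2l//; exact: fM.
exact: (adjoint_local TT' (X_Cc cg) (X_Cc cf) fg vx).
Qed.

(** From [|T'h|^2 = <T T'h, h>], bounded by Cauchy-Schwarz. *)
Lemma opbd_adjoint n T T' e : adjoint n T T' -> 0 <= e -> opbd n T e -> opbd n T' e.
Proof.
move=> TT' e0 Te h M Xh hM v; have [XT XT' tt] := TT'.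
have M0 := bd_ge0 v hM; have [N0 _ hN0] := X_bd (XT' _ Xh).
pose N := inner_norm n (T' h) ^+ 2; have hN : bd n (T' h) N by exact: bd_inner_norm hN0.
have NN : 0 <= N by exact: sqr_ge0.
have P : 0 <= e * N * M by apply: mulr_ge0 => //; exact: mulr_ge0 e0 NN.
have Ne : N <= Num.sqrt (e * N * M).
  apply: inner_norm_le; first exact: sqrtr_ge0.
  move=> w; have [s [sE s0 _ hs]] := ip_self (hN w); apply: l2_le hs.
  rewrite -(ger0_norm s0) -normc_real normc_le_sqn ?sqrtr_ge0//.
  rewrite sqr_sqrtr// -sE -innerE -tt//; last exact: XT'.
  by apply: inner_bound; [apply: Te => //; exact: XT'|].
have : N ^+ 2 <= e * N * M.
  by rewrite -[leRHS]sqr_sqrtr// ler_sqr// nnegrE// sqrtr_ge0.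
have [N0'|N0'] := eqVneq N 0.
  by move=> _; apply: l2_le (hN v); rewrite N0' mulr_ge0.
rewrite mulrAC expr2 ler_pM2r; last by rewrite lt_neqAle eq_sym N0'.
by move=> NeM; exact: l2_le NeM (hN v).
Qed.

Definition frank n (s : seq ((L -> C) * (L -> C))) h : L -> C :=
  fun x => \sum_(fg <- s) rank_one n fg.1 fg.2 h x.

Definition pairs (P : (L -> C) -> Prop) (s : seq ((L -> C) * (L -> C))) :=
  List.Forall (fun fg => P fg.1 /\ P fg.2) s.

Lemma pairs_X n s : pairs (Cc n) s -> pairs (X n) s.
Proof. by apply: List.Forall_impl => fg [cf cg]; split; exact: X_Cc. Qed.

Lemma frank_cons n fg s h : frank n (fg :: s) h =
  fun x => 1 * rank_one n fg.1 fg.2 h x + frank n s h x.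
Proof. by apply/funext => x; rewrite /frank big_cons mul1r. Qed.

Lemma frank_nil n : frank n [::] = fun _ _ => 0.
Proof. by apply/funext => f; apply/funext => x; rewrite /frank big_nil. Qed.

Lemma adjoint_frank n s : pairs (X n) s ->
  adjoint n (frank n s) (frank n [seq (fg.2, fg.1) | fg <- s]).
Proof.
elim=> [|[f g] s' [/= Xf Xg] _ IH] /=; first by rewrite frank_nil; exact: adjoint0.
have := adjoint_comb 1 (adjoint_rank_one Xf Xg) IH; rewrite rmorph1.
by congr adjoint; apply/funext => h; rewrite frank_cons.
Qed.

Lemma opbd_rank_one n f g M N : 0 <= N -> bd n f M -> bd n g N ->
  opbd n (rank_one n f g) (N * M).
Proof.
by move=> N0 fM gN h M' Xh hM; rewrite mulrAC; exact: bd_rank_one.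
Qed.

Lemma opbd_frank n s : pairs (X n) s -> exists2 e, 0 <= e & opbd n (frank n s) e.
Proof.
elim=> [|[f g] s' [/= Xf Xg] _ [e e0 se]].
  exists 0 => // h M _ _ v F _; rewrite big1 ?mul0r// => x _.
  by rewrite frank_nil sqn0.
have [M M0 fM] := X_bd Xf; have [N N0 gN] := X_bd Xg.
exists (2 * (N * M + e)); first by rewrite mulr_ge0 ?addr_ge0 ?mulr_ge0.
apply: opbd_eq (opbdD (opbd_rank_one N0 fM gN) se) => h _.
by rewrite frank_cons; apply/funext => x; rewrite mul1r.
Qed.

End operators.

(** * Amplification of operators *)

Section amplification.
Context (R : realType) {k : nat} (L : topological_kgraph k).
Local Notation C := R[i].
Implicit Types (m n p : {ffun 'I_k -> nat}) (f g h u : L -> C) (v x y z : L).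
Implicit Types (M N e : R) (S T : (L -> C) -> L -> C).

Lemma mul_peak m n f x y : paths (m + n) x -> fib (m + n) (kg_s x) y ->
  ps_mul m n f (peak R n (tail m n x)) y =
  if tail m n y == tail m n x then f (head m y) else 0.
Proof.
move=> dx [dy sy]; rewrite mulE//.
have [_ dt _ _] := factorisation dx; have [_ dt' _ _] := factorisation dy.
have [_ pk _] := peakE R dt.
rewrite pk; last by split; [exact: dt'|rewrite !kg_s_tail].
by case: eqVneq => _; rewrite ?mulr1 ?mulr0.
Qed.

Lemma prod_peak m n x y : paths (m + n) x -> fib (m + n) (kg_s x) y ->
  ps_mul m n (peak R m (head m x)) (peak R n (tail m n x)) y = (y == x)%:R.
Proof.
move=> dx vy; rewrite (mul_peak _ dx vy); have [dy sy] := vy.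
have [dh _ ht _] := factorisation dx; have [dh' _ ht' _] := factorisation dy.
case: (eqVneq (tail m n y) (tail m n x)) => [txy|]; last first.
  by case: (eqVneq y x) => [->|//]; rewrite eqxx.
have [_ pk _] := peakE R dh.
rewrite pk; last by split; [exact: dh'|rewrite ht ht' txy].
congr (_%:R); congr nat_of_bool; apply/eqP/eqP => [hxy|->//].
exact: factor_inj dy dx hxy txy.
Qed.

Definition kernel m n S' x : L -> C :=
  ps_mul m n (S' (peak R m (head m x))) (peak R n (tail m n x)).

(** The operator [S (x) 1] on the module of degree [m + n]. Its adjoint maps the
peak at a path [x = a z] to the product of the image of the peak at [a] with
the peak at [z], and this determines it. *)
Definition ampl m n S' h : L -> C := fun x =>
  if kg_d x == m + n then inner (m + n) (kernel m n S' x) h (kg_s x) else 0.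

Lemma amplE m n S' h x : paths (m + n) x ->
  ampl m n S' h x = inner (m + n) (kernel m n S' x) h (kg_s x).
Proof. by move=> dx; rewrite /ampl dx eqxx. Qed.

Lemma ampl_off m n S' h x : ~ paths (m + n) x -> ampl m n S' h x = 0.
Proof. by rewrite /ampl; case: eqP. Qed.

Section adjoint_pair.
Context (m n : {ffun 'I_k -> nat}) (S S' : (L -> C) -> L -> C).
Context (SS' : adjoint m S S').

Lemma X_kernel x : paths (m + n) x -> X (m + n) (kernel m n S' x).
Proof.
move=> dx; have [dh dt _ _] := factorisation dx.
have [_ XS' _] := SS'; apply: X_mul; last exact: X_peak.
exact/XS'/X_peak.
Qed.

(** An adjointable operator is determined by its values at peaks, which can be
taken to be products of peaks; there the product rule prescribes them. *)
Lemma ampl_unique T T' : adjoint (m + n) T T' ->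
  (forall f g, X m f -> X n g -> T (ps_mul m n f g) = ps_mul m n (S f) g) ->
  forall h, X (m + n) h -> T h = ampl m n S' h.
Proof.
move=> TT' Tmul h Xh; have [XT XT' tt] := TT'; apply/funext => x.
have [dx|dx] := pselect (paths (m + n) x); last first.
  by rewrite ampl_off// (X_off _ dx)//; exact: XT.
rewrite amplE// (adjoint_peak TT' Xh dx) !innerE; apply: ip_eq => // y vy.
have [dy sy] := vy; have vx : fib (m + n) (kg_s y) x by rewrite sy.
have [dh dt ht _] := factorisation dx; have [dh' dt' ht' _] := factorisation dy.
pose d := ps_mul m n (peak R m (head m y)) (peak R n (tail m n y)).
have Xd : X (m + n) d by apply: X_mul; exact: X_peak.
have -> : T' (peak R (m + n) x) y = inner (m + n) d (T' (peak R (m + n) x)) (kg_s y).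
  rewrite innerE (@ip_single _ _ _ _ _ y)//.
    by rewrite /d prod_peak// eqxx rmorph1 mul1r.
  by move=> z vz zy; rewrite /d prod_peak// (negPf zy) rmorph0 mul0r.
rewrite -tt//; last exact: X_peak.
rewrite sy inner_peakr// Tmul//; [|exact: X_peak|exact: X_peak].
rewrite /kernel (mul_peak _ dy vx) (mul_peak _ dx vy) eq_sym.
case: eqP => [txy|_]; last by rewrite rmorph0.
have hxy : kg_s (head m x) = kg_s (head m y) by rewrite ht ht' txy.
have [_ _ ss'] := adjoint_sym SS'.
rewrite -(inner_peakl _ dh) -ss'; [|exact: X_peak..].
by rewrite hxy inner_peakr// conjCK.
Qed.

(** The kernel at [x] only sees the paths with the same tail as [x], which
reduces the sum over a fibre of degree [m + n] to the sum over the heads that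
gives [S f]. *)
Lemma ampl_mul f g : X m f -> X n g ->
  ampl m n S' (ps_mul m n f g) = ps_mul m n (S f) g.
Proof.
move=> Xf Xg; apply/funext => x.
have [dx|dx] := pselect (paths (m + n) x); last first.
  by rewrite ampl_off// mul_off.
have [dh dt ht xE] := factorisation dx; have [XS XS' _] := SS'.
have Xk := XS' _ (X_peak R dh).
rewrite amplE// mulE// (adjoint_peak SS' Xf dh).
have [M [N [kM fN]]] := X_ip (kg_s (head m x)) Xk Xf.
have hs := has_sumZ (g (tail m n x)) (has_sum_ip kM fN).
rewrite mulrC innerE; apply: has_sum_sum.
apply: (@has_sum_reindex _ _ _ (fib m (kg_s (head m x))) _
  (fun a => kg_comp a (tail m n x)) (head m)).
- move=> a [da sa]; have at' : kg_s a = kg_r (tail m n x) by rewrite sa.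
  split; last exact: (head_comp da dt at').
  split; first by rewrite /paths /= kg_d_comp// da dt.
  by rewrite kg_s_comp// kg_s_tail.
- move=> y vy; rewrite /kernel (mul_peak _ dx vy).
  case: (eqVneq (tail m n y) (tail m n x)) => [tyx _|_]; last first.
    by rewrite rmorph0 mul0r eqxx.
  have [dy sy] := vy; have [dh' dt' ht' yE] := factorisation dy.
  by split; [split => //; rewrite ht ht' tyx|rewrite -tyx].
apply: has_sum_eq hs => a [da sa] /=.
have at' : kg_s a = kg_r (tail m n x) by rewrite sa.
have vax : fib (m + n) (kg_s x) (kg_comp a (tail m n x)).
  split; first by rewrite /paths /= kg_d_comp// da dt.
  by rewrite kg_s_comp// kg_s_tail.
rewrite /kernel (mul_peak _ dx vax) (tail_comp da dt at') eqxx (head_comp da dt at').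
rewrite mulE; last by case: vax.
by rewrite (tail_comp da dt at') (head_comp da dt at') mulrC -mulrA.
Qed.

Lemma amplB f g : X (m + n) f -> X (m + n) g ->
  ampl m n S' (fun x => f x - g x) = fun x => ampl m n S' f x - ampl m n S' g x.
Proof.
move=> Xf Xg; apply/funext => x.
have [dx|dx] := pselect (paths (m + n) x); last by rewrite !ampl_off// subrr.
by rewrite !amplE// innerBr//; exact: X_kernel.
Qed.

Lemma amplD f g : X (m + n) f -> X (m + n) g ->
  ampl m n S' (fun x => f x + g x) = fun x => ampl m n S' f x + ampl m n S' g x.
Proof.
move=> Xf Xg; apply/funext => x.
have [dx|dx] := pselect (paths (m + n) x); last by rewrite !ampl_off// addr0.
rewrite !amplE// -[inner _ _ f _]mul1r -inner_combr//; last exact: X_kernel.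
by rewrite (_ : (fun x => 1 * f x + g x) = (fun x => f x + g x))//;
  apply/funext => y; rewrite mul1r.
Qed.

Context (e : R) (e0 : 0 <= e) (Se : opbd m S e).

(** Over a fibre the module of degree [m + n] splits according to the tails, and
the amplification acts on each summand like [S]. *)
Lemma ampl_bd_Cc h v M : Cc (m + n) h -> l2 (fib (m + n) v) h M ->
  l2 (fib (m + n) v) (ampl m n S' h) (e * M).
Proof.
move=> ch hM F Fv; have [_ /(_ v)[E [Ev EE]]] := Cc_fin ch.
pose s z := \sum_(y <- [fset y in E | tail m n y == z]%fset) sqn (h y).
have s0 z : 0 <= s z by apply: sumr_ge0 => y _; exact: sqn_ge0.
rewrite (tail_partition m n).
apply: (@le_trans _ _ (\sum_(z <- [fset tail m n x | x in F]%fset) e * s z)); last first.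
  rewrite -mulr_sumr ler_wpM2l//.
  apply: le_trans (hM E Ev); rewrite [leRHS](tail_partition m n).
  apply: sum_le_sub => // z _; apply: contraNT => zE.
  rewrite /s big1_seq// => y /=; rewrite !inE => /andP[yE /eqP yz].
  by case/negP: zE; apply/imfsetP; exists y.
rewrite big_seq [leRHS]big_seq; apply: ler_sum => z /imfsetP[w /= wF zE].
set G := [fset x in F | _]%fset; set D := [fset y in E | tail m n y == z]%fset.
have GP x : x \in G -> x \in F /\ tail m n x = z.
  by rewrite !inE => /andP[? /eqP].
have DP y : y \in D -> y \in E /\ tail m n y = z.
  by rewrite !inE => /andP[? /eqP].
have DI y : y \in E -> tail m n y = z -> y \in D.
  by rewrite !inE => -> ->; rewrite eqxx.
have Gv : [set` G] `<=` fib (m + n) v by move=> x /GP[/Fv].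
have Gz x : x \in G -> tail m n x = z by case/GP.
have Dv : [set` D] `<=` fib (m + n) v by move=> x /DP[/Ev].
have Dz x : x \in D -> tail m n x = z by case/DP.
have [dw sw] := Fv _ wF; have dz : paths n z.
  by rewrite zE; have [] := factorisation dw.
pose a b := h (kg_comp b z).
(* an element of the module with the same values as [h] over the tail [z] *)
have [f [cf fD fM]] := interpolation a (heads_sub Dv Dz).
have aD : \sum_(b <- [fset head m y | y in D]%fset) sqn (a b) = s z.
  rewrite -(heads_sum (fun b => sqn (a b)) Dv Dz); apply: eq_big_seq => y yD.
  have [dy _] := Dv _ yD; have [_ _ _ yE] := factorisation dy.
  by rewrite /a -(Dz _ yD) yE.
have Th x : x \in G -> ampl m n S' h x = S f (head m x).
  move=> xG; have [dx sx] := Gv _ xG; have [dh dt ht xE] := factorisation dx.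
  have xx : fib (m + n) (kg_s x) x by [].
  have := congr1 (@^~ x) (ampl_mul (X_Cc cf) (X_peak R dt)).
  rewrite /= (mul_peak _ dx xx) eqxx => <-; rewrite !amplE// !innerE.
  apply: ip_eqM => y vy; rewrite /kernel !(mul_peak _ dx vy) (Gz _ xG).
  case: eqP => [yz|_]; last by rewrite rmorph0 !mul0r.
  congr (_ * _); have [dy sy] := vy; have [dh' _ ht' yE] := factorisation dy.
  rewrite fD; last by split => //; rewrite ht' yz.
  case: ifPn => [_|nD]; first by rewrite /a -yz yE.
  apply/eqP; apply: contraNT nD => hy; apply/imfsetP; exists y => //=.
  by apply: DI => //; apply: EE => //; rewrite -sx.
rewrite (eq_big_seq (fun x => sqn (S f (head m x)))) => [|x xG]; last by rewrite Th.
rewrite (heads_sum (fun b => sqn (S f b)) Gv Gz) -aD.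
have fb := opbd_fibre SS' Se e0 cf (fM (kg_r z)).
by apply: fb; exact: heads_sub Gv Gz.
Qed.

(** The constant 4 pays for the passage from compactly supported functions to
their limits with the inequality [sqnD]. *)
Lemma ampl_bd : opbd (m + n) (ampl m n S') (4 * e).
Proof.
move=> h M Xh hM v F Fv; have M0 := bd_ge0 v hM.
have /choice[B BP] : forall x, exists B, 0 <= B /\
    (paths (m + n) x -> bd (m + n) (kernel m n S' x) B).
  move=> x; have [dx|dx] := pselect (paths (m + n) x); last by exists 0.
  by have [B B0 hB] := X_bd (X_kernel dx); exists B.
have B0 : 0 <= 2 * \sum_(x <- F) B x + 4 * e.
  rewrite addr_ge0 ?mulr_ge0//; apply: sumr_ge0 => x _; by case: (BP x).
apply/ler_addgt0Pr => t t0; have [d d0 dt] := small_factor B0 t0.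
have [u cu ud] := X_app Xh d0.
have uM : bd (m + n) u (2 * (M + d)).
  by apply: bd_eq (bdB hM ud) => // x _; rewrite opprB addrC subrK.
have uT := ampl_bd_Cc cu (uM v) Fv.
have hT : \sum_(x <- F) sqn (ampl m n S' h x - ampl m n S' u x) <=
    (\sum_(x <- F) B x) * d.
  rewrite mulr_suml big_seq [leRHS]big_seq; apply: ler_sum => x xF.
  have [dx _] := Fv _ xF; rewrite !amplE// -innerBr//; [|exact: X_kernel|exact: X_Cc].
  by apply: inner_bound ud; have [_ hB] := BP x; exact: hB.
apply: (@le_trans _ _ (\sum_(x <- F) (2 * (sqn (ampl m n S' h x - ampl m n S' u x) +
    sqn (ampl m n S' u x))))).
  apply: ler_sum => x _; rewrite -{1}[ampl m n S' h x](subrK (ampl m n S' u x)).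
  exact: sqnD.
rewrite -mulr_sumr big_split /=.
apply: (@le_trans _ _ (2 * ((\sum_(x <- F) B x) * d + e * (2 * (M + d))))).
  by rewrite ler_pM2l// lerD.
move: (\sum_(x <- F) B x) dt => b dt.
have -> : 2 * (b * d + e * (2 * (M + d))) = (2 * b + 4 * e) * d + 4 * e * M by ring.
by rewrite addrC lerD2l.
Qed.

(** On products [ampl] takes values in the module by [ampl_mul]; sums of products
are dense, and [ampl] is bounded. *)
Lemma X_ampl h : X (m + n) h -> X (m + n) (ampl m n S' h).
Proof.
move=> Xh; have [XS _ _] := SS'.
have H u : Cc (m + n) u -> X (m + n) (ampl m n S' u).
  move: u; apply: Cc_mul_ind => [|f g cf cg Xf Xg|f g cf cg].
  - rewrite (_ : ampl _ _ _ _ = fun=> 0); first exact: X0.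
    apply/funext => x; rewrite /ampl; case: eqP => // dx.
    by rewrite innerE ip_eq0// => y _; rewrite mulr0.
  - by rewrite amplD; [exact: XD|exact: X_Cc|exact: X_Cc].
  - by rewrite ampl_mul; [apply: X_mul; [exact/XS/X_Cc|exact: X_Cc]|
      exact: X_Cc|exact: X_Cc].
apply: X_closed => [x dx|t t0]; first exact: ampl_off.
have [d d0 dt] := small_factor (mulr_ge0 (ler0n R 4) e0) t0.
have [u cu ud] := X_app Xh d0; exists (ampl m n S' u); first exact: H.
rewrite -amplB//; last exact: X_Cc.
by apply: bd_le (ampl_bd _ ud) => //; apply: XB => //; exact: X_Cc.
Qed.

End adjoint_pair.

Lemma kernel_sym m n S S' x y : adjoint m S S' -> paths (m + n) x ->
  fib (m + n) (kg_s x) y -> kernel m n S' x y = (kernel m n S y x)^*.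
Proof.
move=> SS' dx vy; have [dy sy] := vy.
have vx : fib (m + n) (kg_s y) x by rewrite sy.
have [dh dt ht _] := factorisation dx; have [dh' dt' ht' _] := factorisation dy.
rewrite /kernel (mul_peak _ dx vy) (mul_peak _ dy vx) eq_sym.
case: eqP => [txy|_]; last by rewrite rmorph0.
have hxy : kg_s (head m x) = kg_s (head m y) by rewrite ht ht' txy.
have [XS XS' ss] := SS'.
rewrite -(inner_peakr _ dh) hxy ss; [|exact: X_peak..].
by rewrite inner_peakl.
Qed.

(** For compactly supported functions all the sums are finite, and the adjoint
relation is the symmetry of the kernels; the general case follows by density,
the defect [D] being a bounded sesquilinear form. *)
Lemma ampl_adjoint m n S S' e : adjoint m S S' -> 0 <= e -> opbd m S e ->
  adjoint (m + n) (ampl m n S') (ampl m n S).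
Proof.
move=> SS' e0 Se; have S'S := adjoint_sym SS'; have S'e := opbd_adjoint SS' e0 Se.
have XA h : X (m + n) h -> X (m + n) (ampl m n S' h) by exact: (X_ampl SS' e0 Se).
have XA' h : X (m + n) h -> X (m + n) (ampl m n S h) by exact: (X_ampl S'S e0 S'e).
have Ab := ampl_bd (n := n) SS' e0 Se; have A'b := ampl_bd (n := n) S'S e0 S'e.
split; [exact: XA|exact: XA'|move=> h u Xh Xu; apply/funext => v].
have e40 : 0 <= 4 * e by rewrite mulr_ge0.
have H1 f g : Cc (m + n) f -> Cc (m + n) g ->
    inner (m + n) (ampl m n S' f) g v = inner (m + n) f (ampl m n S g) v.
  move=> cf cg; have [_ /(_ v)[E [Ev EE]]] := Cc_fin cf.
  have [_ /(_ v)[G [Gv GG]]] := Cc_fin cg.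
  have f0 y : fib (m + n) v y -> y \notin E -> f y = 0.
    by move=> vy; apply: contraNeq; exact: EE.
  have g0 y : fib (m + n) v y -> y \notin G -> g y = 0.
    by move=> vy; apply: contraNeq; exact: GG.
  rewrite !innerE (ip_fin Gv) => [|x vx xG]; last by rewrite g0// mulr0.
  rewrite (ip_fin Ev) => [|y vy yE]; last by rewrite f0// rmorph0 mul0r.
  rewrite (eq_big_seq (fun x => \sum_(y <- E) kernel m n S' x y * (f y)^* * g x)).
    rewrite exchange_big /=; apply: eq_big_seq => y yE; have [dy sy] := Ev _ yE.
    rewrite amplE// sy innerE (ip_fin Gv) => [|x vx xG]; last by rewrite g0// mulr0.
    rewrite mulr_sumr; apply: eq_big_seq => x xG; have [dx sx] := Gv _ xG.
    rewrite (kernel_sym SS' dx); last by rewrite sx; exact: Ev.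
    by rewrite mulrA [(f y)^* * _]mulrC.
  move=> x xG; have [dx sx] := Gv _ xG.
  rewrite amplE// sx innerE (ip_fin Ev) => [|y vy yE]; last by rewrite f0// mulr0.
  rewrite rmorph_sum mulr_suml; apply: eq_bigr => y _.
  by rewrite rmorphM /= conjCK.
pose D f g := inner (m + n) (ampl m n S' f) g v - inner (m + n) f (ampl m n S g) v.
have Db f g M N : X (m + n) f -> X (m + n) g -> bd (m + n) f M -> bd (m + n) g N ->
    sqn (D f g) <= 16 * e * M * N.
  move=> Xf Xg fM gN; apply: le_trans (sqnD _ _) _; rewrite sqnN.
  have := inner_bound v (Ab _ _ Xf fM) gN; have := inner_bound v fM (A'b _ _ Xg gN).
  by lra.
have Dr f g w : X (m + n) f -> X (m + n) g -> X (m + n) w ->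
    D f (fun x => g x - w x) = D f g - D f w.
  move=> Xf Xg Xw; rewrite /D (amplB S'S)// !innerBr//; first ring.
  - exact: XA'.
  - exact: XA'.
  - exact: XA.
have Dl f g w : X (m + n) f -> X (m + n) g -> X (m + n) w ->
    D (fun x => g x - w x) f = D g f - D w f.
  move=> Xf Xg Xw; rewrite /D (amplB SS')// !innerBl//; first ring.
  - exact: XA'.
  - exact: XA.
  - exact: XA.
have H2 f : Cc (m + n) f -> D f u = 0.
  move=> cf; have Xf := X_Cc cf; apply: eq0_sqn_small => t t0.
  have [M M0 fM] := X_bd Xf.
  have c0 : 0 <= 16 * e * M by apply: mulr_ge0 => //; rewrite mulr_ge0.
  have [d d0 dt] := small_factor c0 t0; have [w cw wd] := X_app Xu d0.
  have Xw := X_Cc cw; rewrite -[D f u]subr0 -(_ : D f w = 0); last first.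
    by rewrite /D H1// subrr.
  by rewrite -Dr//; apply: le_trans (Db _ _ _ _ Xf (XB Xu Xw) fM wd) dt.
apply/eqP; rewrite -subr_eq0 -/(D h u); apply/eqP; apply: eq0_sqn_small => t t0.
have [M M0 uM] := X_bd Xu.
have c0 : 0 <= 16 * e * M by apply: mulr_ge0 => //; rewrite mulr_ge0.
have [d d0 dt] := small_factor c0 t0; have [w cw wd] := X_app Xh d0.
have Xw := X_Cc cw; rewrite -[D h u]subr0 -(H2 w)// -Dl//.
by apply: le_trans (Db _ _ _ _ (XB Xh Xw) Xu wd uM) _; rewrite mulrAC.
Qed.

End amplification.

(** * Compact operators and the maps [iota] *)

Section compact_operators.
Context (R : realType) {k : nat} (L : topological_kgraph k).
Local Notation C := R[i].
Implicit Types (m n p : {ffun 'I_k -> nat}) (f g h u : L -> C) (v x y z : L).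
Implicit Types (M N e : R) (S T : (L -> C) -> L -> C).

(** Compactly supported functions are enough to approximate compact operators,
by [approximable_frank]. *)
Definition approximable n T := forall e, 0 < e ->
  exists2 s, pairs (Cc n) s & opbd n (fun h x => T h x - frank n s h x) e.

Lemma opbd_tri n S T U e e' : opbd n (fun h x => S h x - T h x) e ->
  opbd n (fun h x => T h x - U h x) e' ->
  opbd n (fun h x => S h x - U h x) (2 * (e + e')).
Proof.
move=> ST TU; apply: opbd_eq (opbdD ST TU) => f _; apply/funext => x.
by rewrite addrA subrK.
Qed.

Lemma frank_cat n s t h :
  frank n (s ++ t) h = fun x => frank n s h x + frank n t h x.
Proof. by apply/funext => x; rewrite /frank big_cat. Qed.

Lemma approximable_frank n s : pairs (X n) s -> approximable n (frank n s).
Proof.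
elim=> [|[f g] s' [/= Xf Xg] _ IH] e e0.
  exists [::]; first exact: List.Forall_nil.
  move=> h M _ hM v F Fv; rewrite big1 ?mulr_ge0 ?(bd_ge0 v hM)// 1?ltW// => x _.
  by rewrite frank_nil subrr sqn0.
have e40 : 0 < e / 10 by rewrite divr_gt0.
have [t tC te] := IH _ e40.
have [N N0 gN] := X_bd Xg; have [d d0 de] := small_factor N0 e40.
have [f' cf' fd] := X_app Xf d0.
have [M M0 fM] := X_bd (X_Cc cf'); have [d' d'0 de'] := small_factor M0 e40.
have [g' cg' gd] := X_app Xg d'0.
exists ((f', g') :: t); first exact: List.Forall_cons.
have H1 := opbd_le de (opbd_rank_one N0 fd gN).
have H2 : opbd n (rank_one n f' (fun x => g x - g' x)) (e / 10).
  apply: opbd_le (opbd_rank_one (ltW d'0) fM gd); rewrite mulrC; exact: de'.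
have H := opbdD (opbdD H1 H2) te.
apply: opbd_le (opbd_eq _ H) => [|h Xh]; first lra.
rewrite -rank_oneBl -rank_oneBm//; last exact: X_Cc.
by rewrite !frank_cons; apply/funext => x /=; ring.
Qed.

Lemma frank_tnth n s h x : frank n s h x =
  \sum_(i < size s) 1 * rank_one n (tnth (in_tuple s) i).1 (tnth (in_tuple s) i).2 h x.
Proof.
rewrite /frank big_tnth; apply: eq_bigr => i _; by rewrite mul1r.
Qed.

Lemma Forall_tnth (A : Type) (P : A -> Prop) (s : seq A) (i : 'I_(size s)) :
  List.Forall P s -> P (tnth (in_tuple s) i).
Proof.
move=> Ps; rewrite (tnth_nth (tnth (in_tuple s) i)) /=.
move: (tnth _ _) (nat_of_ord i) (ltn_ord i) => a j.
elim: Ps j => [j|b t Pb _ IH [|j]] //=; exact: IH.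
Qed.

Lemma compact_operatorP n T : compact_operator n T <->
  adjointable n T /\ approximable n T.
Proof.
split=> [[aT cT]|[aT cT]]; split => // e e0.
  have [T' [XT _ _]] := (adjointableP n T).1 aT.
  have e40 : 0 < Num.sqrt (e / 4) by rewrite sqrtr_gt0 divr_gt0.
  have [N [c [f [g [Xfg H]]]]] := cT _ e40.
  pose s := [seq ((fun x => c i * f i x), g i) | i <- enum 'I_N].
  have Xs : pairs (X n) s.
    rewrite /s; elim: (enum _) => [|i t IH] /=; first exact: List.Forall_nil.
    by apply: List.Forall_cons IH; have [Xf Xg] := Xfg i; split => //=; exact: XZ.
  have fsE h : frank n s h = fun x => \sum_i c i * rank_one n (f i) (g i) h x.
    apply/funext => x; rewrite /frank /s big_map big_enum /=.
    by apply: eq_bigr => i _; rewrite /rank_one /ract mulrA.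
  have Hs : opbd n (fun h x => T h x - frank n s h x) (e / 4).
    move=> h M Xh hM v; have M0 := bd_ge0 v hM.
    have [XS _ _] := adjoint_frank Xs.
    have [K _ hK] := X_bd (XB (XT _ Xh) (XS _ Xh)).
    have hb := bd_inner_norm hK; apply: (l2_le _ (hb v)); have := H h Xh; rewrite fsE.
    set a := inner_norm n _; set b := inner_norm n h => ab.
    have a0 : 0 <= a by exact: sqrtr_ge0.
    have b0 : 0 <= b by exact: sqrtr_ge0.
    apply: (@le_trans _ _ ((Num.sqrt (e / 4) * b) ^+ 2)).
      rewrite ler_sqr; [exact: ab|rewrite nnegrE; exact: a0|].
      by rewrite nnegrE mulr_ge0// ltW.
    have e4 : 0 <= e / 4 by rewrite divr_ge0// ltW.
    by rewrite exprMn sqr_sqrtr// ler_wpM2l// inner_norm_le.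
  have [t tC te] := approximable_frank Xs (divr_gt0 e0 (ltr0n R 4)).
  by exists t => //; apply: opbd_le (opbd_tri Hs te); lra.
have [T' [XT _ _]] := (adjointableP n T).1 aT.
have [s sC sT] := cT _ (exprn_gt0 2 e0).
exists (size s), (fun=> 1), (fun i => (tnth (in_tuple s) i).1),
  (fun i => (tnth (in_tuple s) i).2); split=> [i|h Xh].
  by have := Forall_tnth i (pairs_X sC).
have -> : (fun x => \sum_(i < size s) 1 * rank_one n (tnth (in_tuple s) i).1
    (tnth (in_tuple s) i).2 h x) = frank n s h.
  by apply/funext => x; rewrite frank_tnth.
have [K _ hK] := X_bd Xh; have hh := bd_inner_norm hK.
have e1 := ltW e0.
rewrite -ler_sqr ?nnegrE ?sqrtr_ge0//; last by rewrite mulr_ge0// sqrtr_ge0.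
rewrite exprMn; apply: inner_norm_le; first by rewrite mulr_ge0 ?sqr_ge0.
exact: sT hh.
Qed.

Lemma compact_opbd n T : compact_operator n T -> exists2 e, 0 <= e & opbd n T e.
Proof.
move=> /compact_operatorP[_ /(_ 1 ltr01)[s sC sT]].
have [e e0 se] := opbd_frank (pairs_X sC).
exists (2 * (1 + e)); first by rewrite mulr_ge0// addr_ge0.
apply: opbd_eq (opbdD sT se) => f _; apply/funext => x.
by rewrite subrK.
Qed.

(** In degree 0 every fibre of the source map is a point, so that an adjointable
operator is a multiplication. *)
Lemma degree0_fibre v x : fib 0 v x -> x = v.
Proof. by move=> [/deg0_id[sx _] <-]. Qed.

Lemma degree0_bd f M : (forall x, ~ paths 0 x -> f x = 0) -> 0 <= M ->
  (forall x, paths 0 x -> sqn (f x) <= M) -> bd 0 f M.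
Proof.
move=> f0 M0 fM v; apply: (@s_inj_l2 _ _ _ _ _ (paths 0)) => //.
- by move=> x y; rewrite !inE => /deg0_id[sx _] /deg0_id[sy _]; rewrite sx sy.
- by move=> x; apply: contraNP => /f0 ->.
- move=> x; have [/fM//|/f0 ->] := pselect (paths 0 x); by rewrite sqn0.
Qed.

Lemma compact_degree0 S : compact_operator 0 S -> exists2 a, X 0 a &
  forall b, X 0 b -> S b = fun x => a x * b x.
Proof.
move=> /compact_operatorP[/adjointableP[S' SS'] Sa].
have [XS XS' _] := SS'.
pose a x : C := if kg_d x == 0 then (S' (peak R 0 x) x)^* else 0.
have a0 x : ~ paths 0 x -> a x = 0 by rewrite /a; case: eqP.
have Sb b : X 0 b -> S b = fun x => a x * b x.
  move=> Xb; apply/funext => x; have [dx|dx] := pselect (paths 0 x); last first.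
    by rewrite (X_off (XS _ Xb))// a0// mul0r.
  have [sx _] := deg0_id dx.
  rewrite (adjoint_peak SS' Xb dx) innerE (@ip_single _ _ _ _ _ x)//.
    by rewrite /a dx eqxx.
  by move=> y /degree0_fibre ->; rewrite sx eqxx.
exists a => //; apply: X_closed => // e e0; have [s sC sS] := Sa e e0.
(* the function by which the finite-rank approximation multiplies *)
pose q x := \sum_(fg <- s) fg.1 x * (fg.2 x)^*.
have qC : Cc 0 q.
  rewrite /q; elim: sC => [|[f g] t [/= cf cg] _ IH].
    rewrite (_ : (fun x => _) = fun=> 0); first exact: Cc0.
    by apply/funext => x; rewrite big_nil.
  rewrite (_ : (fun x => _) = fun x => (g x)^* * f x +
      \sum_(fg <- t) fg.1 x * (fg.2 x)^*).
    by apply: CcD IH; apply: CcM cf _; apply: continuous_conj; exact: (Cc_cont cg).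
  by apply/funext => x; rewrite big_cons /= mulrC.
exists q; first exact: X_Cc.
apply: degree0_bd => [x dx||x dx]; first by rewrite a0// (Cc_off qC)// subrr.
  exact: ltW.
have [_ _ p1] := peakE R dx; have Xp := X_peak R dx.
have := bd_pt dx (sS _ _ Xp p1); rewrite mulr1; congr (sqn _ <= _).
have xx : fib 0 (kg_s x) x by [].
rewrite Sb// /frank /q; congr (_ - _).
  by have [_ px _] := peakE R dx; rewrite px// eqxx mulr1.
by apply: eq_bigr => fg _; rewrite /rank_one /ract inner_peakr.
Qed.

Lemma lactE n (a f : L -> C) : (forall x, ~ paths n x -> f x = 0) ->
  lact a f = ps_mul 0 n a f.
Proof.
move=> f0; apply/funext => x; rewrite /lact.
have [dx|dx] := pselect (paths n x); last first.
  by rewrite mul_off ?add0r// f0// mulr0.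
have sr : kg_s (kg_r x) = kg_r x by rewrite kg_sr.
rewrite mulE ?add0r//.
rewrite -{3}(kg_comp1l x) (head_comp (kg_d_id x) dx sr).
by rewrite -{4}(kg_comp1l x) (tail_comp (kg_d_id x) dx sr).
Qed.

Lemma adjoint_lact n (a : L -> C) : X 0 a ->
  adjoint n (lact a) (lact (fun x => (a x)^*)).
Proof.
move=> Xa; have XL b f : X 0 b -> X n f -> X n (lact b f).
  move=> Xb Xf; rewrite (@lactE n); last by move=> x; exact: X_off.
  by have := X_mul Xb Xf; rewrite add0r.
split=> [f|f Xf|f g _ _]; first exact: XL.
  by apply: XL => //; exact: X_conj.
apply/funext => v; rewrite !innerE; apply: ip_eqM => x _.
by rewrite /lact rmorphM /= mulrCA mulrA.
Qed.

(** The two clauses in the definition of [iota] agree: in degree 0 the left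
action of a multiplication operator satisfies the product rule as well. *)
Lemma iotaP m n p S : m + n = p -> compact_operator m S ->
  adjointable p (Defs.iota m p S) /\
  forall f g, X m f -> X n g -> Defs.iota m p S (ps_mul m n f g) = ps_mul m n (S f) g.
Proof.
move=> <- cS; have [e e0 Se] := compact_opbd cS.
have [/adjointableP[S' SS'] _] := (compact_operatorP m S).1 cS.
rewrite /Defs.iota deg_addK; have [m0|m0] := eqVneq m 0.
  subst m; rewrite add0r; have [a Xa Sa] := compact_degree0 cS.
  set A := [set T | _].
  have [a' [C0a' Sa' Ta']] : exists a, [/\ C0 0 a,
      forall b, X 0 b -> S b = (fun x => a x * b x)
    & forall f, X n f -> xget S A f = lact a f].
    have : A (xget S A).
      apply: xgetPex; exists (lact a); have [C0a _] := Xa; rewrite /A /=; exists a.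
      by split; [exact: C0a|exact: Sa|exact: (fun f _ => erefl)].
    by rewrite {1}/A /=.
  have aa' : a' = a.
    have [_ a'0 _] := C0a'; apply/funext => x.
    have [dx|dx] := pselect (paths 0 x); last by rewrite a'0// (X_off Xa).
    have := Sa' _ (X_peak R dx); rewrite Sa; last exact: X_peak.
    move=> /(congr1 (@^~ x)) /=; have [_ px _] := peakE R dx.
    by rewrite px// eqxx !mulr1.
  rewrite aa' in Ta'; have [XL XL' LL'] := adjoint_lact n Xa.
  split.
    apply/adjointableP; exists (lact (fun x => (a x)^*)).
    split=> [f Xf|f Xf|f g Xf Xg]; last by rewrite Ta'//; exact: LL'.
      by rewrite Ta'//; exact: XL.
    exact: XL'.
  move=> f g Xf Xg; have Xfg : X n (ps_mul 0 n f g).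
    by have := X_mul Xf Xg; rewrite add0r.
  rewrite Ta'// Sa//; apply/funext => x; rewrite /lact.
  have [dx|dx] := pselect (paths (0 + n) x); last by rewrite !mul_off// mulr0.
  rewrite !mulE//; have dx' : kg_d x = n by rewrite -[RHS]add0r.
  have sr : kg_s (kg_r x) = kg_r x by rewrite kg_sr.
  have -> : head 0 x = kg_r x.
    by rewrite -{1}(kg_comp1l x) (head_comp (kg_d_id x) dx' sr).
  by rewrite mulrA.
set A := [set T | _].
have : A (xget S A); last first.
  by rewrite {1}/A; case: eqP m0.
apply: xgetPex; exists (ampl m n S'); rewrite /A.
case: eqP m0 => // _ _; split.
  by apply/adjointableP; exists (ampl m n S); exact: (ampl_adjoint n SS' e0 Se).
by move=> f g Xf Xg; exact: ampl_mul.
Qed.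

Lemma iota_ampl m n p S S' : m + n = p -> compact_operator m S ->
  adjoint m S S' -> forall h, X p h -> Defs.iota m p S h = ampl m n S' h.
Proof.
move=> <- cS SS' h Xh.
have [/adjointableP[T' TT'] Tmul] := iotaP (erefl (m + n)) cS.
exact: (ampl_unique SS' TT' Tmul Xh).
Qed.

End compact_operators.

(** * Multiplication operators *)

Section compact_alignment.
Context (R : realType) {k : nat} (L : topological_kgraph k).
Local Notation C := R[i].
Implicit Types (m n p q : {ffun 'I_k -> nat}) (f g h u : L -> C) (v x y z : L).
Implicit Types (M N e : R) (S T : (L -> C) -> L -> C) (U V K W : set L).

Definition finite_rank n T := exists2 s, pairs (Cc n) s &
  forall h, X n h -> T h = frank n s h.

Lemma finite_rank_approximable n T : finite_rank n T -> approximable n T.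
Proof.
move=> [s sC Ts] e e0; exists s => // h M Xh hM v F Fv.
have M0 := bd_ge0 v hM.
rewrite big1 => [|x _]; first by rewrite mulr_ge0// ltW.
by rewrite Ts// subrr sqn0.
Qed.

Lemma finite_rankD n S T : finite_rank n S -> finite_rank n T ->
  finite_rank n (fun h x => S h x + T h x).
Proof.
move=> [s sC Ss] [t tC Tt]; exists (s ++ t); first by apply/List.Forall_app.
by move=> h Xh; rewrite frank_cat Ss// Tt.
Qed.

Lemma finite_rank0 n T : (forall h, X n h -> T h = fun=> 0) -> finite_rank n T.
Proof.
move=> T0; exists [::]; first exact: List.Forall_nil.
by move=> h /T0 ->; rewrite frank_nil.
Qed.

Lemma finite_rank_eq n S T : (forall h, X n h -> S h = T h) ->
  finite_rank n S -> finite_rank n T.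
Proof. by move=> ST [s sC Ss]; exists s => // h Xh; rewrite -ST// Ss. Qed.

Definition mulop (a : L -> C) h : L -> C := fun x => a x * h x.

(** If [a] is supported where the local unit [c] is 1, multiplication by [a] is
the rank-one operator given by [a] and [c]. *)
Lemma finite_rank_mulop n (a : L -> C) : Cc n a -> finite_rank n (mulop a).
Proof.
move: a; apply: Cc_ind => [|a b ca cb Fa Fb|x nx].
- apply: finite_rank0 => h _; apply/funext => x.
  by rewrite /mulop mul0r.
- apply: finite_rank_eq (finite_rankD Fa Fb) => h _.
  by apply/funext => x; rewrite /mulop mulrDl.
have [W [W' [c [[oW Wx WW'] [[_ W'n W'i] [cc c1 cW']]]]]] := local_unit R nx.
exists W; split => // a ca aW; exists [:: (a, c)].
  exact: List.Forall_cons (List.Forall_nil _).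
move=> h Xh; apply/funext => y; rewrite /frank big_seq1 /= /rank_one /ract /mulop.
have [->|ay] := eqVneq (a y) 0; first by rewrite !mul0r.
have Wy := carriedE aW ay; congr (_ * _).
rewrite innerE (@ip_single _ _ _ _ _ y).
- by rewrite c1// rmorph1 mul1r.
- by split => //; exact/W'n/WW'.
move=> z [nz sz] zy; have [->|/(carriedE cW') W'z] := eqVneq (c z) 0.
  by rewrite rmorph0 mul0r.
by case/eqP: zy; apply: (s_injE W'i) => //; exact: WW'.
Qed.

Lemma X_mulop n (a : L -> C) h : Cc n a -> X n h -> X n (mulop a h).
Proof.
move=> /finite_rank_mulop[s sC sh] Xh; rewrite sh//.
by have [XS _ _] := adjoint_frank (pairs_X sC); exact: XS.
Qed.

Lemma adjoint_mulop n (a : L -> C) : Cc n a ->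
  adjoint n (mulop a) (mulop (fun x => (a x)^*)).
Proof.
move=> ca; split=> [f|f|f g _ _]; first exact: X_mulop.
  by apply: X_mulop; exact: Cc_conj.
apply/funext => v; rewrite !innerE; apply: ip_eqM => x _.
by rewrite /mulop rmorphM /= mulrCA mulrA.
Qed.

Lemma compact_mulop n (a : L -> C) : Cc n a -> compact_operator n (mulop a).
Proof.
move=> ca; apply/compact_operatorP; split.
  by apply/adjointableP; eexists; exact: adjoint_mulop.
exact/finite_rank_approximable/finite_rank_mulop.
Qed.

Lemma iota_mulop m n p (a : L -> C) h x : m + n = p -> Cc m a -> X p h ->
  paths p x -> Defs.iota m p (mulop a) h x = a (head m x) * h x.
Proof.
move=> mn ca Xh; rewrite -{1}mn => dx.
rewrite (iota_ampl mn (compact_mulop ca) (adjoint_mulop ca) Xh) amplE// innerE.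
have [dh dt ht xE] := factorisation dx.
rewrite (@ip_single _ _ _ _ _ x)//.
  rewrite /kernel mul_peak// eqxx /mulop.
  have [_ pk _] := peakE R dh; rewrite pk// eqxx mulr1 conjCK.
  by [].
move=> y vy yx; have [dy sy] := vy; rewrite /kernel mul_peak//.
case: (eqVneq (tail m n y) (tail m n x)) => [txy|_]; last by rewrite rmorph0 mul0r.
have [dh' dt' ht' yE] := factorisation dy.
have [_ pk _] := peakE R dh; rewrite /mulop pk; last first.
  by split; [exact: dh'|rewrite ht ht' txy].
case: (eqVneq (head m y) (head m x)) => [hxy|_].
  by case/eqP: yx; exact: factor_inj dy dx hxy txy.
by rewrite mulr0 rmorph0 mul0r.
Qed.

Lemma compact_plateau n U : U `<=` paths n -> compact U ->
  exists c : L -> R, Cc n (fun x => (c x)%:C) /\ forall x, U x -> 1 <= c x.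
Proof.
move=> Un cU.
have /choice[c cP] : forall x, exists c : L -> R, paths n x ->
    [/\ Cc n (fun y => (c y)%:C), forall y, 0 <= c y & nbhs x [set y | c y = 1]].
  move=> x; have [nx|nx] := pselect (paths n x); last by exists (cst 0).
  have [c [K [V [cc c01 [cK KW] c0 [oV Vx _ V1]]]]] :=
    @bump R L (@kg_locally_compact _ L) (@kg_hausdorff _ L) _ _ (@open_paths _ L n) nx.
  exists c => _; split.
  - apply: (Cc_intro (continuous_complex cc) cK KW) => y cy; apply: c0.
    by apply: contraNneq cy => ->.
  - by move=> y; have /andP[] := c01 y.
  - by apply: (@filterS _ (nbhs x) _ V) => //; exact: open_nbhs_nbhs.
have Uc x : U x -> nbhs x [set y | c x y = 1] by move=> /Un/cP[].
have [E [EU UE]] := compact_fset_cover cU Uc.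
exists (fun y => \sum_(x <- E) c x y); split=> [|y Uy].
  have : forall x, x \in enum_fset E -> paths n x by move=> x /EU /Un.
  elim: (enum_fset E) => [|x s IH] sn.
    rewrite (_ : (fun x => _) = fun=> 0); first exact: Cc0.
    by apply/funext => y; rewrite big_nil.
  rewrite (_ : (fun x => _) = fun y => (c x y)%:C + (\sum_(z <- s) c z y)%:C).
    apply: CcD; last by apply: IH => z zs; apply: sn; rewrite inE zs orbT.
    by have [] := cP x (sn x (mem_head _ _)).
  by apply/funext => y; rewrite big_cons rmorphD.
have [x xE /= cxy] := UE y Uy; rewrite (big_fsetD1 x)//= cxy lerDl.
rewrite big_seq; apply: sumr_ge0 => z; rewrite !inE => /andP[_ zE].
by have [_ + _] := cP z (Un z (EU z zE)); apply.
Qed.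

Lemma closed_path_mul m n U : U `<=` paths m -> closed U ->
  closed (path_mul U (paths n)).
Proof.
move=> Um cU; rewrite -openC openE => x nx; rewrite /interior.
have [dx|dx] := pselect (paths (m + n) x); last first.
  have : nbhs x (paths (kg_d x)) by apply: open_nbhs_nbhs; split=> //; exact: open_paths.
  apply: filterS => y dy [a [b [/Um da db ab yE]]]; apply: dx.
  by rewrite /paths /= -dy yE kg_d_comp// da db.
have [dh dt ht xE] := factorisation dx.
have nU : (~` U) (head m x).
  by move=> Uh; apply: nx; exists (head m x), (tail m n x).
have : nbhs x (head m @^-1` (~` U)).
  apply: (head_continuous dx); apply: open_nbhs_nbhs; split => //.
  exact: closed_openC.
apply: filterS => y /= nUy [a [b [Ua db ab yE]]]; apply: nUy.
by rewrite yE (head_comp (Um _ Ua) db ab).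
Qed.

Lemma carrier_frank n s : pairs (Cc n) s -> exists K, compact K /\
  forall x h, ~ K x -> frank n s h x = 0.
Proof.
elim=> [|[f g] t [/= cf cg] _ [K [cK K0]]].
  by exists set0; split=> [|x h _]; [exact: compact0|rewrite frank_nil].
have [W [cW _ fW]] := Cc_carrier cf; exists (W `|` K).
split=> [|x h nx]; first exact: compactU.
rewrite frank_cons K0 => [|Kx]; last by apply: nx; right.
have fx0 : f x = 0 by apply/eqP; apply: contra_notT nx => /fW; left.
by rewrite /rank_one /ract /= fx0 mul0r mulr0 addr0.
Qed.

(** The composite of the operators induced by two multiplications multiplies the
peak at a path of the join by a number which is at least 1, while finite-rank
operators with compactly supported data kill the peaks of the paths far out. *)
Lemma kgraph_aligned_of_ps :
  ps_compactly_aligned R L -> kgraph_compactly_aligned L.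
Proof.
move=> psL p q U V Up Vq cU cV.
have [a [ca aU]] := compact_plateau Up cU.
have [b [cb bV]] := compact_plateau Vq cV.
have := psL p q _ _ (compact_mulop ca) (compact_mulop cb).
set P := deg_join p q; have pP := deg_joinl p q; have qP := deg_joinr p q.
set A := Defs.iota p P _; set B := Defs.iota q P _.
(* any tolerance less than 1 contradicts the lower bound on the symbol *)
move=> /compact_operatorP[_ /(_ (1 / 4))[]]; first by rewrite divr_gt0.
move=> s sC sAB; have [K [cK K0]] := carrier_frank sC.
apply: (compact_sub _ cK).
  have clU : closed U by apply: compact_closed cU; exact: kg_hausdorff.
  have clV : closed V by apply: compact_closed cV; exact: kg_hausdorff.
  by apply: closedI; [exact: closed_path_mul Up clU|exact: closed_path_mul Vq clV].
move=> x [[y [z [Uy dz yz xE]]] [y' [z' [Vy dz' yz' xE']]]].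
apply: contrapT => nKx.
have dx : paths P x by rewrite /paths /= xE kg_d_comp// (Up _ Uy) dz pP.
have hx : head p x = y by rewrite xE (head_comp (Up _ Uy) dz yz).
have hx' : head q x = y' by rewrite xE' (head_comp (Vq _ Vy) dz' yz').
have Xd := X_peak R dx; have [_ pk d1] := peakE R dx.
have XB : X P (B (peak R P x)).
  have [/adjointableP[B' [XB _ _]] _] := iotaP qP (compact_mulop cb).
  exact: XB.
have := bd_pt dx (sAB _ _ Xd d1); rewrite K0// subr0 /= mulr1.
rewrite /A (iota_mulop pP ca XB dx) /B (iota_mulop qP cb Xd dx) pk// eqxx mulr1.
rewrite hx hx' -rmorphM sqn_real.
have ab1 : 1 <= a y * b y'.
  by rewrite -[leLHS]mulr1 ler_pM//; [exact: aU|exact: bV].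
have : 1 <= (a y * b y') ^+ 2 by rewrite exprn_ege1.
lra.
Qed.

(** * Composites of amplified rank-one operators *)

Lemma inner_suml n (I : Type) (s : seq I) (c : I -> C) (f : I -> L -> C) h v :
  (forall i, X n (f i)) -> X n h ->
  inner n (fun x => \sum_(i <- s) c i * f i x) h v =
    \sum_(i <- s) (c i)^* * inner n (f i) h v.
Proof.
move=> Xf Xh.
suff [] : X n (fun x => \sum_(i <- s) c i * f i x) /\
    inner n (fun x => \sum_(i <- s) c i * f i x) h v =
    \sum_(i <- s) (c i)^* * inner n (f i) h v by [].
elim: s => [|i s [XS IH]].
  rewrite (_ : (fun x => _) = fun=> 0); last by apply/funext => x; rewrite big_nil.
  split; first exact: X0.
  by rewrite big_nil innerE ip_eq0// => x _; rewrite rmorph0 mul0r.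
rewrite (_ : (fun x => _) = fun x => c i * f i x + \sum_(i <- s) c i * f i x).
  by split; [exact: X_comb|rewrite inner_combl// IH big_cons].
by apply/funext => x; rewrite big_cons.
Qed.

Lemma kernel_rank_one m n f g x y : paths (m + n) x -> fib (m + n) (kg_s x) y ->
  kernel m n (rank_one m g f) x y =
  (f (head m x))^* * ps_mul m n g (peak R n (tail m n x)) y.
Proof.
move=> dx vy; rewrite /kernel !mul_peak//; case: eqVneq => [txy|_]; last first.
  by rewrite mulr0.
have [dy sy] := vy; have [dh dt ht _] := factorisation dx.
have [_ _ ht' _] := factorisation dy.
by rewrite /rank_one /ract ht' txy -ht inner_peakr// mulrC.
Qed.

Lemma ampl_rank_one m n f g h x : X m f -> X m g -> X (m + n) h ->
  paths (m + n) x -> ampl m n (rank_one m g f) h x =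
  f (head m x) * inner (m + n) (ps_mul m n g (peak R n (tail m n x))) h (kg_s x).
Proof.
move=> Xf Xg Xh dx; have [dh dt _ _] := factorisation dx.
have Xk := X_mul Xg (X_peak R dt).
rewrite amplE// (_ : inner _ _ _ _ = ip (fib (m + n) (kg_s x))
  (fun y => (f (head m x))^* * ps_mul m n g (peak R n (tail m n x)) y) h).
  have [M [N [kM hN]]] := X_ip (kg_s x) Xk Xh.
  by rewrite (ipZl _ kM hN) conjCK.
by apply: ip_eq => // y vy; rewrite kernel_rank_one.
Qed.

Lemma X_ampl_rank_one m n f g h : X m f -> X m g -> X (m + n) h ->
  X (m + n) (ampl m n (rank_one m g f) h).
Proof.
move=> Xf Xg; have [M M0 fM] := X_bd Xf; have [N N0 gN] := X_bd Xg.
exact: (X_ampl (adjoint_rank_one Xf Xg) (mulr_ge0 N0 M0) (opbd_rank_one N0 fM gN)).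
Qed.

(** On a fibre the product of [g] and [b] is the finite sum of the products of [g]
with the [b z * peak z]. *)
Lemma inner_inner m n g b h v : X m g -> Cc n b -> X (m + n) h ->
  inner n b (fun z => inner (m + n) (ps_mul m n g (peak R n z)) h v) v =
  inner (m + n) (ps_mul m n g b) h v.
Proof.
move=> Xg cb Xh; have [_ /(_ v)[Z [Zv ZZ]]] := Cc_fin cb.
have b0 z : fib n v z -> z \notin Z -> b z = 0.
  by move=> vz; apply: contraNeq; exact: ZZ.
rewrite innerE (ip_fin Zv) => [|z vz zZ]; last by rewrite b0// rmorph0 mul0r.
pose F z := if pselect (paths n z) then ps_mul m n g (peak R n z) else fun=> 0.
have XF z : X (m + n) (F z).
  rewrite /F; case: pselect => nz; last exact: X0.
  by apply: X_mul => //; exact: X_peak.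
rewrite (eq_big_seq (fun z => (b z)^* * inner (m + n) (F z) h v)); last first.
  by move=> z zZ; have [nz _] := Zv _ zZ; rewrite /F; case: pselect.
rewrite -inner_suml// !innerE; apply: ip_eq => // y [dy sy].
have [dh dt ht yE] := factorisation dy; rewrite mulE//.
have vt : fib n v (tail m n y) by split; [exact: dt|rewrite kg_s_tail].
have FE z : z \in Z -> F z y = if tail m n y == z then g (head m y) else 0.
  move=> zZ; have [nz sz] := Zv _ zZ; rewrite /F; case: pselect => [nz'|//] /=.
  rewrite mulE//; have [_ pk _] := peakE R nz; rewrite pk; last by rewrite sz.
  by case: eqVneq => _; rewrite ?mulr1 ?mulr0.
rewrite (@sum_one _ _ _ _ (tail m n y)).
- have [tZ|tZ] := boolP (tail m n y \in Z); first by rewrite FE// eqxx mulrC.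
  by rewrite b0// mulr0 mul0r.
- by move=> z zZ zt; rewrite FE// eq_sym (negPf zt) mulr0.
by move=> tZ; rewrite b0// mul0r.
Qed.

(** At a path [x] the composite is the value of [f1] at the head of [x], times a
sum over the paths [y] with the same tail as [x] after degree [m], weighted by the
overlap [F y] of [g1] and [f2]. Compact alignment of the graph makes the support
of [F] compact, since it lies in the join of the supports of [g1] and [f2];
then [two_tails] splits the sum into finitely many terms of rank one. *)
Lemma ampl_comp_rank_one m m' n n' f1 g1 f2 g2 :
  deg_join m n = m + m' -> deg_join m n = n + n' ->
  kgraph_compactly_aligned L -> Cc m f1 -> Cc m g1 -> Cc n f2 -> Cc n g2 ->
  finite_rank (m + m') (ampl m m' (rank_one m g1 f1) \o
    ampl n n' (rank_one n g2 f2)).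
Proof.
move=> em en aL cf1 cg1 cf2 cg2; have emn : m + m' = n + n' by rewrite -em.
have m'E : deg_sub (deg_join m n) m = m' by rewrite em deg_addK.
have n'E : deg_sub (deg_join m n) n = n' by rewrite en deg_addK.
pose F y := ps_mul m m' (fun x => (g1 x)^*) (cst 1) y * ps_mul n n' f2 (cst 1) y.
have FE y : paths (m + m') y -> F y = (g1 (head m y))^* * f2 (head n y).
  by move=> dy; have dy' := dy; rewrite emn in dy'; rewrite /F !mulE// !mulr1.
have cF : Cc (m + m') F.
  have [K1 [cK1 K1m gK1]] := Cc_carrier cg1; have [K2 [cK2 K2n fK2]] := Cc_carrier cf2.
  apply: (Cc_intro _ (aL m n K1 K2 K1m K2n cK1 cK2)).
  - apply: continuous_mul.
      apply: mul_continuous; last exact: continuous_cst.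
      exact: continuous_conj (Cc_cont cg1).
    by apply: mul_continuous; [exact: Cc_cont cf2|exact: continuous_cst].
  - rewrite /path_join m'E => _ [[a [b [/K1m da db ab ->]]] _].
    by rewrite /paths /= kg_d_comp// da db.
  move=> y Fy; have [dy|dy] := pselect (paths (m + m') y); last first.
    by move: Fy; rewrite /F mul_off// mul0r eqxx.
  have dy' := dy; rewrite emn in dy'.
  have [dh dt ht yE] := factorisation dy; have [dh' dt' ht' yE'] := factorisation dy'.
  move: Fy; rewrite FE// mulf_eq0 negb_or conjC_eq0 => /andP[/gK1 gy /fK2 fy].
  rewrite /path_join m'E n'E; split.
    by exists (head m y), (tail m m' y).
  by exists (head n y), (tail n n' y).
have [s [sC sF]] := two_tails emn cF.
exists [seq (ps_mul m m' f1 ab.1, ps_mul n n' g2 ab.2) | ab <- s].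
  elim: sC => [|[a b] t [/= ca cb] _ IH] /=; first exact: List.Forall_nil.
  apply: List.Forall_cons IH; split => /=; first exact: Cc_mul.
  by rewrite emn; exact: Cc_mul.
have Xf1 := X_Cc cf1; have Xg1 := X_Cc cg1; have Xf2 := X_Cc cf2; have Xg2 := X_Cc cg2.
move=> h Xh; have Xh' := Xh; rewrite emn in Xh'.
have XH : X (m + m') (ampl n n' (rank_one n g2 f2) h).
  by rewrite emn; exact: X_ampl_rank_one.
apply/funext => x; rewrite /= /frank big_map /=.
have [dx|dx] := pselect (paths (m + m') x); last first.
  rewrite ampl_off// big1// => ab _.
  by rewrite /rank_one /ract mul_off// mul0r.
have [dh dt ht xE] := factorisation dx; set v := kg_s x.
have st : kg_s (tail m m' x) = v by rewrite kg_s_tail.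
pose k1 := ps_mul m m' g1 (peak R m' (tail m m' x)).
have [pC _ _] := peakE R dt; have ck1 : Cc (m + m') k1 by exact: Cc_mul.
pose Q z := inner (n + n') (ps_mul n n' g2 (peak R n' z)) h v.
have [_ /(_ v)[E1 [E1v E1E]]] := Cc_fin ck1; have [_ /(_ v)[E2 [E2v E2E]]] := Cc_fin cF.
pose E := (E1 `|` E2)%fset; have Ev : [set` E] `<=` fib (m + m') v by exact: fsetU_sub.
have EF y : fib (m + m') v y -> F y != 0 -> y \in E.
  by move=> vy /(E2E _ vy) yE; rewrite inE yE orbT.
have := sF (tail m m' x) Q E dt; rewrite st => /(_ Ev EF) sumF.
rewrite ampl_rank_one// -/v -/k1 innerE (ip_fin Ev) => [|y vy yE]; last first.
  have -> : k1 y = 0; last by rewrite rmorph0 mul0r.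
  by apply/eqP; apply: contraNT yE => /(E1E _ vy) yE; rewrite inE yE.
transitivity (f1 (head m x) *
    \sum_(y <- E | tail m m' y == tail m m' x) F y * Q (tail n n' y)).
  congr (_ * _); rewrite [RHS]big_mkcond /=; apply: eq_big_seq => y yE.
  have vy := Ev _ yE; have [dy sy] := vy; have dy' := dy; rewrite emn in dy'.
  rewrite /k1 mul_peak//; case: eqVneq => _; last by rewrite rmorph0 mul0r.
  by rewrite ampl_rank_one// FE// mulrA sy.
rewrite sumF mulr_sumr; elim: sC => [|[a b] t [/= ca cb] _ IH]; first by rewrite !big_nil.
rewrite !big_cons IH; congr (_ + _) => /=.
rewrite /Q inner_inner// /rank_one /ract mulE//.
by rewrite mulrA -/v emn.
Qed.

Lemma ampl_swap_cons m n fg s h : pairs (X m) (fg :: s) -> X (m + n) h ->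
  ampl m n (frank m [seq (fg.2, fg.1) | fg <- fg :: s]) h =
  fun x => ampl m n (rank_one m fg.2 fg.1) h x +
    ampl m n (frank m [seq (fg.2, fg.1) | fg <- s]) h x.
Proof.
move=> Xs Xh; apply/funext => x.
have [dx|dx] := pselect (paths (m + n) x); last by rewrite !ampl_off// addr0.
case/List.Forall_cons_iff: Xs => -[Xf Xg] Xs.
have A1 := adjoint_rank_one Xf Xg; have A2 := adjoint_frank Xs.
have E := inner_combl 1 (kg_s x) Xh (X_kernel A1 dx) (X_kernel A2 dx).
rewrite conjC1 mul1r in E; rewrite !amplE// -E.
have -> // : kernel m n (frank m [seq (fg.2, fg.1) | fg <- fg :: s]) x =
  fun y => 1 * kernel m n (rank_one m fg.2 fg.1) x y +
    kernel m n (frank m [seq (fg.2, fg.1) | fg <- s]) x y.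
apply/funext => y; rewrite /kernel /ps_mul /= frank_cons.
by case: ifP => _; [rewrite mulrDl mulrA|rewrite mulr0 addr0].
Qed.

Lemma ampl_comp_frank m m' n n' s t :
  deg_join m n = m + m' -> deg_join m n = n + n' ->
  kgraph_compactly_aligned L -> pairs (Cc m) s -> pairs (Cc n) t ->
  finite_rank (m + m') (ampl m m' (frank m [seq (fg.2, fg.1) | fg <- s]) \o
    ampl n n' (frank n [seq (fg.2, fg.1) | fg <- t])).
Proof.
move=> em en aL sC tC; have emn : m + m' = n + n' by rewrite -em.
have ampl0 p q h : ampl p q (frank p [::]) h = fun=> 0.
  apply/funext => x; rewrite /ampl; case: eqP => // _.
  rewrite innerE ip_eq0// => y _; rewrite /kernel /ps_mul frank_nil.
  by case: ifP => _; rewrite ?mul0r rmorph0 mul0r.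
have XA w h : pairs (Cc n) w -> X (m + m') h ->
    X (m + m') (ampl n n' (frank n [seq (fg.2, fg.1) | fg <- w]) h).
  move=> /pairs_X Xw; have [e e0 we] := opbd_frank Xw; rewrite emn => Xh.
  exact: (X_ampl (adjoint_frank Xw) e0 we Xh).
have H f g : Cc m f -> Cc m g -> finite_rank (m + m') (ampl m m' (rank_one m g f) \o
    ampl n n' (frank n [seq (fg.2, fg.1) | fg <- t])).
  move=> cf cg; have ag := adjoint_rank_one (X_Cc cf) (X_Cc cg).
  elim: tC => [|[f2 g2] t' [/= cf2 cg2] t'C IH].
    apply: finite_rank0 => h Xh; rewrite /= ampl0; apply/funext => x.
    by rewrite /ampl; case: eqP => // _; rewrite innerE ip_eq0// => y _; rewrite mulr0.
  have t2C : pairs (Cc n) ((f2, g2) :: t') by exact: List.Forall_cons.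
  apply: finite_rank_eq (finite_rankD
    (ampl_comp_rank_one em en aL cf cg cf2 cg2) IH) => h Xh.
  have Xh' := Xh; rewrite emn in Xh'.
  rewrite [RHS]/= (ampl_swap_cons (pairs_X t2C) Xh') (amplD ag)//; last exact: XA.
  by rewrite emn; apply: X_ampl_rank_one Xh'; exact: X_Cc.
elim: sC => [|[f1 g1] s' [/= cf1 cg1] s'C IH].
  by apply: finite_rank0 => h Xh; rewrite /= ampl0.
have s1C : pairs (Cc m) ((f1, g1) :: s') by exact: List.Forall_cons.
apply: finite_rank_eq (finite_rankD (H f1 g1 cf1 cg1) IH) => h Xh.
by rewrite [RHS]/= (ampl_swap_cons (pairs_X s1C))//; exact: XA.
Qed.

Lemma ampl_swap m n s T S' : pairs (X m) s -> adjoint m T S' ->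
  forall h, X (m + n) h ->
  (fun x => ampl m n S' h x - ampl m n (frank m [seq (fg.2, fg.1) | fg <- s]) h x) =
  ampl m n (fun f x => S' f x - frank m [seq (fg.2, fg.1) | fg <- s] f x) h.
Proof.
move=> Xs TS h Xh; apply/funext => x.
have [dx|dx] := pselect (paths (m + n) x); last by rewrite !ampl_off// subrr.
have As := adjoint_frank Xs.
have E := innerBl (kg_s x) Xh (X_kernel TS dx) (X_kernel As dx).
rewrite !amplE// -E.
have -> // : kernel m n (fun f x => S' f x -
    frank m [seq (fg.2, fg.1) | fg <- s] f x) x = fun y => kernel m n S' x y -
    kernel m n (frank m [seq (fg.2, fg.1) | fg <- s]) x y.
apply/funext => y; rewrite /kernel /ps_mul.
by case: ifP => _; [rewrite mulrBl|rewrite subrr].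
Qed.

(** The error of the approximation is [(A - A1) B + A1 (B - B1)], so that [A1] has
to be chosen according to the norm of [B], and only then [B1] according to the
norm of [A1]. *)
Lemma ps_aligned_of_kgraph :
  kgraph_compactly_aligned L -> ps_compactly_aligned R L.
Proof.
move=> aL m n S T cS cT; set p := deg_join m n.
pose m' := deg_sub p m; pose n' := deg_sub p n.
have em : m + m' = p := deg_joinl m n; have en : n + n' = p := deg_joinr m n.
have [eS eS0 Sb] := compact_opbd cS; have [eT eT0 Tb] := compact_opbd cT.
have [/adjointableP[S' SS'] Sa] := (compact_operatorP m S).1 cS.
have [/adjointableP[T' TT'] Ta] := (compact_operatorP n T).1 cT.
have [/adjointableP[A' AA'] _] := iotaP em cS.
have [/adjointableP[B' BB'] _] := iotaP en cT.
have AE := iota_ampl em cS SS'; have BE := iota_ampl en cT TT'.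
apply/compact_operatorP; split.
  by apply/adjointableP; exists (B' \o A'); exact: adjoint_comp.
move=> e e0; have [XiA _ _] := AA'; have [XiB _ _] := BB'.
set A := Defs.iota m p S in AE AA' XiA *; set B := Defs.iota n p T in BE BB' XiB *.
have Bb : opbd p B (4 * eT).
  apply: (opbd_eq (S := ampl n n' T')) => [h Xh|]; first by rewrite BE.
  by rewrite -en; exact: (ampl_bd TT').
have c1 : 0 <= 16 * (4 * eT) by rewrite !mulr_ge0.
have [d1 d10 d1e] := small_factor c1 (divr_gt0 e0 (ltr0n R 4)).
have [s sC sS] := Sa _ d10; have Xs := pairs_X sC.
pose A1 := ampl m m' (frank m [seq (fg.2, fg.1) | fg <- s]).
have sA : opbd p (fun h x => A h x - A1 h x) (4 * d1).
  have := ampl_bd (n := m') (adjoint_sub SS' (adjoint_frank Xs)) (ltW d10) sS.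
  rewrite em => H; apply: opbd_eq H => h Xh; rewrite AE//.
  by rewrite -em in Xh; rewrite (ampl_swap Xs SS').
have [es es0 sb] := opbd_frank Xs.
have A1b : opbd p A1 (4 * es) by rewrite -em; exact: (ampl_bd (adjoint_frank Xs)).
have c2 : 0 <= 16 * (4 * es) by rewrite !mulr_ge0.
have [d2 d20 d2e] := small_factor c2 (divr_gt0 e0 (ltr0n R 4)).
have [t tC tT] := Ta _ d20; have Xt := pairs_X tC.
pose B1 := ampl n n' (frank n [seq (fg.2, fg.1) | fg <- t]).
have tB : opbd p (fun h x => B h x - B1 h x) (4 * d2).
  have := ampl_bd (n := n') (adjoint_sub TT' (adjoint_frank Xt)) (ltW d20) tT.
  rewrite en => H; apply: opbd_eq H => h Xh; rewrite BE//.
  by rewrite -en in Xh; rewrite (ampl_swap Xt TT').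
have [et et0 tb] := opbd_frank Xt.
have XB1 h : X p h -> X p (B1 h).
  by rewrite -en => Xh; exact: (X_ampl (adjoint_frank Xt) et0 tb).
have [w wC wE] := ampl_comp_frank (esym em) (esym en) aL sC tC.
rewrite em in wC wE; exists w; first exact: wC.
have E1 : opbd p (fun h x => A (B h) x - A1 (B h) x) (4 * d1 * (4 * eT)).
  exact: (opbd_comp XiB sA Bb).
have E2 : opbd p (fun h x => A1 (B h) x - A1 (B1 h) x) (4 * es * (4 * d2)).
  have XBB1 h : X p h -> X p (fun x => B h x - B1 h x).
    by move=> Xh; apply: XB; [exact: XiB|exact: XB1].
  apply: opbd_eq (opbd_comp XBB1 A1b tB) => h Xh /=.
  rewrite /A1 (amplB (adjoint_frank Xs))// em; [exact: XiB|exact: XB1].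
apply: opbd_le (opbd_eq _ (opbd_tri E1 E2)) => [|h Xh]; first lra.
by rewrite -wE.
Qed.

End compact_alignment.

Theorem proposition5p15 (R : realType) (k : nat) (L : topological_kgraph k) :
  ps_compactly_aligned R L <-> kgraph_compactly_aligned L.
Proof.
split; first exact: kgraph_aligned_of_ps.
exact: ps_aligned_of_kgraph.
Qed.
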